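(* Let $\mathcal{L}$ be a boolean constraint language which is not bijunctive, not Horn, and not dual Horn. Then (a) there is a BCS with contexts over $\mathcal{L}$ which is matrix-satisfiable but not satisfiable; and (b) there is a BCS with contexts over $\mathcal{L}$ which is $\mathcal{R}^{\mathcal{U}}$-satisfiable but not matrix-satisfiable.
   Context: Booleans are written multiplicatively: $-1$ is TRUE and $1$ is FALSE. A boolean relation of arity $k\ge 1$ is a subset $R\subseteq\{\pm1\}^k$. A constraint on a finite set of variables $X$ is a pair $(S,R)$, where the scope $S=(s_1,\dots,s_k)$ is a sequence over $X\cup\{\pm1\}$ (so constants may be substituted) and $R$ is a $k$-ary relation. A boolean constraint system (BCS) is a pair $(X,\{C_i\}_{i=1}^m)$ with $X$ a finite set of variables and the $C_i$ constraints on $X$. An assignment to $X$ is a function $\phi:X\to\{\pm1\}$, extended to constants by the identity; $\phi(S)=(\phi(s_1),\dots,\phi(s_k))$; $\phi$ is satisfying if $\phi(S)\in R$ for every constraint $(S,R)$, and non-satisfying otherwise. A BCS with contexts is a tuple $B=(X,\{(U_i,V_i)\}_{i=1}^\ell)$ where $X$ is a finite set of variables, $U_i\subseteq X$, and $(U_i,V_i)$ is a BCS on the variables $U_i$. $\mathscr{A}_{con}(B)$ is the unital complex $*$-algebra generated by $X$ subject to (1) $x^2=1$, $x^*=x$ for $x\in X$; (2) $xy=yx$ for $x,y\in U_i$, $1\le i\le\ell$. For an assignment $\phi$ to $U_i$ put $\Pi_{U_i,\phi}=\prod_{x\in U_i}\frac12(1+\phi(x)x)$. The BCS algebra $\mathscr{A}(B)$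 is the quotient of $\mathscr{A}_{con}(B)$ by the relations (3) $\Pi_{U_i,\phi}=0$ for all $1\le i\le\ell$ and all non-satisfying assignments $\phi$ to $(U_i,V_i)$. $B$ is satisfiable if there is a unital $*$-homomorphism $\mathscr{A}(B)\to\mathbb{C}$; matrix-satisfiable if there is a unital $*$-homomorphism $\mathscr{A}(B)\to M_d(\mathbb{C})$ for some $d\ge1$; $\mathcal{R}^{\mathcal{U}}$-satisfiable if there is a unital $*$-homomorphism $\mathscr{A}(B)\to\mathcal{R}^{\mathcal{U}}$, where $\mathcal{R}^{\mathcal{U}}$ is an ultrapower (by a free ultrafilter on $\mathbb{N}$) of the hyperfinite II$_1$ factor $\mathcal{R}$. A boolean constraint language $\mathcal{L}$ is a collection of relations of possibly different arities. A BCS with contexts is over $\mathcal{L}$ if every relation in every $V_i$ belongs to $\mathcal{L}$. A term is a boolean variable or a constant; a literal is a term (positive literal) or the negation of a term (negative literal); a clause is a disjunction of literals; a CNF is a conjunction of clauses. A relation is bijunctive if it is the set of satisfying assignments of a CNF with at most two literals in every clause; Horn if it is the set of satisfying assignments of a CNF in which every clause has at most one positive literal; dual Horn if it is the set of satisfying assignments of a CNF in which every clause has at most one negative literal. A language is bijunctive (resp. Horn, dual Horn) if every relation in it is. *)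

(* Defs.v *)
From HB Require Import structures.
From mathcomp Require Import all_boot all_order all_algebra.
From mathcomp Require Import sesquilinear.
From mathcomp Require Import complex ring lra.
From mathcomp Require Import all_classical all_reals all_analysis.

Set Implicit Arguments.
Unset Strict Implicit.
Unset Printing Implicit Defensive.

Import Order.TTheory GRing.Theory Num.Theory.
Import numFieldNormedType.Exports.

Local Open Scope ring_scope.
Local Open Scope quotient_scope.

(* A BCS algebra may be the zero ring, which rules out [algType] (its ring is
   nontrivial by definition), and Hierarchy Builder does not allow a new join
   of [pzRingType] and [lmodType]; hence the scalar action is a field here. *)
HB.mixin Record isStarAlg (C : numClosedFieldType) A of GRing.PzRing A := {
  scal : C -> A -> A;
  star : A -> A;
  scalA : forall k l a, scal k (scal l a) = scal (k * l) a;
  scal1 : left_id 1 scal;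
  scalDr : right_distributive scal +%R;
  scalDl : forall a, {morph scal^~ a : k l / k + l};
  scalAl : forall k (a b : A), scal k (a * b) = scal k a * b;
  scalAr : forall k (a b : A), scal k (a * b) = a * scal k b;
  starK : involutive star;
  starD : {morph star : a b / a + b};
  starM : forall a b, star (a * b) = star b * star a;
  starZ : forall k a, star (scal k a) = scal k^* (star a)
}.

#[short(type="starAlgType")]
HB.structure Definition StarAlg (C : numClosedFieldType) :=
  { A of GRing.PzRing A & isStarAlg C A }.

Definition star_hom (C : numClosedFieldType) (A B : starAlgType C)
    (f : {rmorphism A -> B}) : Prop :=
  (forall (k : C) a, f (scal k a) = scal k (f a)) /\
  (forall a, f (star (a : A)) = star (f a)).

Section ScalarsAndMatrices.
Variable C : numClosedFieldType.

Fact self_starM (a b : C) : (a * b)^* = b^* * a^*.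
Proof. by rewrite rmorphM mulrC. Qed.

HB.instance Definition _ := isStarAlg.Build C C^o
  (@mulrA C) (@mul1r C) (@mulrDr C) (fun a k l => mulrDl k l a)
  (@mulrA C) (@mulrCA C) (@conjCK C) (@rmorphD _ _ Num.conj)
  self_starM (@rmorphM _ _ Num.conj).

Variable d : nat.

Definition conj_trmx (A : 'M[C]_d) : 'M[C]_d := (map_mx Num.conj A)^T.

Fact conj_trmxK : involutive conj_trmx.
Proof. by move=> A; apply/matrixP=> i j; rewrite !mxE conjCK. Qed.

Fact conj_trmxD : {morph conj_trmx : A B / A + B}.
Proof. by move=> A B; apply/matrixP=> i j; rewrite !mxE rmorphD. Qed.

Fact conj_trmxM A B : conj_trmx (A * B) = conj_trmx B * conj_trmx A.
Proof. by rewrite /conj_trmx map_mxM trmx_mul. Qed.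

Fact conj_trmxZ k A : conj_trmx (k *: A) = k^* *: conj_trmx A.
Proof. by apply/matrixP=> i j; rewrite !mxE rmorphM. Qed.

HB.instance Definition _ := isStarAlg.Build C 'M[C]_d
  (@scalerA _ _) (@scale1r _ _) (@scalerDr _ _) (fun A k l => scalerDl A k l)
  (fun k A B => scalemxAl k A B) (fun k A B => scalemxAr k A B)
  conj_trmxK conj_trmxD conj_trmxM conj_trmxZ.

End ScalarsAndMatrices.

(* A *-algebra in which equality is replaced by a congruence; its quotient is a
   genuine [starAlgType]. Both presented algebras and ultrapowers are instances. *)
Record starSetoid (C : numClosedFieldType) := StarSetoid {
  ssort :> Type;
  seqv : ssort -> ssort -> Prop;
  szero : ssort; sone : ssort;
  sopp : ssort -> ssort; sadd : ssort -> ssort -> ssort;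
  smul : ssort -> ssort -> ssort;
  sscal : C -> ssort -> ssort; sstar : ssort -> ssort;
  seqv_refl : forall a, seqv a a;
  seqv_sym : forall a b, seqv a b -> seqv b a;
  seqv_trans : forall a b c, seqv a b -> seqv b c -> seqv a c;
  sopp_congr : forall a b, seqv a b -> seqv (sopp a) (sopp b);
  sadd_congr : forall a a' b b', seqv a a' -> seqv b b' ->
    seqv (sadd a b) (sadd a' b');
  smul_congr : forall a a' b b', seqv a a' -> seqv b b' ->
    seqv (smul a b) (smul a' b');
  sscal_congr : forall k a b, seqv a b -> seqv (sscal k a) (sscal k b);
  sstar_congr : forall a b, seqv a b -> seqv (sstar a) (sstar b);
  saddA : forall a b c, seqv (sadd a (sadd b c)) (sadd (sadd a b) c);
  saddC : forall a b, seqv (sadd a b) (sadd b a);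
  sadd0 : forall a, seqv (sadd szero a) a;
  saddN : forall a, seqv (sadd (sopp a) a) szero;
  smulA : forall a b c, seqv (smul a (smul b c)) (smul (smul a b) c);
  smul1l : forall a, seqv (smul sone a) a;
  smul1r : forall a, seqv (smul a sone) a;
  smulDl : forall a b c, seqv (smul (sadd a b) c) (sadd (smul a c) (smul b c));
  smulDr : forall a b c, seqv (smul a (sadd b c)) (sadd (smul a b) (smul a c));
  sscalA : forall k l a, seqv (sscal k (sscal l a)) (sscal (k * l) a);
  sscal1 : forall a, seqv (sscal 1 a) a;
  sscalDr : forall k a b, seqv (sscal k (sadd a b)) (sadd (sscal k a) (sscal k b));
  sscalDl : forall k l a, seqv (sscal (k + l) a) (sadd (sscal k a) (sscal l a));
  sscalAl : forall k a b, seqv (sscal k (smul a b)) (smul (sscal k a) b);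
  sscalAr : forall k a b, seqv (sscal k (smul a b)) (smul a (sscal k b));
  sstarK : forall a, seqv (sstar (sstar a)) a;
  sstarD : forall a b, seqv (sstar (sadd a b)) (sadd (sstar a) (sstar b));
  sstarM : forall a b, seqv (sstar (smul a b)) (smul (sstar b) (sstar a));
  sstarZ : forall k a, seqv (sstar (sscal k a)) (sscal k^* (sstar a))
}.

Section Quotient.
Variables (C : numClosedFieldType) (T : starSetoid C).

Definition seqvb (a b : {classic T}) : bool := `[< @seqv _ T a b >].

Fact seqvb_refl : reflexive seqvb.
Proof. by move=> a; apply/asboolP/seqv_refl. Qed.
Fact seqvb_sym : symmetric seqvb.
Proof. by move=> a b; apply/asboolP/asboolP; apply: seqv_sym. Qed.
Fact seqvb_trans : transitive seqvb.
Proof.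
by move=> b a c /asboolP ab /asboolP bc; apply/asboolP/(seqv_trans ab bc).
Qed.

Canonical seqvb_equiv := EquivRel seqvb seqvb_refl seqvb_sym seqvb_trans.

Definition starQuot := {eq_quot seqvb_equiv}.
HB.instance Definition _ := Choice.on starQuot.

Definition qpi (a : T) : starQuot := \pi_{eq_quot seqvb_equiv} (a : {classic T}).
Definition qrep (q : starQuot) : T :=
  repr (q : {eq_quot seqvb_equiv}) : {classic T}.

Lemma qrepK q : qpi (qrep q) = q.
Proof. exact: reprK. Qed.

Lemma qpiP a b : qpi a = qpi b <-> seqv a b.
Proof.
split=> [/eqmodP/asboolP //|ab].
by apply/eqmodP/asboolP.
Qed.

Lemma qrep_pi a : seqv (qrep (qpi a)) a.
Proof. by apply/qpiP; rewrite qrepK. Qed.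

Definition qadd p q := qpi (sadd (qrep p) (qrep q)).
Definition qopp p := qpi (sopp (qrep p)).
Definition qmul p q := qpi (smul (qrep p) (qrep q)).
Definition qscal k p := qpi (sscal k (qrep p)).
Definition qstar p := qpi (sstar (qrep p)).

Lemma qaddE a b : qadd (qpi a) (qpi b) = qpi (sadd a b).
Proof. by apply/qpiP/sadd_congr; exact: qrep_pi. Qed.
Lemma qoppE a : qopp (qpi a) = qpi (sopp a).
Proof. by apply/qpiP/sopp_congr; exact: qrep_pi. Qed.
Lemma qmulE a b : qmul (qpi a) (qpi b) = qpi (smul a b).
Proof. by apply/qpiP/smul_congr; exact: qrep_pi. Qed.
Lemma qscalE k a : qscal k (qpi a) = qpi (sscal k a).
Proof. by apply/qpiP/sscal_congr; exact: qrep_pi. Qed.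
Lemma qstarE a : qstar (qpi a) = qpi (sstar a).
Proof. by apply/qpiP/sstar_congr; exact: qrep_pi. Qed.

Let qE := (qaddE, qoppE, qmulE, qscalE, qstarE).

Fact qaddA : associative qadd.
Proof.
move=> p q r; rewrite -(qrepK p) -(qrepK q) -(qrepK r) !qE.
exact/qpiP/saddA.
Qed.
Fact qaddC : commutative qadd.
Proof. by move=> p q; rewrite -(qrepK p) -(qrepK q) !qE; exact/qpiP/saddC. Qed.
Fact qadd0 : left_id (qpi (szero T)) qadd.
Proof. by move=> p; rewrite -(qrepK p) !qE; exact/qpiP/sadd0. Qed.
Fact qaddN : left_inverse (qpi (szero T)) qopp qadd.
Proof. by move=> p; rewrite -(qrepK p) !qE; exact/qpiP/saddN. Qed.
Fact qmulA : associative qmul.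
Proof.
move=> p q r; rewrite -(qrepK p) -(qrepK q) -(qrepK r) !qE.
exact/qpiP/smulA.
Qed.
Fact qmul1l : left_id (qpi (sone T)) qmul.
Proof. by move=> p; rewrite -(qrepK p) !qE; exact/qpiP/smul1l. Qed.
Fact qmul1r : right_id (qpi (sone T)) qmul.
Proof. by move=> p; rewrite -(qrepK p) !qE; exact/qpiP/smul1r. Qed.
Fact qmulDl : left_distributive qmul qadd.
Proof.
move=> p q r; rewrite -(qrepK p) -(qrepK q) -(qrepK r) !qE.
exact/qpiP/smulDl.
Qed.
Fact qmulDr : right_distributive qmul qadd.
Proof.
move=> p q r; rewrite -(qrepK p) -(qrepK q) -(qrepK r) !qE.
exact/qpiP/smulDr.
Qed.

HB.instance Definition _ := GRing.isZmodule.Build starQuot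
  qaddA qaddC qadd0 qaddN.
HB.instance Definition _ := GRing.Zmodule_isPzRing.Build starQuot
  qmulA qmul1l qmul1r qmulDl qmulDr.

Fact qscalA k l p : qscal k (qscal l p) = qscal (k * l) p.
Proof. by rewrite -(qrepK p) !qE; exact/qpiP/sscalA. Qed.
Fact qscal1 : left_id 1 qscal.
Proof. by move=> p; rewrite -(qrepK p) !qE; exact/qpiP/sscal1. Qed.
Fact qscalDr : right_distributive qscal +%R.
Proof.
move=> k p q; rewrite -(qrepK p) -(qrepK q) /GRing.add /= !qE.
exact/qpiP/sscalDr.
Qed.
Fact qscalDl p : {morph qscal^~ p : k l / k + l}.
Proof.
move=> k l; rewrite -(qrepK p) [RHS]/GRing.add /= !qE.
exact/qpiP/sscalDl.
Qed.
Fact qscalAl k (p q : starQuot) : qscal k (p * q) = qscal k p * q.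
Proof.
rewrite -(qrepK p) -(qrepK q) /GRing.mul /= !qE.
exact/qpiP/sscalAl.
Qed.
Fact qscalAr k (p q : starQuot) : qscal k (p * q) = p * qscal k q.
Proof.
rewrite -(qrepK p) -(qrepK q) /GRing.mul /= !qE.
exact/qpiP/sscalAr.
Qed.
Fact qstarK : involutive qstar.
Proof. by move=> p; rewrite -(qrepK p) !qE; exact/qpiP/sstarK. Qed.
Fact qstarD : {morph qstar : p q / p + q}.
Proof.
move=> p q; rewrite -(qrepK p) -(qrepK q) /GRing.add /= !qE.
exact/qpiP/sstarD.
Qed.
Fact qstarM (p q : starQuot) : qstar (p * q) = qstar q * qstar p.
Proof.
rewrite -(qrepK p) -(qrepK q) /GRing.mul /= !qE.
exact/qpiP/sstarM.
Qed.
Fact qstarZ k p : qstar (qscal k p) = qscal k^* (qstar p).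
Proof. by rewrite -(qrepK p) !qE; exact/qpiP/sstarZ. Qed.

HB.instance Definition _ := isStarAlg.Build C starQuot
  qscalA qscal1 qscalDr qscalDl qscalAl qscalAr qstarK qstarD qstarM qstarZ.

End Quotient.

Inductive starTerm (C X : Type) :=
| TGen of X
| TZero | TOne
| TOpp of starTerm C X
| TAdd of starTerm C X & starTerm C X
| TMul of starTerm C X & starTerm C X
| TScal of C & starTerm C X
| TStar of starTerm C X.
Arguments TGen {C X} _.
Arguments TZero {C X}.
Arguments TOne {C X}.

(* The least congruence containing [rel] and the axioms of unital *-algebras. *)
Inductive presEqv (C : numClosedFieldType) (X : Type)
    (rel : starTerm C X -> starTerm C X -> Prop) :
    starTerm C X -> starTerm C X -> Prop :=
| PRel a b : rel a b -> presEqv rel a b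
| PRefl a : presEqv rel a a
| PSym a b : presEqv rel a b -> presEqv rel b a
| PTrans a b c : presEqv rel a b -> presEqv rel b c -> presEqv rel a c
| POpp a b : presEqv rel a b -> presEqv rel (TOpp a) (TOpp b)
| PAdd a a' b b' : presEqv rel a a' -> presEqv rel b b' ->
    presEqv rel (TAdd a b) (TAdd a' b')
| PMul a a' b b' : presEqv rel a a' -> presEqv rel b b' ->
    presEqv rel (TMul a b) (TMul a' b')
| PScal k a b : presEqv rel a b -> presEqv rel (TScal k a) (TScal k b)
| PStar a b : presEqv rel a b -> presEqv rel (TStar a) (TStar b)
| PaddA a b c : presEqv rel (TAdd a (TAdd b c)) (TAdd (TAdd a b) c)
| PaddC a b : presEqv rel (TAdd a b) (TAdd b a)
| Padd0 a : presEqv rel (TAdd TZero a) a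
| PaddN a : presEqv rel (TAdd (TOpp a) a) TZero
| PmulA a b c : presEqv rel (TMul a (TMul b c)) (TMul (TMul a b) c)
| Pmul1l a : presEqv rel (TMul TOne a) a
| Pmul1r a : presEqv rel (TMul a TOne) a
| PmulDl a b c : presEqv rel (TMul (TAdd a b) c) (TAdd (TMul a c) (TMul b c))
| PmulDr a b c : presEqv rel (TMul a (TAdd b c)) (TAdd (TMul a b) (TMul a c))
| PscalA k l a : presEqv rel (TScal k (TScal l a)) (TScal (k * l) a)
| Pscal1 a : presEqv rel (TScal 1 a) a
| PscalDr k a b : presEqv rel (TScal k (TAdd a b)) (TAdd (TScal k a) (TScal k b))
| PscalDl k l a : presEqv rel (TScal (k + l) a) (TAdd (TScal k a) (TScal l a))
| PscalAl k a b : presEqv rel (TScal k (TMul a b)) (TMul (TScal k a) b)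
| PscalAr k a b : presEqv rel (TScal k (TMul a b)) (TMul a (TScal k b))
| PstarK a : presEqv rel (TStar (TStar a)) a
| PstarD a b : presEqv rel (TStar (TAdd a b)) (TAdd (TStar a) (TStar b))
| PstarM a b : presEqv rel (TStar (TMul a b)) (TMul (TStar b) (TStar a))
| PstarZ k a : presEqv rel (TStar (TScal k a)) (TScal k^* (TStar a)).

Definition presSetoid (C : numClosedFieldType) (X : Type)
    (rel : starTerm C X -> starTerm C X -> Prop) : starSetoid C :=
  StarSetoid (@PRefl C X rel) (@PSym C X rel) (@PTrans C X rel)
    (@POpp C X rel) (@PAdd C X rel) (@PMul C X rel) (@PScal C X rel)
    (@PStar C X rel) (@PaddA C X rel) (@PaddC C X rel) (@Padd0 C X rel)
    (@PaddN C X rel) (@PmulA C X rel) (@Pmul1l C X rel) (@Pmul1r C X rel)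
    (@PmulDl C X rel) (@PmulDr C X rel) (@PscalA C X rel) (@Pscal1 C X rel)
    (@PscalDr C X rel) (@PscalDl C X rel) (@PscalAl C X rel)
    (@PscalAr C X rel) (@PstarK C X rel) (@PstarD C X rel) (@PstarM C X rel)
    (@PstarZ C X rel).

Definition presAlg (C : numClosedFieldType) (X : Type)
    (rel : starTerm C X -> starTerm C X -> Prop) : starAlgType C :=
  starQuot (presSetoid rel).

(* [true : bool] stands for the value -1 and [false] for the value 1. *)

Record boolrel := BoolRel {
  arity : nat;
  arity_gt0 : (0 < arity)%N;
  tuples : {set arity.-tuple bool}
}.

(* Variables from [Y] and the two constants; used both for scopes of
   constraints and for the terms of a CNF. *)
Inductive term (Y : Type) := Var of Y | Const of bool.
Arguments Const {Y} _.

Definition term_val (Y : Type) (phi : Y -> bool) (t : term Y) : bool :=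
  match t with Var y => phi y | Const b => b end.

Record constraint (Y : Type) := Constraint {
  crel : boolrel;
  scope : (arity crel).-tuple (term Y)
}.

Record bcs (Y : Type) := BCS {
  nconstr : nat;
  constr : 'I_nconstr -> constraint Y
}.

Arguments constr {Y} b j.

Definition constraint_holds (Y : Type) (phi : Y -> bool) (c : constraint Y) :=
  map_tuple (term_val phi) (scope c) \in tuples (crel c).

Definition satisfying (Y : Type) (V : bcs Y) (phi : Y -> bool) : bool :=
  [forall j, constraint_holds phi (constr V j)].

Record bcs_ctx := BCSCtx {
  bvar : finType;
  nctx : nat;
  ctx : 'I_nctx -> {set bvar};
  ctx_bcs : forall i, bcs {x : bvar | x \in ctx i}
}.

Arguments ctx : clear implicits.
Arguments ctx_bcs : clear implicits.

Definition language := boolrel -> Prop.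

Definition over_language (L : language) (B : bcs_ctx) : Prop :=
  forall i j, L (crel (constr (ctx_bcs B i) j)).

Inductive literal (Y : Type) := Pos of term Y | Neg of term Y.

Definition is_pos (Y : Type) (l : literal Y) :=
  if l is Pos _ then true else false.

Definition literal_val (Y : Type) (phi : Y -> bool) (l : literal Y) : bool :=
  match l with Pos t => term_val phi t | Neg t => ~~ term_val phi t end.

Definition clause (Y : Type) := seq (literal Y).
Definition cnf (Y : Type) := seq (clause Y).

Definition cnf_val (Y : Type) (phi : Y -> bool) (f : cnf Y) : bool :=
  all (has (literal_val phi)) f.

Definition cnf_defines (S : boolrel) (f : cnf 'I_(arity S)) : Prop :=
  forall a, (a \in tuples S) = cnf_val (tnth a) f.

Definition bijunctive_rel (S : boolrel) : Prop :=
  exists2 f, @cnf_defines S f & all (fun c => size c <= 2)%N f.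

Definition horn_rel (S : boolrel) : Prop :=
  exists2 f, @cnf_defines S f & all (fun c => count (@is_pos _) c <= 1)%N f.

Definition dual_horn_rel (S : boolrel) : Prop :=
  exists2 f, @cnf_defines S f &
    all (fun c => count (predC (@is_pos _)) c <= 1)%N f.

Definition bijunctive (L : language) := forall S, L S -> bijunctive_rel S.
Definition horn (L : language) := forall S, L S -> horn_rel S.
Definition dual_horn (L : language) := forall S, L S -> dual_horn_rel S.

Section BCSAlgebra.
Variables (C : numClosedFieldType) (B : bcs_ctx).

Notation T := (starTerm C (bvar B)).

(* The order of the factors is that of the enumeration of the context; it is
   immaterial modulo [con_rel]. *)
Definition spectral_proj (i : 'I_(nctx B))
    (phi : {ffun {x | x \in ctx B i} -> bool}) : T :=
  \big[@TMul C (bvar B) / TOne]_(y : {x | x \in ctx B i})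
    TScal 2^-1 (TAdd TOne (TScal ((-1) ^+ phi y) (TGen (val y)))).

Inductive con_rel : T -> T -> Prop :=
| con_sqr x : con_rel (TMul (TGen x) (TGen x)) TOne
| con_star x : con_rel (TStar (TGen x)) (TGen x)
| con_comm i x y : x \in ctx B i -> y \in ctx B i ->
    con_rel (TMul (TGen x) (TGen y)) (TMul (TGen y) (TGen x)).

(* A quotient of the algebra presented by [con_rel] is presented by all the
   relations together. *)
Inductive bcs_rel : T -> T -> Prop :=
| bcs_con a b : con_rel a b -> bcs_rel a b
| bcs_unsat i (phi : {ffun {x | x \in ctx B i} -> bool}) :
    ~~ satisfying (ctx_bcs B i) phi ->
    bcs_rel (@spectral_proj i phi) TZero.

Definition bcs_alg : starAlgType C := presAlg bcs_rel.

Definition sat_in (A : starAlgType C) : Prop :=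
  exists f : {rmorphism bcs_alg -> A}, star_hom f.

End BCSAlgebra.
Arguments bcs_alg C B : clear implicits.
Arguments sat_in {C} B A.

Definition satisfiable (C : numClosedFieldType) (B : bcs_ctx) : Prop :=
  sat_in B (C^o : starAlgType C).

Definition matrix_satisfiable (C : numClosedFieldType) (B : bcs_ctx) : Prop :=
  exists2 d : nat, (0 < d)%N & sat_in B ('M[C]_d : starAlgType C).

(* The form [ip] is linear in its first argument. *)
Definition ip_norm (R : realType) (V : lmodType R[i]) (ip : V -> V -> R[i])
  (x : V) : R := Num.sqrt (complex.Re (ip x x)).

Record hilbert (R : realType) := Hilbert {
  hcarrier :> lmodType R[i];
  ip : {dot hcarrier for Num.conj};
  hilbert_complete : forall u : nat -> hcarrier,
    (forall e : R, 0 < e -> exists N, forall m n, (N <= m)%N -> (N <= n)%N ->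
      ip_norm ip (u m - u n) < e) ->
    exists l, ((fun n => ip_norm ip (u n - l)) @ \oo --> (0 : R))%classic
}.
Arguments ip {R h}.

Section ReLemmas.
Variable R : realType.
Implicit Types z w : R[i].

Lemma cReD z w : complex.Re (z + w) = complex.Re z + complex.Re w.
Proof. by case: z w => [a b] [c d]. Qed.
Lemma cReN z : complex.Re (- z) = - complex.Re z.
Proof. by case: z. Qed.
Lemma cReZ (a : R) z : complex.Re (a%:C%C * z) = a * complex.Re z.
Proof. by case: z => b c /=; rewrite mul0r subr0. Qed.
Lemma cRe_ge0 z : 0 <= z -> 0 <= complex.Re z.
Proof. by case: z => a b; rewrite lecE /= => /andP[]. Qed.
Lemma cRe_conj z : complex.Re (z^*)%R = complex.Re z.
Proof. by case: z. Qed.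
Lemma ge0_cReE z : 0 <= z -> z = (complex.Re z)%:C%C.
Proof. by case: z => a b; rewrite lecE /= => /andP[/eqP -> _]. Qed.

End ReLemmas.

Section Hilbert.
Variables (R : realType) (H : hilbert R).
Implicit Types x y z : H.

Definition hnorm x : R := ip_norm ip x.
Definition hsq x : R := complex.Re (ip x x).

Lemma ipC x y : ip x y = (ip y x)^*.
Proof. by rewrite {1}hermitian_subproof expr0 mul1r. Qed.
Lemma ipDl x y z : ip (x + y) z = ip x z + ip y z.
Proof. exact: linearDl. Qed.
Lemma ipDr x y z : ip z (x + y) = ip z x + ip z y.
Proof. exact: linearDr. Qed.
Lemma ipNl x z : ip (- x) z = - ip x z.
Proof. exact: linearNl. Qed.
Lemma ipNr x z : ip z (- x) = - ip z x.
Proof. exact: linearNr. Qed.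
Lemma ip0l z : ip 0 z = 0.
Proof. exact: linear0l. Qed.
Lemma ip0r z : ip z 0 = 0.
Proof. exact: linear0r. Qed.
Lemma ipZl k x z : ip (k *: x) z = k * ip x z.
Proof. exact: linearZl_LR. Qed.
Lemma ipZr k x z : ip z (k *: x) = k^* * ip z x.
Proof. exact: linearZr_LR. Qed.

Lemma ip_ge0 x : 0 <= ip x x.
Proof.
have [->|x0] := eqVneq x 0; first by rewrite ip0l.
exact/ltW/neq0_dnorm_gt0.
Qed.

Lemma ip_eq0 x : ip x x = 0 -> x = 0.
Proof.
by apply: contra_eq => x0; rewrite gt_eqF //; exact: neq0_dnorm_gt0.
Qed.

Lemma ip_inj x y : (forall z, ip x z = ip y z) -> x = y.
Proof.
move=> xy; apply/eqP; rewrite -subr_eq0; apply/eqP/ip_eq0.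
by rewrite ipDl ipNl xy subrr.
Qed.

Lemma ip_injr x y : (forall z, ip z x = ip z y) -> x = y.
Proof. by move=> xy; apply: ip_inj => z; rewrite ipC xy -ipC. Qed.

Lemma hsq_ge0 x : 0 <= hsq x. Proof. exact/cRe_ge0/ip_ge0. Qed.
Lemma ipxx x : ip x x = (hsq x)%:C%C. Proof. exact/ge0_cReE/ip_ge0. Qed.

Lemma hsqD x y : hsq (x + y) = hsq x + hsq y + (complex.Re (ip x y)) *+ 2.
Proof.
rewrite /hsq ipDl !ipDr !cReD [ip y x]ipC cRe_conj; ring.
Qed.

Lemma hsqN x : hsq (- x) = hsq x.
Proof. by rewrite /hsq ipNl ipNr opprK. Qed.

Lemma hsqD_le x y : hsq (x + y) <= 2 * hsq x + 2 * hsq y.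
Proof.
have := hsq_ge0 (x - y); rewrite !hsqD hsqN ipNr cReN; lra.
Qed.

Lemma hsqZ (k : R[i]) x : hsq (k *: x) = complex.Re (k * k^*) * hsq x.
Proof.
rewrite /hsq ipZl ipZr mulrA ipxx mulrC cReZ mulrC.
by rewrite /hsq ipxx.
Qed.

(* [c] bounds the square of the operator norm. *)
Definition sq_bound (c : R) (f : H -> H) : Prop :=
  0 < c /\ forall x, hsq (f x) <= c * hsq x.

Lemma norm_boundP (I : Type) (f : I -> H -> H) :
  (exists c : R, forall i x, hnorm (f i x) <= c * hnorm x) <->
  (exists c, forall i, sq_bound c (f i)).
Proof.
split=> [[c fc]|[c fc]].
  exists (c ^+ 2 + 1); split=> [|x]; first by rewrite ltr_wpDl ?sqr_ge0.
  have c0 : 0 <= c * hnorm x by rewrite (le_trans _ (fc i x)) ?sqrtr_ge0.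
  have : hnorm (f i x) ^+ 2 <= (c * hnorm x) ^+ 2.
    by rewrite ler_pXn2r ?nnegrE ?sqrtr_ge0.
  rewrite exprMn !sqr_sqrtr ?hsq_ge0 // => /le_trans; apply.
  by rewrite mulrDl lerDl mul1r hsq_ge0.
exists (Num.sqrt c) => i x; have [c0 {}fc] := fc i.
rewrite /hnorm /ip_norm -(sqrtrM _ (ltW c0)).
exact: (ler_wsqrtr (fc x)).
Qed.

Definition adjoint (f g : H -> H) : Prop := forall x y, ip (f x) y = ip x (g y).

Lemma adjointC f g : adjoint f g -> adjoint g f.
Proof. by move=> fg x y; rewrite ipC -fg -ipC. Qed.

Lemma adjoint_linear f g : adjoint f g -> linear f.
Proof. by move=> fg k x y; apply: ip_inj => z; rewrite !(ipDl, ipZl, fg). Qed.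

Lemma adjoint_bound c f g : adjoint f g -> sq_bound c f -> sq_bound c g.
Proof.
move=> fg [c0 fc]; split=> // y; set z := g y.
have := hsq_ge0 (f z - c%:C%C *: y).
rewrite hsqD hsqN hsqZ ipNr ipZr fg -/z ipxx cReN.
have -> : (c%:C%C)^* = c%:C%C :> R[i] by exact: conjc_real.
rewrite -rmorphM !cReZ /= => h.
have := fc z => h2.
have h3 : c * hsq z <= c * (c * hsq y) by lra.
by rewrite -(ler_pM2l c0).
Qed.

Lemma sq_bound0 : sq_bound 1 (fun=> 0).
Proof. by split=> // x; rewrite mul1r {1}/hsq ip0l; exact: hsq_ge0. Qed.
Lemma sq_bound1 : sq_bound 1 id.
Proof. by split=> // x; rewrite mul1r. Qed.
Lemma sq_boundN c f : sq_bound c f -> sq_bound c (fun x => - f x).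
Proof. by move=> [c0 fc]; split=> // x; rewrite hsqN. Qed.
Lemma sq_boundD c d f g : sq_bound c f -> sq_bound d g ->
  sq_bound (2 * c + 2 * d) (fun x => f x + g x).
Proof.
move=> [c0 fc] [d0 gd]; split=> [|x]; first by lra.
by have := hsqD_le (f x) (g x); have := fc x; have := gd x; lra.
Qed.
Lemma sq_boundM c d f g : sq_bound c f -> sq_bound d g ->
  sq_bound (c * d) (f \o g).
Proof.
move=> [c0 fc] [d0 gd]; split=> [|x]; first exact: mulr_gt0.
by rewrite (le_trans (fc _)) // -mulrA ler_pM2l.
Qed.
Lemma sq_boundZ k c f : sq_bound c f ->
  sq_bound ((complex.Re (k * k^*) + 1) * c) (fun x => k *: f x).
Proof.
have k0 : 0 <= complex.Re (k * k^*) by exact/cRe_ge0/mul_conjC_ge0.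
move=> [c0 fc]; split=> [|x]; first by rewrite mulr_gt0 ?ltr_wpDl.
rewrite hsqZ -mulrA (le_trans (ler_wpM2l k0 (fc x))) //.
apply: ler_wpM2r; last by rewrite lerDl.
exact: mulr_ge0 (ltW c0) (hsq_ge0 x).
Qed.

End Hilbert.
Arguments adjoint {R H}.
Arguments hnorm {R H}.

(* A bounded operator is bundled with its adjoint, which exists by the Riesz
   representation theorem and is unique; so this is all of B(H). *)
Record bop (R : realType) (H : hilbert R) := BOp {
  bop_fun :> H -> H;
  bop_adj : H -> H;
  bop_linear : linear bop_fun;
  bop_bounded : exists c : R, forall x, hnorm (bop_fun x) <= c * hnorm x;
  bop_adjoint : adjoint bop_fun bop_adj
}.

Section BoundedOperators.
Variables (R : realType) (H : hilbert R).
Implicit Types S T : bop H.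

Lemma bop_sq_bound T : exists c, sq_bound c T.
Proof.
have /norm_boundP[c /(_ tt)] : exists c : R, forall (i : unit) x,
    hnorm (T x) <= c * hnorm x.
  by have [c Tc] := bop_bounded T; exists c.
by exists c.
Qed.

Fact mk_bop_bounded (f : H -> H) : (exists c, sq_bound c f) ->
  exists c : R, forall x, hnorm (f x) <= c * hnorm x.
Proof.
move=> [c fc]; have /norm_boundP[d fd] : exists c, forall _ : unit, sq_bound c f.
  by exists c.
by exists d; exact: fd tt.
Qed.

Definition mk_bop (f g : H -> H) (fg : adjoint f g)
    (fb : exists c, sq_bound c f) : bop H :=
  BOp (adjoint_linear fg) (mk_bop_bounded fb) fg.

Lemma bopP S T : S =1 T -> S = T.
Proof.
case: S T => [f f' fl fb ff'] [g g' gl gb gg'] /= /funext fg.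
rewrite -{}fg in gl gb gg' *.
have f'g' : f' = g'.
  by apply/funext => y; apply: ip_injr => z; rewrite -ff' gg'.
rewrite -{}f'g' in gg' *.
by congr BOp; exact: Prop_irrelevance.
Qed.

Definition bop_star T : bop H.
Proof.
apply: (@mk_bop (bop_adj T) T); first exact/adjointC/bop_adjoint.
have [c Tc] := bop_sq_bound T.
by exists c; apply: adjoint_bound Tc; exact: bop_adjoint.
Defined.

Definition bop_zero : bop H.
Proof.
apply: (@mk_bop (fun=> 0) (fun=> 0)) => [x y|]; first by rewrite ip0l ip0r.
by exists 1; exact: sq_bound0.
Defined.

Definition bop_one : bop H.
Proof. by apply: (@mk_bop id id) => //; exists 1; exact: sq_bound1. Defined.

Definition bop_opp T : bop H.
Proof.
apply: (@mk_bop (fun x => - T x) (fun x => - bop_adj T x)) => [x y|].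
  by rewrite ipNl ipNr bop_adjoint.
by have [c Tc] := bop_sq_bound T; exists c; exact: sq_boundN.
Defined.

Definition bop_add S T : bop H.
Proof.
apply: (@mk_bop (fun x => S x + T x) (fun x => bop_adj S x + bop_adj T x)).
  by move=> x y; rewrite ipDl ipDr !bop_adjoint.
have [c Sc] := bop_sq_bound S; have [d Td] := bop_sq_bound T.
by exists (2 * c + 2 * d); exact: sq_boundD.
Defined.

Definition bop_mul S T : bop H.
Proof.
apply: (@mk_bop (S \o T) (bop_adj T \o bop_adj S)).
  by move=> x y /=; rewrite !bop_adjoint.
have [c Sc] := bop_sq_bound S; have [d Td] := bop_sq_bound T.
by exists (c * d); exact: sq_boundM.
Defined.

Definition bop_scal (k : R[i]) T : bop H.
Proof.
apply: (@mk_bop (fun x => k *: T x) (fun x => k^* *: bop_adj T x)).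
  by move=> x y; rewrite ipZl ipZr conjCK bop_adjoint.
have [c Tc] := bop_sq_bound T.
by exists ((complex.Re (k * k^*) + 1) * c); exact: sq_boundZ.
Defined.

HB.instance Definition _ := gen_eqMixin (bop H).
HB.instance Definition _ := gen_choiceMixin (bop H).

Fact bop_addA : associative bop_add.
Proof. by move=> S T V; apply: bopP => x /=; rewrite addrA. Qed.
Fact bop_addC : commutative bop_add.
Proof. by move=> S T; apply: bopP => x /=; rewrite addrC. Qed.
Fact bop_add0 : left_id bop_zero bop_add.
Proof. by move=> T; apply: bopP => x /=; rewrite add0r. Qed.
Fact bop_addN : left_inverse bop_zero bop_opp bop_add.
Proof. by move=> T; apply: bopP => x /=; rewrite addNr. Qed.
HB.instance Definition _ := GRing.isZmodule.Build (bop H)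
  bop_addA bop_addC bop_add0 bop_addN.

Fact bopD T x y : T (x + y) = T x + T y.
Proof. by have := bop_linear T 1 x y; rewrite !scale1r. Qed.
Fact bopZ T k x : T (k *: x) = k *: T x.
Proof.
have T0 : T 0 = 0 by apply: (addrI (T 0)); rewrite -bopD !addr0.
by have := bop_linear T k x 0; rewrite T0 !addr0.
Qed.

Fact bop_mulA : associative bop_mul.
Proof. by move=> S T V; apply: bopP. Qed.
Fact bop_mul1l : left_id bop_one bop_mul.
Proof. by move=> T; apply: bopP. Qed.
Fact bop_mul1r : right_id bop_one bop_mul.
Proof. by move=> T; apply: bopP. Qed.
Fact bop_mulDl : left_distributive bop_mul +%R.
Proof. by move=> S T V; apply: bopP. Qed.
Fact bop_mulDr : right_distributive bop_mul +%R.
Proof. by move=> S T V; apply: bopP => x /=; rewrite bopD. Qed.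
HB.instance Definition _ := GRing.Zmodule_isPzRing.Build (bop H)
  bop_mulA bop_mul1l bop_mul1r bop_mulDl bop_mulDr.

Fact bop_scalA k l T : bop_scal k (bop_scal l T) = bop_scal (k * l) T.
Proof. by apply: bopP => x /=; rewrite scalerA. Qed.
Fact bop_scal1 : left_id 1 bop_scal.
Proof. by move=> T; apply: bopP => x /=; rewrite scale1r. Qed.
Fact bop_scalDr : right_distributive bop_scal +%R.
Proof. by move=> k S T; apply: bopP => x /=; rewrite scalerDr. Qed.
Fact bop_scalDl T : {morph bop_scal^~ T : k l / k + l}.
Proof. by move=> k l; apply: bopP => x /=; rewrite scalerDl. Qed.
Fact bop_scalAl k S T : bop_scal k (S * T) = bop_scal k S * T.
Proof. exact: bopP. Qed.
Fact bop_scalAr k S T : bop_scal k (S * T) = S * bop_scal k T.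
Proof. by apply: bopP => x /=; rewrite bopZ. Qed.
Fact bop_starK : involutive bop_star.
Proof. by move=> T; apply: bopP. Qed.
Fact bop_starD : {morph bop_star : S T / S + T}.
Proof. by move=> S T; apply: bopP. Qed.
Fact bop_starM S T : bop_star (S * T) = bop_star T * bop_star S.
Proof. exact: bopP. Qed.
Fact bop_starZ k T : bop_star (bop_scal k T) = bop_scal k^* (bop_star T).
Proof. exact: bopP. Qed.
HB.instance Definition _ := isStarAlg.Build R[i] (bop H)
  bop_scalA bop_scal1 bop_scalDr bop_scalDl bop_scalAl bop_scalAr
  bop_starK bop_starD bop_starM bop_starZ.

Local Open Scope classical_set_scope.

Definition star_subalgebra (A : set (bop H)) : Prop :=
  [/\ A 1, forall S T, A S -> A T -> A (S + T),
      forall (k : R[i]) T, A T -> A (scal k T),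
      forall S T, A S -> A T -> A (S * T) & forall T, A T -> A (star T)].

Definition commutant (A : set (bop H)) : set (bop H) :=
  [set T | forall S, A S -> S * T = T * S].

Definition von_neumann_algebra (M : set (bop H)) : Prop :=
  star_subalgebra M /\ commutant (commutant M) = M.

Definition factor (M : set (bop H)) : Prop :=
  von_neumann_algebra M /\
  forall T, M T -> commutant M T -> exists k : R[i], T = scal k 1.

Definition finite_dimensional (A : set (bop H)) : Prop :=
  exists n (e : 'I_n -> bop H),
    forall T, A T -> exists c : 'I_n -> R[i], T = \sum_i scal (c i) (e i).

Definition positive (T : bop H) : Prop := forall x, 0 <= ip (T x) x.

(* Ultraweak continuity of a functional on [M]: it is a sum of vector
   functionals <T xi_n, eta_n> with square-summable norms. *)
Definition ultraweakly_continuous (M : set (bop H)) (tr : bop H -> R[i]) :=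
  exists xi eta : nat -> H,
    [/\ cvgn (series (fun n => hnorm (xi n) ^+ 2)),
        cvgn (series (fun n => hnorm (eta n) ^+ 2)) &
        forall T, M T ->
          (fun N => \sum_(n < N) ip (T (xi n)) (eta n) : R[i]^o) @ \oo
            --> (tr T : R[i]^o)].

(* Only the values of [tr] on [M] are meaningful. *)
Record tracial_state (M : set (bop H)) (tr : bop H -> R[i]) : Prop := {
  trD : forall S T, M S -> M T -> tr (S + T) = tr S + tr T;
  trZ : forall (k : R[i]) T, M T -> tr (scal k T) = k * tr T;
  tr1 : tr 1 = 1;
  tr_ge0 : forall T, M T -> positive T -> 0 <= tr T;
  trC : forall S T, M S -> M T -> tr (S * T) = tr (T * S);
  tr_faithful : forall T, M T -> tr (star T * T) = 0 -> T = 0;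
  tr_normal : ultraweakly_continuous M tr
}.

(* By the bicommutant theorem, the last clause says that the union of the
   [A n] is weakly dense in [M]. *)
Definition hyperfinite (M : set (bop H)) : Prop :=
  exists A : nat -> set (bop H),
    [/\ forall n, star_subalgebra (A n) /\ finite_dimensional (A n),
        forall n, A n `<=` A n.+1 &
        M = commutant (commutant (\bigcup_n A n))].

End BoundedOperators.

(* The trace is determined by the set of operators, since a II_1 factor has only
   one tracial state. *)
Record hyperfinite_II1_factor (R : realType) := HyperfiniteII1 {
  hf_space : hilbert R;
  hf_set : set (bop hf_space);
  hf_tr : bop hf_space -> R[i];
  hf_factor : factor hf_set;
  hf_infinite : ~ finite_dimensional hf_set;
  hf_trace : tracial_state hf_set hf_tr;
  hf_hyperfinite : hyperfinite hf_set
}.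

Record free_ultrafilter := FreeUltrafilter {
  fu_sets :> set_system nat;
  fu_ultra : UltraFilter fu_sets;
  fu_free : forall n, ~ fu_sets [set n]%classic
}.

#[global] Instance fu_filter (U : free_ultrafilter) : Filter U.
Proof. by case: (fu_ultra U) => -[]. Qed.

Section Ultrapower.
Variables (R : realType) (M : hyperfinite_II1_factor R) (U : free_ultrafilter).

Notation H := (hf_space M).
Notation B := (bop H).
Notation inM := (@hf_set R M).
Notation tr := (@hf_tr R M).

Definition norm2 (T : B) : R := Num.sqrt (complex.Re (tr (star T * T))).

Record bdd_seq := BddSeq {
  bseq :> nat -> B;
  bseq_in : forall n, inM (bseq n);
  bseq_bdd : exists c : R, forall n x, hnorm (bseq n x) <= c * hnorm x
}.

Definition null_seq (u : nat -> B) : Prop :=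
  ((norm2 \o u) @ (fu_sets U) --> (0 : R))%classic.

Definition bseq_eqv (u v : bdd_seq) : Prop := null_seq (fun n => u n - v n).

Let Msub : star_subalgebra inM := (hf_factor M).1.1.
Let trM := hf_trace M.

Let M1 : inM 1. Proof. by have [] := Msub. Qed.
Let MD S T : inM S -> inM T -> inM (S + T).
Proof. by have [_ h _ _ _] := Msub; exact: h. Qed.
Let MZ (k : R[i]) T : inM T -> inM (scal k T).
Proof. by have [_ _ h _ _] := Msub; exact: h. Qed.
Let MM S T : inM S -> inM T -> inM (S * T).
Proof. by have [_ _ _ h _] := Msub; exact: h. Qed.
Let MS T : inM T -> inM (star T).
Proof. by have [_ _ _ _ h] := Msub; exact: h. Qed.
Let scalN1 (T : B) : scal (-1 : R[i]) T = - T.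
Proof. by apply: bopP => x /=; rewrite scaleN1r. Qed.
Let MN T : inM T -> inM (- T).
Proof. by move=> /(MZ (-1)); rewrite scalN1. Qed.
Let M0 : inM 0. Proof. by rewrite -(subrr 1); apply: MD => //; exact: MN. Qed.

Let tsq (T : B) : R := complex.Re (tr (star T * T)).

Let starN (T : B) : star (- T) = - star T.
Proof. exact: bopP. Qed.

Let positive_sq (T : B) : positive (star T * T).
Proof.
by move=> x; rewrite [ip _ _](adjointC (@bop_adjoint _ _ T)) ip_ge0.
Qed.

Let tsq_ge0 T : inM T -> 0 <= tsq T.
Proof.
move=> MT; apply/cRe_ge0/(tr_ge0 trM); last exact: positive_sq.
by apply: MM => //; exact: MS.
Qed.

Let trN T : inM T -> tr (- T) = - tr T.
Proof. by move=> MT; rewrite -scalN1 (trZ trM) // mulN1r. Qed.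

Let tsqD_le S T : inM S -> inM T -> tsq (S + T) <= 2 * tsq S + 2 * tsq T.
Proof.
move=> MS' MT.
have MSq V : inM V -> inM (star V * V) by move=> MV; apply: MM => //; exact: MS.
have MNT := MN MT.
have : tsq (S + T) + tsq (S - T) = 2 * tsq S + 2 * tsq T.
  rewrite /tsq -cReD -(trD trM); [|exact/MSq/MD|exact/MSq/MD].
  have -> : star (S + T) * (S + T) + star (S - T) * (S - T) =
      (star S * S + star T * T) + (star S * S + star T * T).
    rewrite !starD !starN !mulrDl !mulrDr !mulrN !mulNr opprK.
    rewrite addrACA [X in X + _ = _]addrACA subrr addr0.
    by rewrite [X in _ + X = _]addrACA subrr add0r addrACA.
  have MSS := MSq _ MS'; have MTT := MSq _ MT; have MST := MD MSS MTT.
  rewrite (trD trM MST MST) (trD trM MSS MTT) !cReD; ring.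
have := tsq_ge0 (MD MS' MNT); lra.
Qed.

Let tsqM_le c (A T : B) : sq_bound c A -> inM A -> inM T -> tsq (A * T) <= c * tsq T.
Proof.
move=> [c0 Ac] MA MT; rewrite -subr_ge0.
have MTT : inM (star T * T) by apply: MM => //; exact: MS.
have MAT := MM MA MT.
have MATT : inM (star (A * T) * (A * T)) by apply: MM => //; exact: MS.
have -> : c * tsq T - tsq (A * T) =
    complex.Re (tr (scal (c%:C%C : R[i]) (star T * T) - star (A * T) * (A * T))).
  rewrite (trD trM (MZ _ MTT) (MN MATT)) (trZ trM) // trN // cReD cReN.
  by rewrite cReZ.
apply/cRe_ge0/(tr_ge0 trM); first exact/(MD (MZ _ MTT))/MN.
move=> x.
have -> : (scal (c%:C%C : R[i]) (star T * T) - star (A * T) * (A * T)) x =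
  c%:C%C *: (bop_adj T (T x)) - bop_adj T (bop_adj A (A (T x))) by [].
rewrite ipDl ipNl ipZl !(adjointC (@bop_adjoint _ _ _)) !ipxx.
by rewrite -rmorphM -rmorphB lecR subr_ge0.
Qed.

Let tsqS T : inM T -> tsq (star T) = tsq T.
Proof. by move=> MT; rewrite /tsq starK (trC trM) //; exact: MS. Qed.

Let nullP (u : nat -> B) : (forall n, inM (u n)) ->
  null_seq u <->
  forall e : R, 0 < e -> (\forall n \near fu_sets U, tsq (u n) < e)%classic.
Proof.
move=> Mu; rewrite /null_seq; split=> [/cvgr0Pnorm_lt h e e0|h].
  have /h : 0 < Num.sqrt e by rewrite sqrtr_gt0.
  apply: filterS => n /=; rewrite ger0_norm ?sqrtr_ge0 //.
  by rewrite /norm2 ltr_sqrt.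
apply/cvgr0Pnorm_lt => e e0; have /h : 0 < e ^+ 2 by rewrite exprn_gt0.
apply: filterS => n /= ue; rewrite ger0_norm ?sqrtr_ge0 //.
rewrite -(ger0_norm (ltW e0)) -sqrtr_sqr /norm2.
by rewrite ltr_sqrt ?exprn_gt0.
Qed.

Let null_le (c : R) (u v : nat -> B) : 0 < c ->
  (forall n, inM (u n)) -> (forall n, inM (v n)) ->
  (forall n, tsq (v n) <= c * tsq (u n)) -> null_seq u -> null_seq v.
Proof.
move=> c0 Mu Mv uv /(nullP Mu) hu; apply/(nullP Mv) => e e0.
have /hu : 0 < e / c by rewrite divr_gt0.
apply: filterS => n; rewrite ltr_pdivlMr // => h.
by rewrite (le_lt_trans (uv n)) // mulrC.
Qed.

Let null_add (u v : nat -> B) :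
  (forall n, inM (u n)) -> (forall n, inM (v n)) ->
  null_seq u -> null_seq v -> null_seq (fun n => u n + v n).
Proof.
move=> Mu Mv /(nullP Mu) hu /(nullP Mv) hv.
apply/(@nullP (fun n => u n + v n)) => [n|e e0]; first exact: MD.
have e4 : 0 < e / 4 by rewrite divr_gt0.
apply: filterS2 (hu _ e4) (hv _ e4) => n hun hvn.
by have := tsqD_le (Mu n) (Mv n); lra.
Qed.

Let null_eq0 (u : nat -> B) : (forall n, u n = 0) -> null_seq u.
Proof.
move=> u0; have Mu n : inM (u n) by rewrite u0.
apply/(nullP Mu) => e e0; apply: nearW => n; rewrite u0 /tsq mulr0.
by rewrite -(subrr 1) (trD trM) ?trN ?subrr //; exact: MN.
Qed.

Let bseq_sq_bound (u : bdd_seq) : exists c, forall n, sq_bound c (u n).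
Proof. exact/norm_boundP/(bseq_bdd u). Qed.

Let null_mull (a : bdd_seq) (u : nat -> B) : (forall n, inM (u n)) ->
  null_seq u -> null_seq (fun n => a n * u n).
Proof.
move=> Mu; have [c ac] := bseq_sq_bound a.
apply: (@null_le c) => // [|n|n]; first by case: (ac 0).
- by apply: MM => //; exact: bseq_in.
- by apply: tsqM_le => //; exact: bseq_in.
Qed.

Let null_star (u : nat -> B) : (forall n, inM (u n)) ->
  null_seq u -> null_seq (fun n => star (u n)).
Proof.
move=> Mu; apply: (@null_le 1) => // n; first exact: MS.
by rewrite mul1r tsqS.
Qed.

Definition bseq_const (T : B) (MT : inM T) : bdd_seq.
Proof.
by apply: (@BddSeq (fun=> T)) => //; have [c Tc] := bop_bounded T; exists c.
Defined.

Definition bseq_zero : bdd_seq := bseq_const M0.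
Definition bseq_one : bdd_seq := bseq_const M1.

Definition bseq_opp (u : bdd_seq) : bdd_seq.
Proof.
apply: (@BddSeq (fun n => - u n)) => [n|]; first exact/MN/bseq_in.
apply/norm_boundP; have [c uc] := bseq_sq_bound u.
by exists c => n; exact: sq_boundN (uc n).
Defined.

Definition bseq_add (u v : bdd_seq) : bdd_seq.
Proof.
apply: (@BddSeq (fun n => u n + v n)) => [n|]; first by apply: MD; exact: bseq_in.
apply/norm_boundP; have [c uc] := bseq_sq_bound u.
have [d vd] := bseq_sq_bound v.
by exists (2 * c + 2 * d) => n; exact: sq_boundD (uc n) (vd n).
Defined.

Definition bseq_mul (u v : bdd_seq) : bdd_seq.
Proof.
apply: (@BddSeq (fun n => u n * v n)) => [n|]; first by apply: MM; exact: bseq_in.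
apply/norm_boundP; have [c uc] := bseq_sq_bound u.
have [d vd] := bseq_sq_bound v.
by exists (c * d) => n; exact: sq_boundM (uc n) (vd n).
Defined.

Definition bseq_scal (k : R[i]) (u : bdd_seq) : bdd_seq.
Proof.
apply: (@BddSeq (fun n => scal k (u n))) => [n|]; first exact/MZ/bseq_in.
apply/norm_boundP; have [c uc] := bseq_sq_bound u.
by exists ((complex.Re (k * k^*) + 1) * c) => n; exact: sq_boundZ (uc n).
Defined.

Definition bseq_star (u : bdd_seq) : bdd_seq.
Proof.
apply: (@BddSeq (fun n => star (u n))) => [n|]; first exact/MS/bseq_in.
apply/norm_boundP; have [c uc] := bseq_sq_bound u.
by exists c => n; apply: adjoint_bound (uc n); exact: bop_adjoint.
Defined.

Let bseq_eqW (u v : bdd_seq) : (forall n, u n = v n) -> bseq_eqv u v.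
Proof. by move=> uv; apply: null_eq0 => n; rewrite uv subrr. Qed.

Let bseq_inB (u v : bdd_seq) n : inM (u n - v n).
Proof. by apply: MD; [exact: bseq_in|exact/MN/bseq_in]. Qed.

Let null_ext (u v : nat -> B) : (forall n, u n = v n) -> null_seq u -> null_seq v.
Proof. by move=> uv; have -> : u = v by exact/funext. Qed.

Fact bseq_refl u : bseq_eqv u u. Proof. exact: bseq_eqW. Qed.

Fact bseq_opp_congr u v : bseq_eqv u v -> bseq_eqv (bseq_opp u) (bseq_opp v).
Proof.
move=> uv; apply: (@null_le 1 _ _ ltr01 (@bseq_inB u v)
  (@bseq_inB (bseq_opp u) (bseq_opp v)) _ uv) => n.
by rewrite /= -opprD /tsq starN mulrNN mul1r.
Qed.

Fact bseq_sym u v : bseq_eqv u v -> bseq_eqv v u.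
Proof. by move/bseq_opp_congr; apply: null_ext => n /=; rewrite opprK addrC. Qed.

Fact bseq_trans u v w : bseq_eqv u v -> bseq_eqv v w -> bseq_eqv u w.
Proof.
move=> uv vw; apply: null_ext (null_add (@bseq_inB u v) (@bseq_inB v w) uv vw).
by move=> n; rewrite addrA subrK.
Qed.

Fact bseq_add_congr u u' v v' : bseq_eqv u u' -> bseq_eqv v v' ->
  bseq_eqv (bseq_add u v) (bseq_add u' v').
Proof.
move=> uu vv; apply: null_ext (null_add (@bseq_inB u u') (@bseq_inB v v') uu vv).
by move=> n /=; rewrite addrACA opprD.
Qed.

Fact bseq_star_congr u v : bseq_eqv u v -> bseq_eqv (bseq_star u) (bseq_star v).
Proof.
move=> uv; apply: null_ext (null_star (@bseq_inB u v) uv).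
by move=> n; rewrite starD starN.
Qed.

Let bseq_mull a u v : bseq_eqv u v -> bseq_eqv (bseq_mul a u) (bseq_mul a v).
Proof.
move=> uv; apply: null_ext (null_mull a (@bseq_inB u v) uv).
by move=> n; rewrite mulrBr.
Qed.

Fact bseq_mul_congr u u' v v' : bseq_eqv u u' -> bseq_eqv v v' ->
  bseq_eqv (bseq_mul u v) (bseq_mul u' v').
Proof.
move=> uu vv; apply: (bseq_trans (bseq_mull u vv)).
have := bseq_star_congr (bseq_mull (bseq_star v') (bseq_star_congr uu)).
by apply: null_ext => n /=; rewrite !starM !starK.
Qed.

Fact bseq_scal_congr k u v : bseq_eqv u v ->
  bseq_eqv (bseq_scal k u) (bseq_scal k v).
Proof.
move/(bseq_mull (bseq_const (MZ k M1))); apply: null_ext => n /=.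
by rewrite -!scalAl !mul1r.
Qed.

Definition ultra_setoid : starSetoid R[i].
Proof.
by apply: (@StarSetoid R[i] bdd_seq bseq_eqv bseq_zero bseq_one bseq_opp bseq_add
  bseq_mul bseq_scal bseq_star bseq_refl bseq_sym bseq_trans bseq_opp_congr
  bseq_add_congr bseq_mul_congr bseq_scal_congr bseq_star_congr) => *;
  apply: bseq_eqW => n /=;
  rewrite ?(addrA, add0r, addNr, mulrA, mul1r, mulr1, mulrDl, mulrDr, scalA,
    scal1, scalDr, scalDl, scalAl, starK, starD, starM, starZ) //;
  rewrite 1?addrC // -?scalAl ?scalAr.
Defined.

Definition ultrapower : starAlgType R[i] := starQuot ultra_setoid.

End Ultrapower.

(* The hyperfinite II_1 factor is unique up to trace-preserving *-isomorphism
   (Murray and von Neumann), so the choice of a realization [M] is immaterial. *)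
Definition RU_satisfiable (R : realType) (U : free_ultrafilter) (B : bcs_ctx) :
  Prop := exists M : hyperfinite_II1_factor R, sat_in B (ultrapower M U).

(* Main.v *)
(* By Schaefer's analysis a language that is neither bijunctive nor Horn nor dual Horn
   pp-defines, with constants, the parity constraint x + y + z = c; keeping all
   auxiliary variables inside one context, BCS algebras over L then realise arbitrary
   systems of equations x y z = +-1 between commuting self-adjoint involutions. The
   Mermin-Peres magic square adds relations x y = w y x to these.

   (a) Take w = -1: anticommuting involutions exist in matrix algebras but not in C.

   (b) Let p, q be involutions and a = p q. Conjugation of a to a^2 by a product of
   two involutions, and of a to -a by a third, can be written with such relations.
   In M_d this is impossible: the finite spectrum of a would be mapped onto itself,
   hence injectively, by squaring, although it contains l and -l. It does hold up to
   an error tending to 0 in matrix algebras of size 2^m when a has the odd multiples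
   of pi / N as its arguments. These algebras embed in the hyperfinite factor, built
   as the von Neumann algebra generated on l^2 by the twisted regular representation
   of an infinite elementary abelian 2-group, and in its ultrapower the errors
   vanish. *)
Require Import Defs.
From HB Require Import structures.
From mathcomp Require Import all_boot all_order all_algebra.
From mathcomp Require Import zify complex mxtens ring lra.
From mathcomp Require Import all_classical all_reals all_analysis.

Set Implicit Arguments.
Unset Strict Implicit.
Unset Printing Implicit Defensive.

Import Order.TTheory GRing.Theory Num.Theory.
Import numFieldNormedType.Exports.

(** * Definability of parity *)

(** The parity constraint arises in two stages. Failure of closure under conjunction and under
    disjunction yields the relation [x != y], hence negation; failure under majority then yields a
    ternary relation that contains the triples of weight one but not the zero triple, and after
    symmetrisation only four cases are left. The obstacle in (b) is that equations relate commuting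
    variables only. A conjugation [x a x = b] is the commutator relation [x a = (a b) a x], which
    can be imposed only when [a] and [b] commute, and [q] does not commute with [q p q]. So each
    operator is first flipped into another tensor factor, where it commutes with its origin and its
    destination, and then brought back. This is why two reflections stand for one unitary and why
    [q p q] itself is reached in two steps. A magic square forces a commutator, but a model must
    also supply the other entries of the square. They are built from an anticommuting pair that
    commutes with all other operators, whence a last Pauli factor in every model. The finite models
    fail in one relation only, and the error there is a multiple of a unitary, so its trace norm is
    explicit. *)

Section Closure.
Variable S : boolrel.
Notation k := (arity S).
Implicit Types a b s : k.-tuple bool.

Definition lit (e : bool) (i : 'I_k) : literal 'I_k :=
  if e then Pos (Var i) else Neg (Var i).

Lemma lit_val e i a : literal_val (tnth a) (lit e i) = (tnth a i == e).
Proof. by case: e => /=; case: (tnth a i). Qed.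

(* Conjunction for [e = true], disjunction for [e = false]. *)
Definition meet (e x y : bool) : bool := if (x == e) && (y == e) then e else ~~ e.

Definition tmeet e a b : k.-tuple bool :=
  [tuple meet e (tnth a i) (tnth b i) | i < k].

Definition value_set (e : bool) a : {set 'I_k} := [set i | tnth a i == e].

Lemma value_set_meet e a b :
  value_set e (tmeet e a b) = value_set e a :&: value_set e b.
Proof.
apply/setP=> i; rewrite !inE tnth_mktuple /meet.
by case: (tnth a i); case: (tnth b i); case: e.
Qed.

Lemma value_set_inj e a b : value_set e a = value_set e b -> a = b.
Proof.
move=> ab; apply: eq_from_tnth => i; have /setP/(_ i) := ab; rewrite !inE.
by case: (tnth a i); case: (tnth b i); case: (e).
Qed.

Definition forced e a j :=
  (tnth a j != e) && [forall s in tuples S,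
    (value_set e a \subset value_set e s) ==> (tnth s j == e)].

(** The rule violated by [a]: when all coordinates at which [a] has value [e] take that value, so
    does [j]. Without a forced [j] the head is empty and the body is forbidden outright. The head is
    the only literal of sign [e], so the clause is Horn for [e = true] and dual Horn for
    [e = false]. *)
Definition implication e a : clause 'I_k :=
  [seq lit (~~ e) i | i <- enum (value_set e a)] ++
  (if [pick j | forced e a j] is Some j then [:: lit e j] else [::]).

Lemma implicationP e a s : has (literal_val (tnth s)) (implication e a) =
  ~~ (value_set e a \subset value_set e s) ||
  (if [pick j | forced e a j] is Some j then tnth s j == e else false).
Proof.
rewrite has_cat has_map; congr orb; last first.
  by case: pickP => //= j _; rewrite lit_val orbF.
rewrite -[LHS]negbK -all_predC; congr (~~ _); apply/allP/fintype.subsetP => h i.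
  rewrite !inE => ai; have := h i; rewrite mem_enum inE ai => /(_ isT) /=.
  by rewrite lit_val; case: (tnth s i); case: (e).
rewrite mem_enum => /h; rewrite inE /= lit_val => /eqP->.
by case: (e).
Qed.

(** Let [a] lie outside [S]. Among the members of [S] whose [e]-set contains that of [a], one with
    the fewest entries [e] lies below all others, because its meet with another cannot be smaller.
    It differs from [a], and a coordinate where it does is forced. So the head is empty only if no
    member of [S] lies above [a]. *)
Lemma cnf_of_meet_closed e :
  (forall a b, a \in tuples S -> b \in tuples S -> tmeet e a b \in tuples S) ->
  cnf_defines [seq implication e a | a <- enum (~: tuples S)].
Proof.
move=> cl c; rewrite /cnf_val all_map; apply/idP/allP => [cS a|h].
  rewrite mem_enum inE => aS; rewrite /= implicationP; case: (boolP (_ \subset _)) => //= ac.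
  case: pickP => [j /andP[_ /forall_inP/(_ c cS)]|none]; first by rewrite ac.
  pose Q := [pred m : k.-tuple bool |
    (m \in tuples S) && (value_set e a \subset value_set e m)].
  have Qc : Q c by rewrite /= cS.
  case: (arg_minnP (fun m : k.-tuple bool => #|value_set e m|) Qc)
    => m /andP[mS am] mmin.
  have /negP[] : ~~ (value_set e m \subset value_set e a).
    apply: contra aS => ma; suff -> : a = m by [].
    by apply: (@value_set_inj e); apply/eqP; rewrite finset.eqEsubset am ma.
  apply/fintype.subsetP => j; rewrite !inE => mj; apply/negPn/negP => aj.
  have := none j; rewrite /forced aj /= => /negP[]; apply/forall_inP => s sS.
  apply/implyP => as_.
  have /mmin : Q (tmeet e m s) by rewrite /= cl //= value_set_meet finset.subsetI am.
  rewrite value_set_meet => /(conj (subsetIl (value_set e m) (value_set e s))).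
  move=> /andP; rewrite -eqEcard => /eqP/setP/(_ j).
  by rewrite !inE mj.
apply/negPn/negP => cS; have /h : c \in enum (~: tuples S).
  by rewrite mem_enum inE.
rewrite /= implicationP fintype.subxx /=; case: pickP => // j /andP[/negP cj _] //.
Qed.

Lemma count_implication e a :
  count (fun l => is_pos l == e) (implication e a) <= 1.
Proof.
rewrite count_cat; have /eqP -> : count (fun l => is_pos l == e)
    [seq lit (~~ e) i | i <- enum (value_set e a)] == 0.
  by rewrite -leqn0 leqNgt -has_count has_map; apply/hasPn => i _ /=; case: (e).
by case: pickP => //= j _; case: (_ == _).
Qed.

Lemma horn_of_closed :
  (forall a b, a \in tuples S -> b \in tuples S -> tmeet true a b \in tuples S) ->
  horn_rel S.
Proof.
move=> /cnf_of_meet_closed def; exists (map (implication true)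
  (enum (~: tuples S))) => //.
rewrite all_map; apply/allP => a _; apply: leq_trans (count_implication true a).
by apply: sub_count => l /= ->.
Qed.

Lemma dual_horn_of_closed :
  (forall a b, a \in tuples S -> b \in tuples S -> tmeet false a b \in tuples S) ->
  dual_horn_rel S.
Proof.
move=> /cnf_of_meet_closed def; exists (map (implication false)
  (enum (~: tuples S))) => //.
rewrite all_map; apply/allP => a _; apply: leq_trans (count_implication false a).
by apply: sub_count => l /= /negbTE->.
Qed.

Definition maj (x y z : bool) : bool := [|| x && y, y && z | x && z].

Definition tmaj a b c : k.-tuple bool :=
  [tuple maj (tnth a i) (tnth b i) (tnth c i) | i < k].

Definition agree (c s : k.-tuple bool) i := tnth s i == tnth c i.

(* Baker and Pixley: a relation closed under the majority operation is
   determined by its projections to pairs of coordinates. *)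
Lemma agree_on_pairs c :
  (forall a b d, a \in tuples S -> b \in tuples S -> d \in tuples S ->
    tmaj a b d \in tuples S) ->
  (forall i j, exists2 s, s \in tuples S & agree c s i && agree c s j) ->
  c \in tuples S.
Proof.
move=> cl pairs.
suff [s sS cs] : exists2 s, s \in tuples S & {in enum 'I_k, forall i, agree c s i}.
  suff -> : c = s by [].
  by apply: eq_from_tnth => i; apply/esym/eqP/cs; rewrite mem_enum.
have [n] := ubnP (size (enum 'I_k)); move: (enum 'I_k) => r.
elim: n r => // n IH [|i [|j [|l r]]] /=.
- have [s sS _] := pairs (Ordinal (arity_gt0 S)) (Ordinal (arity_gt0 S)).
  by exists s.
- have [s sS /andP[si _]] := pairs i i.
  by exists s => // x; rewrite inE => /eqP->.
- have [s sS /andP[si sj]] := pairs i j.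
  by exists s => // x; rewrite !inE => /orP[] /eqP->.
rewrite !ltnS => rn.
have [s1 s1S h1] := IH (j :: l :: r) rn.
have [s2 s2S h2] := IH (i :: l :: r) rn.
have [s3 s3S h3] := IH (i :: j :: r) rn.
(* Each of the three tuples may miss [c] at one of [i], [j], [l] only, so at every coordinate at
   least two of them vote for [c]. *)
exists (tmaj s1 s2 s3); first exact: cl.
have majP x : (agree c s1 x && agree c s2 x) || (agree c s2 x && agree c s3 x)
    || (agree c s1 x && agree c s3 x) -> agree c (tmaj s1 s2 s3) x.
  rewrite /agree tnth_mktuple /maj.
  by case: (tnth s1 x); case: (tnth s2 x); case: (tnth s3 x); case: (tnth c x).
move=> x; rewrite !inE => /or4P[/eqP->|/eqP->|/eqP->|xr]; apply: majP.
- by rewrite (h2 i) ?(h3 i) ?orbT // !inE eqxx.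
- by rewrite (h1 j) ?(h3 j) ?orbT // !inE eqxx ?orbT.
- by rewrite (h1 l) ?(h2 l) ?orbT // !inE eqxx ?orbT.
- by rewrite (h1 x) ?(h2 x) ?orbT // !inE xr ?orbT.
Qed.

(** By [agree_on_pairs], a tuple outside [S] has two coordinates at which no member of [S] shares
    both of its values. The clause with these two literals excludes the tuple and nothing in [S]. *)
Lemma bijunctive_of_closed :
  (forall a b d, a \in tuples S -> b \in tuples S -> d \in tuples S ->
    tmaj a b d \in tuples S) -> bijunctive_rel S.
Proof.
move=> cl.
pose bad c (ij : 'I_k * 'I_k) := [forall s in tuples S,
  ~~ (agree c s ij.1 && agree c s ij.2)].
pose cla c : clause 'I_k := if [pick ij | bad c ij] is Some ij
  then [:: lit (~~ tnth c ij.1) ij.1; lit (~~ tnth c ij.2) ij.2] else [::].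
exists [seq cla c | c <- enum (~: tuples S)]; last first.
  by rewrite all_map; apply/allP => c _; rewrite /= /cla; case: pickP.
have clP c s : has (literal_val (tnth s)) (cla c) =
    if [pick ij | bad c ij] is Some ij
    then ~~ (agree c s ij.1 && agree c s ij.2) else false.
  rewrite /cla; case: pickP => //= ij _; rewrite !lit_val orbF negb_and /agree.
  by case: (tnth s _); case: (tnth c _); case: (tnth s _); case: (tnth c _).
move=> c; rewrite /cnf_val all_map; apply/idP/allP => [cS a|h].
  rewrite mem_enum inE => aS; rewrite /= clP.
  case: pickP => [ij /forall_inP/(_ c cS)//|none].
  case/negP: aS; apply: agree_on_pairs => // i j.
  have /negbT := none (i, j); rewrite negb_forall_in => /exists_inP[s sS].
  by rewrite negbK => /=; exists s.
apply/negPn/negP => cS; have /h : c \in enum (~: tuples S).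
  by rewrite mem_enum inE.
by rewrite /= clP; case: pickP => // ij _; rewrite /agree !eqxx.
Qed.

End Closure.

Lemma not_closed (P : boolrel -> Prop) (L : language) :
  ~ (forall S, L S -> P S) -> exists2 S, L S & ~ P S.
Proof. by move=> /existsNP[S /not_implyP[LS PS]]; exists S. Qed.

(** * Primitive positive definitions and the parity relation *)

Section PPDefinability.
Variable L : language.

Definition sum_val (Y Z : Type) (phi : Y -> bool) (psi : Z -> bool)
  (t : Y + Z) : bool :=
  match t with inl y => phi y | inr z => psi z end.

Definition bind (Y Y' : Type) (f : Y -> term Y') (t : term Y) : term Y' :=
  match t with Var y => f y | Const b => Const b end.

Definition constraint_bind (Y Y' : Type) (f : Y -> term Y') (c : constraint Y) :
  constraint Y' := Constraint (map_tuple (bind f) (scope c)).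

Lemma bind_val (Y Y' : Type) (f : Y -> term Y') phi t :
  term_val phi (bind f t) = term_val (term_val phi \o f) t.
Proof. by case: t. Qed.

Lemma term_val_ext (Y : Type) (phi psi : Y -> bool) :
  phi =1 psi -> term_val phi =1 term_val psi.
Proof. by move=> e [y|b] /=. Qed.

Lemma constraint_holds_ext (Y : Type) (phi psi : Y -> bool) c :
  phi =1 psi -> constraint_holds phi c = constraint_holds psi c.
Proof.
move=> e; rewrite /constraint_holds.
suff -> : map_tuple (term_val phi) (scope c) = map_tuple (term_val psi) (scope c).
  by [].
by apply: eq_from_tnth => i; rewrite !tnth_map (term_val_ext e).
Qed.

Lemma satisfying_ext (Y : Type) (V : bcs Y) (phi psi : Y -> bool) :
  phi =1 psi -> satisfying V phi = satisfying V psi.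
Proof. by move=> e; apply: eq_forallb => j; exact: constraint_holds_ext. Qed.

Lemma constraint_bind_holds (Y Y' : Type) (f : Y -> term Y') phi c :
  constraint_holds phi (constraint_bind f c) =
  constraint_holds (term_val phi \o f) c.
Proof.
rewrite /constraint_holds /=.
suff -> : map_tuple (term_val phi) (map_tuple (bind f) (scope c)) =
    map_tuple (term_val (term_val phi \o f)) (scope c) by [].
by apply: eq_from_tnth => i; rewrite !tnth_map bind_val.
Qed.

Lemma satisfying_eq1 (Y : Type) (V : bcs Y) (phi psi : Y -> bool) :
  phi =1 psi -> satisfying V phi -> satisfying V psi.
Proof. by move=> /satisfying_ext ->. Qed.

Definition bcs_bind (Y Y' : Type) (f : Y -> term Y') (V : bcs Y) : bcs Y' :=
  BCS (fun j => constraint_bind f (constr V j)).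

Lemma bcs_bind_sat (Y Y' : Type) (f : Y -> term Y') (V : bcs Y) phi :
  satisfying (bcs_bind f V) phi = satisfying V (term_val phi \o f).
Proof. by apply: eq_forallb => j; exact: constraint_bind_holds. Qed.

Definition bcs_cat (Y : Type) (V W : bcs Y) : bcs Y :=
  BCS (fun j : 'I_(nconstr V + nconstr W) =>
    match fintype.split j with inl i => constr V i | inr i => constr W i end).

Lemma bcs_cat_sat (Y : Type) (V W : bcs Y) phi :
  satisfying (bcs_cat V W) phi = satisfying V phi && satisfying W phi.
Proof.
apply/forallP/andP => [h|[/forallP hV /forallP hW] j /=]; last first.
  by rewrite /constr /=; case: (fintype.split j).
split; apply/forallP => j.
  by have := h (lshift _ j); rewrite /= (unsplitK (inl j)).
by have := h (rshift _ j); rewrite /= (unsplitK (inr j)).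
Qed.

Definition bcs_over (Y : Type) (V : bcs Y) := forall j, L (crel (constr V j)).

Lemma bcs_cat_over (Y : Type) (V W : bcs Y) :
  bcs_over V -> bcs_over W -> bcs_over (bcs_cat V W).
Proof. by move=> hV hW j; rewrite /constr /=; case: (fintype.split j). Qed.

(** Primitive positive definability over [L], with constants but without a built-in equality
    relation. *)
Definition pp (Y : Type) (P : (Y -> bool) -> Prop) : Prop :=
  exists (Z : finType) (V : bcs (Y + Z)), bcs_over V /\
    forall phi, P phi <-> exists psi, satisfying V (sum_val phi psi).

Lemma pp_ext (Y : Type) (P Q : (Y -> bool) -> Prop) :
  (forall phi, P phi <-> Q phi) -> pp P -> pp Q.
Proof.
move=> PQ [Z [V [VL h]]]; exists Z, V; split=> // phi.
by rewrite -PQ.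
Qed.

Lemma pp_rel (Y : Type) (S : boolrel) (t : 'I_(arity S) -> term Y) : L S ->
  pp (fun phi => [tuple term_val phi (t i) | i < arity S] \in tuples S).
Proof.
move=> LS; pose f (y : Y) : term (Y + void) := Var (inl y).
exists void, (BCS (fun _ : 'I_1 => @Constraint _ S [tuple bind f (t i) | i < _])).
split=> // phi.
have e psi : [tuple term_val phi (t i) | i < arity S] =
    map_tuple (term_val (sum_val phi psi)) [tuple bind f (t i) | i < arity S].
  apply: eq_from_tnth => i; rewrite !(tnth_map, tnth_mktuple) bind_val /=.
  exact: term_val_ext.
split=> [h|[psi /forallP/(_ ord0)]]; last by rewrite /constraint_holds /= -e.
exists (of_void _); apply/forallP => j; rewrite /constraint_holds /=.
by rewrite -e.
Qed.

Lemma pp_true (Y : Type) : pp (fun _ : Y -> bool => True).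
Proof.
exists void, (BCS (fun j : 'I_0 => False_rect _ (notF (ltn_ord j)))).
split=> [[]|phi] //; split=> // _; exists (of_void _).
by apply/forallP => -[].
Qed.

Lemma pp_and (Y : Type) (P Q : (Y -> bool) -> Prop) :
  pp P -> pp Q -> pp (fun phi => P phi /\ Q phi).
Proof.
move=> [Z1 [V1 [VL1 h1]]] [Z2 [V2 [VL2 h2]]].
pose f1 (t : Y + Z1) : term (Y + (Z1 + Z2)) :=
  Var (match t with inl y => inl y | inr z => inr (inl z) end).
pose f2 (t : Y + Z2) : term (Y + (Z1 + Z2)) :=
  Var (match t with inl y => inl y | inr z => inr (inr z) end).
exists (Z1 + Z2)%type, (bcs_cat (bcs_bind f1 V1) (bcs_bind f2 V2)); split.
  by apply: bcs_cat_over => j; [exact: VL1|exact: VL2].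
move=> phi; rewrite h1 h2; split=> [[[p1 s1] [p2 s2]]|[p]].
  exists (sum_val p1 p2); rewrite bcs_cat_sat !bcs_bind_sat.
  by apply/andP; split; [apply: satisfying_eq1 s1|apply: satisfying_eq1 s2]; case.
rewrite bcs_cat_sat !bcs_bind_sat => /andP[s1 s2].
split; [exists (p \o inl)|exists (p \o inr)].
- by apply: satisfying_eq1 s1; case.
- by apply: satisfying_eq1 s2; case.
Qed.

Lemma pp_forall_seq (Y : Type) (I : eqType) (r : seq I)
  (P : I -> (Y -> bool) -> Prop) : (forall i, pp (P i)) ->
  pp (fun phi => forall i, i \in r -> P i phi).
Proof.
move=> hP; elim: r => [|i r IH]; first exact: pp_ext (pp_true Y).
apply: pp_ext (pp_and (hP i) IH) => phi.
split=> [[h1 h2] j|h]; first by rewrite inE => /predU1P[->|/h2].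
by split=> [|j jr]; apply: h; rewrite inE ?eqxx ?jr ?orbT.
Qed.

Lemma pp_forall (Y : Type) (I : finType) (P : I -> (Y -> bool) -> Prop) :
  (forall i, pp (P i)) -> pp (fun phi => forall i, P i phi).
Proof.
move=> /(pp_forall_seq (enum I)); apply: pp_ext => phi.
by split=> h i // ; apply: h; rewrite mem_enum.
Qed.

Lemma pp_ex (Y : Type) (Z : finType) (P : (Y + Z -> bool) -> Prop) : pp P ->
  pp (fun phi => exists psi : Z -> bool, P (sum_val phi psi)).
Proof.
move=> [Z' [V [VL h]]].
pose f (t : Y + Z + Z') : term (Y + (Z + Z')) :=
  Var (match t with
    | inl (inl y) => inl y | inl (inr z) => inr (inl z) | inr z => inr (inr z)
  end).
exists (Z + Z')%type, (bcs_bind f V); split=> [j|phi]; first exact: VL.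
split=> [[psi /h[psi' hV]]|[psi hV]].
  exists (sum_val psi psi'); rewrite bcs_bind_sat; apply: satisfying_eq1 hV.
  by move=> [[y|z]|z].
exists (psi \o inl); apply/h; exists (psi \o inr).
by move: hV; rewrite bcs_bind_sat; apply: satisfying_eq1 => -[[y|z]|z].
Qed.

(** Quantifying over terms instead of variables makes permutation and identification of arguments
    and substitution of constants free. *)
Definition pp2 (P : bool -> bool -> Prop) := forall (Y : Type) (s t : term Y),
  pp (fun phi => P (term_val phi s) (term_val phi t)).

Definition pp3 (P : bool -> bool -> bool -> Prop) :=
  forall (Y : Type) (s t u : term Y),
  pp (fun phi => P (term_val phi s) (term_val phi t) (term_val phi u)).

Lemma pp3_ext (P Q : bool -> bool -> bool -> Prop) :
  (forall x y z, P x y z <-> Q x y z) -> pp3 P -> pp3 Q.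
Proof. by move=> PQ hP Y s t u; apply: pp_ext (hP Y s t u) => phi; exact: PQ. Qed.

Definition inlt (Y Z : Type) (t : term Y) : term (Y + Z) :=
  bind (fun y => Var (inl y)) t.

Lemma inlt_val (Y Z : Type) (t : term Y) phi (psi : Z -> bool) :
  term_val (sum_val phi psi) (inlt Z t) = term_val phi t.
Proof. by case: t. Qed.

Lemma pp_ex1 (Y : Type) (P : (Y + unit -> bool) -> Prop)
  (Q : (Y -> bool) -> bool -> Prop) :
  (forall phi psi, P (sum_val phi psi) <-> Q phi (psi tt)) -> pp P ->
  pp (fun phi => exists b, Q phi b).
Proof.
move=> PQ /pp_ex; apply: pp_ext => phi.
by split=> [[psi /PQ]|[b hb]]; [exists (psi tt)|exists (fun=> b); apply/PQ].
Qed.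

Let newv (Y : Type) : term (Y + unit) := Var (inr tt).

Section Parity.
Hypothesis neq_pp : pp2 (fun x y => x != y).

Lemma pp3_rot P : pp3 P -> pp3 (fun x y z => P y z x).
Proof. by move=> hP Y s t u; exact: hP. Qed.

Lemma pp3_neg1 P : pp3 P -> pp3 (fun x y z => P (~~ x) y z).
Proof.
move=> hP Y s t u.
have := @pp_ex1 Y _ (fun phi b => term_val phi s != b /\ P b (term_val phi t) (term_val phi u)) _
  (pp_and (neq_pp (inlt _ s) (newv Y)) (hP _ (newv Y) (inlt _ t) (inlt _ u))).
move=> h; apply: pp_ext (h _) => [phi|phi psi]; last by rewrite !inlt_val.
split=> [[b [+ hb]]|hb]; first by case: (term_val phi s) hb; case: b.
by exists (~~ term_val phi s); split=> //; case: (term_val phi s).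
Qed.

Lemma pp3_neg2 P : pp3 P -> pp3 (fun x y z => P x (~~ y) z).
Proof. by move=> /(fun h => pp3_rot (pp3_rot h))/pp3_neg1/pp3_rot. Qed.

Lemma pp3_neg3 P : pp3 P -> pp3 (fun x y z => P x y (~~ z)).
Proof. by move=> /pp3_rot/pp3_neg1/pp3_rot/pp3_rot. Qed.

Lemma pp3_and P Q : pp3 P -> pp3 Q -> pp3 (fun x y z => P x y z /\ Q x y z).
Proof. by move=> hP hQ Y s t u; exact: pp_and. Qed.

Let odd3 x y z := x (+) y (+) z.
Let or3 x y z := [|| x, y | z].

(** Each sign pattern of [or3] excludes a single triple; the four patterns used exclude exactly the
    triples of even weight. *)
Lemma odd_of_or : pp3 or3 -> pp3 odd3.
Proof.
move=> h; apply: pp3_ext (pp3_and h (pp3_and (pp3_neg2 (pp3_neg3 h))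
  (pp3_and (pp3_neg1 (pp3_neg3 h)) (pp3_neg1 (pp3_neg2 h))))).
by move=> [] [] []; split=> // -[? [? []]].
Qed.

(** With third argument [false], not-all-equal is a disjunction, so the second conjunct says that
    [b] implies [u]. The first forces [b] to be true exactly when [s] and [t] are both false, and
    otherwise allows [b = false]. *)
Lemma or_of_nae (P : bool -> bool -> bool -> bool) : pp3 P ->
  (forall x y z, P x y z = or3 x y z && or3 (~~ x) (~~ y) (~~ z)) -> pp3 or3.
Proof.
move=> hP PE Y s t u.
have := @pp_ex1 Y _ (fun phi b => P (term_val phi s) (term_val phi t) b /\ P (~~ b) (term_val phi u) false) _
  (pp_and (hP _ (inlt _ s) (inlt _ t) (newv Y))
    (pp3_neg1 hP (newv Y) (inlt _ u) (Const false))).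
move=> h; apply: pp_ext (h _) => [phi|phi psi]; last by rewrite !inlt_val.
case: (term_val phi s); case: (term_val phi t);
  case: (term_val phi u); split=> //=;
  try (by exists true; rewrite !PE); try (by exists false; rewrite !PE).
by move=> [[] []]; rewrite !PE.
Qed.

(** Some [b] completes [s] and [~~ t] to exactly one true value unless both are already true. *)
Lemma imp_of_one_in_three (P : bool -> bool -> bool -> bool) : pp3 P ->
  (forall x y z, P x y z = odd3 x y z && ~~ [&& x, y & z]) ->
  pp2 (fun x y => x ==> y).
Proof.
move=> hP PE Y s t.
have := @pp_ex1 Y _ (fun phi b => P (term_val phi s) (~~ term_val phi t) b) _
  (pp3_neg2 hP (inlt _ s) (inlt _ t) (newv Y)).
move=> h; apply: pp_ext (h _) => [phi|phi psi]; last by rewrite !inlt_val.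
case: (term_val phi s); case: (term_val phi t); split=> //=;
  try (by exists true; rewrite PE); try (by exists false; rewrite PE).
by move=> [b]; rewrite PE; case: b.
Qed.

(** The witnesses [b] and [c] lie below [s] and [u], and exactly one of [t], [b], [c] is true: they
    select one true argument of the disjunction. *)
Lemma or_of_one_in_three (P : bool -> bool -> bool -> bool) : pp3 P ->
  (forall x y z, P x y z = odd3 x y z && ~~ [&& x, y & z]) -> pp3 or3.
Proof.
move=> hP PE; have himp := imp_of_one_in_three hP PE.
have hK : pp3 (fun y b z => exists c, P y b c /\ c ==> z).
  move=> Y s t u.
  have := @pp_ex1 Y _ (fun phi b => P (term_val phi s) (term_val phi t) b /\
    b ==> term_val phi u) _ (pp_and (hP _ (inlt _ s) (inlt _ t) (newv Y))
    (himp _ (newv Y) (inlt _ u))).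
  by apply => phi psi; rewrite !inlt_val.
move=> Y s t u.
have := @pp_ex1 Y _ (fun phi b =>
    (exists c, P (term_val phi t) b c /\ c ==> term_val phi u) /\
    b ==> term_val phi s) _ (pp_and (hK _ (inlt _ t) (newv Y) (inlt _ u))
    (himp _ (newv Y) (inlt _ s))).
move=> h; apply: pp_ext (h _) => [phi|phi psi]; last by rewrite !inlt_val.
split=> [[b [[c []]]]|].
  by rewrite PE; case: (term_val phi s); case: (term_val phi t);
    case: (term_val phi u); case: b; case: c.
case: (term_val phi s); case: (term_val phi t);
  case: (term_val phi u) => // _;
  try (by exists true; split=> //; exists false; rewrite PE);
  try (by exists false; split=> //; exists false; rewrite PE);
  try (by exists false; split=> //; exists true; rewrite PE).
Qed.

(** A symmetric relation depends on the weight only. Weights 0 and 1 are prescribed, so weights 2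
    and 3 leave four relations: disjunction, not-all-equal, parity and one-in-three. *)
Lemma odd_of_symmetric (P : bool -> bool -> bool -> bool) : pp3 P ->
  (forall x y z, P x y z = P y x z) -> (forall x y z, P x y z = P x z y) ->
  P true false false -> ~~ P false false false -> pp3 odd3.
Proof.
move=> hP s12 s23 P1 P0.
have PE x y z : P x y z = [|| odd3 x y z && ~~ [&& x, y & z],
    [&& x, y & z] && P true true true |
    [&& or3 x y z, or3 (~~ x) (~~ y) (~~ z) & ~~ odd3 x y z] &&
    P true true false].
  have e1 : P false true false by rewrite s12.
  have e2 : P false false true by rewrite s23.
  have e3 : P true false true = P true true false by rewrite s23.
  have e4 : P false true true = P true true false by rewrite s12 e3.
  by case: x; case: y; case: z => /=; rewrite ?orbF ?P1 ?(negbTE P0).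
case P2 : (P true true false); case P3 : (P true true true).
- apply: odd_of_or; apply: pp3_ext hP => x y z; rewrite PE P2 P3.
  by case: x; case: y; case: z.
- apply/odd_of_or/(or_of_nae hP) => x y z; rewrite PE P2 P3.
  by case: x; case: y; case: z.
- apply: pp3_ext hP => x y z; rewrite PE P2 P3.
  by case: x; case: y; case: z.
- apply/odd_of_or/(or_of_one_in_three hP) => x y z; rewrite PE P2 P3.
  by case: x; case: y; case: z.
Qed.

(** Intersecting [P] over all six orders of its arguments makes it symmetric and keeps its values on
    weights 0 and 1. *)
Lemma odd_of_minority (P : bool -> bool -> bool -> bool) : pp3 P ->
  P true false false -> P false true false -> P false false true ->
  ~~ P false false false -> pp3 odd3.
Proof.
move=> hP P1 P2 P3 P0.
pose Q x y z := [&& P x y z, P y z x, P z x y, P y x z, P x z y & P z y x].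
have hQ : pp3 Q.
  have hP' : pp3 (fun x y z => P y x z) by move=> Y s t u; exact: hP.
  have := pp3_and (pp3_and hP (pp3_and (pp3_rot hP) (pp3_rot (pp3_rot hP))))
    (pp3_and hP' (pp3_and (pp3_rot hP') (pp3_rot (pp3_rot hP')))).
  apply: pp3_ext => x y z; rewrite /Q.
  split=> [[[-> [-> ->]] [-> [-> ->]]]//|/and5P[-> -> -> -> /andP[-> ->]]//].
apply: (odd_of_symmetric hQ); rewrite /Q /=.
- by move=> x y z; case: (P x y z); case: (P y z x); case: (P z x y);
    case: (P y x z); case: (P x z y); case: (P z y x).
- by move=> x y z; case: (P x y z); case: (P y z x); case: (P z x y);
    case: (P y x z); case: (P x z y); case: (P z y x).
- by rewrite P1 P2 P3.
- by rewrite (negbTE P0).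
Qed.

End Parity.

Hypothesis not_bijunctive : ~ bijunctive L.
Hypothesis not_horn : ~ horn L.
Hypothesis not_dual_horn : ~ dual_horn L.

(** Coordinates are merged according to the values of [a] and [b] there: [x] stands where only [a]
    has value [e], [y] where only [b] has it, and constants elsewhere. The three prescribed pairs
    then give back [a], [b] and their meet. *)
Lemma pp_of_not_meet_closed e (S : boolrel) : L S ->
  ~ (forall a b, a \in tuples S -> b \in tuples S ->
      tmeet e a b \in tuples S) ->
  exists P : bool -> bool -> bool,
    [/\ pp2 P, P e (~~ e), P (~~ e) e & ~~ P (~~ e) (~~ e)].
Proof.
move=> LS /existsNP[a /existsNP[b /not_implyP[aS /not_implyP[bS abS]]]].
pose t Y (x y : term Y) i := if tnth a i == e
  then (if tnth b i == e then Const e else x)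
  else (if tnth b i == e then y else Const (~~ e)).
pose T Y (x y : term Y) (phi : Y -> bool) :=
  [tuple term_val phi (t Y x y i) | i < arity S].
exists (fun x y => T bool (Const x) (Const y) id \in tuples S); split.
- move=> Y x y; apply: pp_ext (pp_rel (t Y x y) LS) => phi.
  suff -> : [tuple term_val phi (t Y x y i) | i < arity S] =
    T bool (Const (term_val phi x)) (Const (term_val phi y)) id by [].
  apply: eq_from_tnth => i; rewrite !tnth_mktuple /t.
  by case: ifP => _; case: ifP.
- suff -> : T bool (Const e) (Const (~~ e)) id = a by [].
  apply: eq_from_tnth => i; rewrite !tnth_mktuple /t.
  by case: (tnth a i); case: (tnth b i); case: (e).
- suff -> : T bool (Const (~~ e)) (Const e) id = b by [].
  apply: eq_from_tnth => i; rewrite !tnth_mktuple /t.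
  by case: (tnth a i); case: (tnth b i); case: (e).
- apply/negP; suff -> : T bool (Const (~~ e)) (Const (~~ e)) id = tmeet e a b by [].
  apply: eq_from_tnth => i; rewrite !tnth_mktuple /t /meet.
  by case: (tnth a i); case: (tnth b i); case: (e).
Qed.

(** The failure for Horn excludes two false arguments, the failure for dual Horn two true ones, and
    both keep the mixed pairs. *)
Lemma pp_neq : pp2 (fun x y => x != y).
Proof.
have [S1 L1 h1] := not_closed not_horn.
have [S2 L2 h2] := not_closed not_dual_horn.
have [P [hP P10 P01 P00]] := pp_of_not_meet_closed L1 (contra_not (@horn_of_closed S1) h1).
have [Q [hQ Q10 Q01 Q00]] :=
  pp_of_not_meet_closed L2 (contra_not (@dual_horn_of_closed S2) h2).
move=> Y s t; apply: pp_ext (pp_and (hP Y s t) (hQ Y s t)) => phi.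
by case: (term_val phi s); case: (term_val phi t);
  rewrite ?P10 ?P01 ?(negbTE P00) ?Q10 ?Q01 ?(negbTE Q00); split=> // -[].
Qed.

(** Flipping the majority at the marked coordinates turns the three unit triples into [a], [b], [c],
    and the zero triple into the majority itself, which lies outside [S]. *)
Lemma pp_minority : exists P : bool -> bool -> bool -> bool,
  [/\ pp3 P, P true false false, P false true false, P false false true &
    ~~ P false false false].
Proof.
have [S LS hS] := not_closed not_bijunctive.
have /existsNP[a /existsNP[b /existsNP[c /not_implyP[aS
  /not_implyP[bS /not_implyP[cS abcS]]]]]] := contra_not (@bijunctive_of_closed S) hS.
(* The variables [x], [y], [z] mark the coordinates at which [a], [b], [c]
   respectively are in the minority; they occur negated when the majority is true. *)
pose t Y (x y z x' y' z' : term Y) i :=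
  let m := maj (tnth a i) (tnth b i) (tnth c i) in
  if tnth a i != m then (if m then x' else x) else
  if tnth b i != m then (if m then y' else y) else
  if tnth c i != m then (if m then z' else z) else Const m.
pose T Y (x y z x' y' z' : term Y) (phi : Y -> bool) :=
  [tuple term_val phi (t Y x y z x' y' z' i) | i < arity S].
pose cst b : term bool := Const b.
pose P x y z := T bool (cst x) (cst y) (cst z) (cst (~~ x)) (cst (~~ y))
  (cst (~~ z)) id \in tuples S.
have PE x y z d : (forall i, let m := maj (tnth a i) (tnth b i) (tnth c i) in
     tnth d i = m (+) (if tnth a i != m then x else if tnth b i != m then y else
     if tnth c i != m then z else false)) -> P x y z = (d \in tuples S).
  move=> h; rewrite /P; suff -> : T bool (cst x) (cst y) (cst z) (cst (~~ x))
      (cst (~~ y)) (cst (~~ z)) id = d by [].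
  apply: eq_from_tnth => i; rewrite tnth_mktuple h /t /maj.
  by case: (tnth a i); case: (tnth b i); case: (tnth c i).
exists P; split.
- move=> Y s u v.
  pose f (i : 'I_3) := nth s [:: s; u; v] i.
  have hneg : pp (fun phi : Y + 'I_3 -> bool => forall i : 'I_3,
      term_val phi (inlt _ (f i)) != term_val phi (Var (inr i))).
    by apply: pp_forall => i; exact: pp_neq.
  pose w (i : 'I_3) : term (Y + 'I_3) := Var (inr i).
  have hrel := pp_rel (t _ (inlt _ s) (inlt _ u) (inlt _ v)
    (w (inord 0)) (w (inord 1)) (w (inord 2))) LS.
  apply: pp_ext (pp_ex (pp_and hneg hrel)) => phi.
  have negE (psi : 'I_3 -> bool) : (forall i : 'I_3,
      term_val (sum_val phi psi) (inlt _ (f i)) !=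
      term_val (sum_val phi psi) (Var (inr i))) ->
      psi = fun i => ~~ term_val phi (f i).
    move=> h; apply/funext => i; have := h i; rewrite inlt_val /=.
    by case: (term_val phi _); case: (psi i).
  have relE : [tuple term_val (sum_val phi (fun i => ~~ term_val phi (f i)))
      (t _ (inlt _ s) (inlt _ u) (inlt _ v)
      (w (inord 0)) (w (inord 1)) (w (inord 2)) i) | i < arity S] =
    T bool (cst (term_val phi s)) (cst (term_val phi u)) (cst (term_val phi v))
      (cst (~~ term_val phi s)) (cst (~~ term_val phi u))
      (cst (~~ term_val phi v)) id.
    apply: eq_from_tnth => i; rewrite !tnth_mktuple /t.
    by do 3 (case: ifP => _; first by case: ifP => _;
      rewrite ?inlt_val //= /f inordK).
  split=> [[psi [/negE ->]]|hPs]; first by rewrite relE.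
  exists (fun i => ~~ term_val phi (f i)); rewrite relE; split=> // i.
  by rewrite inlt_val /=; case: (term_val phi _).
- rewrite (PE _ _ _ a) // => i /=.
  by rewrite /maj; case: (tnth a i); case: (tnth b i); case: (tnth c i).
- rewrite (PE _ _ _ b) // => i /=.
  by rewrite /maj; case: (tnth a i); case: (tnth b i); case: (tnth c i).
- rewrite (PE _ _ _ c) // => i /=.
  by rewrite /maj; case: (tnth a i); case: (tnth b i); case: (tnth c i).
- apply/negP; rewrite (PE _ _ _ (tmaj a b c)) // => i /=.
  rewrite tnth_mktuple.
  by rewrite /maj; case: (tnth a i); case: (tnth b i); case: (tnth c i).
Qed.

(** Adding the two odd triples cancels the shared [b]. The right-hand side is a term so that the
    sign of an equation can be substituted as a constant. *)
Lemma pp_parity (Y : Type) (s t u v : term Y) :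
  pp (fun phi => term_val phi s (+) term_val phi t (+) term_val phi u =
    term_val phi v).
Proof.
have [P [hP P1 P2 P3 P0]] := pp_minority.
have hodd := odd_of_minority pp_neq hP P1 P2 P3 P0.
have := @pp_ex1 Y _ (fun phi b => (term_val phi s (+) term_val phi t (+) b) /\
    (b (+) term_val phi u (+) term_val phi v)) _
  (pp_and (hodd _ (inlt _ s) (inlt _ t) (newv Y))
    (hodd _ (newv Y) (inlt _ u) (inlt _ v))).
move=> h; apply: pp_ext (h _) => [phi|phi psi]; last by rewrite !inlt_val.
case: (term_val phi s); case: (term_val phi t); case: (term_val phi u);
  case: (term_val phi v); split=> //;
  try (by move=> [[] []]); try (by exists true); by exists false.
Qed.

End PPDefinability.

(** * Constraint systems of linear equations *)

Local Open Scope ring_scope.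

Section StarAlgTheory.
Variables (C : numClosedFieldType) (A : starAlgType C).
Implicit Types (a b : A).

Lemma scal_r0 k : scal k (0 : A) = 0.
Proof. by apply: (addrI (scal k 0)); rewrite -scalDr !addr0. Qed.

Lemma scal0 a : scal 0 a = 0.
Proof. by apply: (addrI (scal 0 a)); rewrite -scalDl !addr0. Qed.

Lemma scal_N1 a : scal (-1) a = - a.
Proof.
by apply/eqP; rewrite -addr_eq0 -[X in _ + X]scal1 -scalDl addNr scal0.
Qed.

Lemma scal_sign (c : bool) a : scal ((-1) ^+ c) a = (-1) ^+ c * a.
Proof. by case: c; rewrite ?expr1 ?expr0 ?scal_N1 ?mulN1r ?scal1 ?mul1r. Qed.

Lemma scal_sum (I : Type) (r : seq I) (P : pred I) (F : I -> A) k :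
  scal k (\sum_(i <- r | P i) F i) = \sum_(i <- r | P i) scal k (F i).
Proof. by apply: (big_morph (scal k)); [exact: scalDr|exact: scal_r0]. Qed.

Lemma star0 : star (0 : A) = 0.
Proof. by apply: (addrI (star 0)); rewrite -starD !addr0. Qed.

Lemma starN a : star (- a) = - star a.
Proof. by apply/eqP; rewrite -addr_eq0 -starD addNr star0. Qed.

Lemma star1 : star (1 : A) = 1.
Proof. have : star (star 1 * 1) = 1 :> A by rewrite mulr1 starK.
by rewrite starM starK mulr1. Qed.

Lemma star_sum (I : Type) (r : seq I) (P : pred I) (F : I -> A) :
  star (\sum_(i <- r | P i) F i) = \sum_(i <- r | P i) star (F i).
Proof. by apply: (big_morph star); [exact: starD|exact: star0]. Qed.

Lemma scal_half a : scal 2^-1 (a + a) = a.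
Proof.
by rewrite scalDr -scalDl -mulr2n -[_ *+ _]mulr_natl divff ?pnatr_eq0 ?scal1.
Qed.

Lemma star_sign (c : bool) : star ((-1) ^+ c : A) = (-1) ^+ c.
Proof. by case: c; rewrite ?expr1 ?expr0 ?starN star1. Qed.

Definition eigenproj (c : bool) a : A := scal 2^-1 (1 + (-1) ^+ c * a).

Lemma eigenprojE c a : a * a = 1 -> a * eigenproj c a = (-1) ^+ c * eigenproj c a.
Proof.
move=> aa; rewrite /eigenproj -!scalAr; congr (scal _ _).
case: c; rewrite ?expr1 ?expr0 ?mulN1r ?mul1r mulrDr ?mulrN mulr1 aa.
  by rewrite opprB addrC.
by rewrite addrC.
Qed.

Lemma eigenproj_sum a : eigenproj false a + eigenproj true a = 1.
Proof.
rewrite /eigenproj -scalDr expr0 expr1 mul1r mulN1r addrACA subrr addr0.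
exact: scal_half.
Qed.

Lemma comm_sign (c : bool) a : GRing.comm a ((-1) ^+ c).
Proof. exact: commr_sign. Qed.

Lemma comm_scal k a b : GRing.comm a b -> GRing.comm a (scal k b).
Proof. by move=> ab; rewrite /GRing.comm -scalAr -scalAl ab. Qed.

Lemma comm_eigenproj c a b : GRing.comm a b -> GRing.comm a (eigenproj c b).
Proof.
move=> ab; apply: comm_scal; apply: commrD; first exact: commr1.
by apply: commrM => //; exact: comm_sign.
Qed.

Lemma star_eigenproj c a : star a = a -> star (eigenproj c a) = eigenproj c a.
Proof.
move=> sa; rewrite starZ starD star1 starM star_sign sa (comm_sign c a).
by rewrite fmorphV rmorphMn rmorph1.
Qed.

Lemma eigenproj_sqr c a : a * a = 1 -> eigenproj c a * eigenproj c a = eigenproj c a.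
Proof.
move=> aa; rewrite {1}/eigenproj -scalAl mulrDl mul1r -mulrA eigenprojE //.
by rewrite mulrA -signr_addb addbb mul1r scal_half.
Qed.

Lemma prod_eigenproj (I : eqType) (r : seq I) (h : I -> A) (phi : I -> bool) i :
  {in r &, forall j k, h j * h k = h k * h j} -> (forall j, h j * h j = 1) ->
  i \in r -> h i * \prod_(j <- r) eigenproj (phi j) (h j) =
    (-1) ^+ phi i * \prod_(j <- r) eigenproj (phi j) (h j).
Proof.
elim: r => // j r IH com sqr; rewrite inE big_cons mulrA => ir.
have [<-|ij] := eqVneq i j; first by rewrite eigenprojE // mulrA.
have {}ir : i \in r by case/predU1P: ir ij => [->|//]; rewrite eqxx.
have cij : GRing.comm (h i) (eigenproj (phi j) (h j)).
  by apply: comm_eigenproj; apply: com; rewrite inE ?eqxx ?ir ?orbT.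
rewrite cij -mulrA IH // => [|k l kr lr]; last first.
  by apply: com; rewrite inE ?kr ?lr orbT.
by rewrite !mulrA (comm_sign (phi i)).
Qed.

(** Every factor multiplies [e] by [0] or [1], and by [0] as soon as [phi] and [psi] differ
    there. *)
Lemma prod_eigenvector (I : Type) (r : seq I) (h : I -> A) (phi psi : I -> bool)
  (e : A) : (forall i, h i * e = (-1) ^+ psi i * e) ->
  has (fun i => phi i != psi i) r -> \prod_(i <- r) eigenproj (phi i) (h i) * e = 0.
Proof.
move=> he; have pe c i : eigenproj c (h i) * e = scal (c == psi i)%:R e.
  rewrite /eigenproj -scalAl mulrDl mul1r -mulrA he mulrA -signr_addb.
  case: c; case: (psi i) => /=;
    by rewrite ?expr0 ?expr1 ?mul1r ?mulN1r ?subrr ?scal_half ?scal1 ?scal_r0 ?scal0.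
have prodE : \prod_(i <- r) eigenproj (phi i) (h i) * e =
    scal (all (fun i => phi i == psi i) r)%:R e.
  elim: r => [|i r IH]; first by rewrite big_nil mul1r scal1.
  by rewrite big_cons -mulrA IH -scalAr pe scalA -natrM mulnb /= andbC.
by move=> hr; rewrite prodE -[all _ _]negbK -has_predC hr scal0.
Qed.

End StarAlgTheory.

(** * Homomorphisms out of presented algebras *)

Section QuotientMap.
Variables (C : numClosedFieldType) (T : starSetoid C).
Implicit Types a b : T.

Lemma qpiD a b : qpi a + qpi b = qpi (sadd a b).
Proof. exact: qaddE. Qed.
Lemma qpiN a : - qpi a = qpi (sopp a).
Proof. exact: qoppE. Qed.
Lemma qpiM a b : qpi a * qpi b = qpi (smul a b).
Proof. exact: qmulE. Qed.
Lemma qpiZ k a : scal k (qpi a) = qpi (sscal k a).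
Proof. exact: qscalE. Qed.
Lemma qpi_star a : star (qpi a) = qpi (sstar a).
Proof. exact: qstarE. Qed.

End QuotientMap.

Section Presentation.
Variables (C : numClosedFieldType) (X : Type) (rel : starTerm C X -> starTerm C X -> Prop).
Variables (A : starAlgType C).

Fixpoint interp (h : X -> A) (t : starTerm C X) : A :=
  match t with
  | TGen x => h x
  | TZero => 0
  | TOne => 1
  | TOpp a => - interp h a
  | TAdd a b => interp h a + interp h b
  | TMul a b => interp h a * interp h b
  | TScal k a => scal k (interp h a)
  | TStar a => star (interp h a)
  end.

Definition respects (h : X -> A) := forall a b, rel a b -> interp h a = interp h b.

Lemma eval_eqv h a b : respects h -> presEqv rel a b -> interp h a = interp h b.
Proof.
move=> hr; elim=> {a b} /=.
all: try by move=> *; rewrite ?(addrA, add0r, addNr, mulrA, mul1r, mulr1,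
  mulrDl, mulrDr, scalA, scal1, scalDr, scalDl, scalAl, starK, starD, starM, starZ).
- exact: hr.
- by move=> a b c _ -> _ ->.
- by move=> a b _ ->.
- by move=> a a' b b' _ -> _ ->.
- by move=> a a' b b' _ -> _ ->.
- by move=> k a b _ ->.
- by move=> a b _ ->.
- by move=> a b; rewrite addrC.
- by move=> k a b; rewrite scalAr.
Qed.

Section Lift.
Variables (h : X -> A) (hr : respects h).

(** The proof of [respects h] is an explicit argument so that the morphism instances, which depend
    on it, attach to [lift hr]. *)
Definition lift of respects h := fun q : presAlg rel => interp h (qrep q).

Lemma lift_pi t : lift hr (qpi (T := presSetoid rel) t) = interp h t.
Proof. exact: (eval_eqv hr (qrep_pi (T := presSetoid rel) t)). Qed.

Fact lift_zmod : zmod_morphism (lift hr).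
Proof.
move=> p q; rewrite -(qrepK p) -(qrepK q).
have -> : qpi (qrep p) - qpi (qrep q) =
    qpi (T := presSetoid rel) (TAdd (qrep p) (TOpp (qrep q))).
  by rewrite qpiN qpiD.
by rewrite !lift_pi.
Qed.

Fact lift_monoid : monoid_morphism (lift hr).
Proof.
split=> [|p q]; first exact: (lift_pi TOne).
rewrite -(qrepK p) -(qrepK q).
have -> : qpi (qrep p) * qpi (qrep q) =
    qpi (T := presSetoid rel) (TMul (qrep p) (qrep q)) by rewrite qpiM.
by rewrite !lift_pi.
Qed.

HB.instance Definition _ := GRing.isZmodMorphism.Build _ _ (lift hr) lift_zmod.
HB.instance Definition _ := GRing.isMonoidMorphism.Build _ _ (lift hr) lift_monoid.

Lemma lift_star_hom : star_hom (lift hr).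
Proof.
split=> [k p|p] /=; rewrite -(qrepK p).
- have -> : scal k (qpi (qrep p)) = qpi (T := presSetoid rel) (TScal k (qrep p)).
    by rewrite qpiZ.
  by rewrite !lift_pi.
- have -> : star (qpi (qrep p)) = qpi (T := presSetoid rel) (TStar (qrep p)).
    by rewrite qpi_star.
  by rewrite !lift_pi.
Qed.
End Lift.

Lemma star_hom_eval (f : {rmorphism presAlg rel -> A}) t : star_hom f ->
  f (qpi (T := presSetoid rel) t) =
  interp (fun x => f (qpi (T := presSetoid rel) (TGen x))) t.
Proof.
move=> [fZ fS]; elim: t => //= [||a IH|a IHa b IHb|a IHa b IHb|k a IH|a IH].
- exact: rmorph0.
- exact: rmorph1.
- by rewrite -IH -rmorphN qpiN.
- by rewrite -IHa -IHb -rmorphD qpiD.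
- by rewrite -IHa -IHb -rmorphM qpiM.
- by rewrite -IH -fZ qpiZ.
- by rewrite -IH -fS qpi_star.
Qed.

(** The universal property: from here on satisfiability is about families of elements and no longer
    about homomorphisms. *)
Lemma presented_homP :
  (exists f : {rmorphism presAlg rel -> A}, star_hom f) <->
  exists h, respects h.
Proof.
split=> [[f hf]|[h hr]]; last by exists (lift hr : {rmorphism _ -> _}); exact: lift_star_hom.
exists (fun x => f (qpi (T := presSetoid rel) (TGen x))) => a b ab.
rewrite -!star_hom_eval //; congr (f _); apply/qpiP; exact: PRel.
Qed.
End Presentation.

Section BCSAlgebra.
Variables (C : numClosedFieldType) (A : starAlgType C) (B : bcs_ctx).

Record operator_solution (h : bvar B -> A) : Prop := {
  op_sqr : forall x, h x * h x = 1;
  op_star : forall x, star (h x) = h x;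
  op_comm : forall i x y, x \in ctx B i -> y \in ctx B i -> h x * h y = h y * h x;
  op_unsat : forall i (phi : {ffun {x | x \in ctx B i} -> bool}),
    ~~ satisfying (ctx_bcs B i) phi ->
    \prod_(y : {x | x \in ctx B i}) eigenproj (phi y) (h (val y)) = 0
}.

Lemma eval_spectral_proj h i phi :
  interp (A := A) h (@spectral_proj C B i phi) =
  \prod_(y : {x | x \in ctx B i}) eigenproj (phi y) (h (val y)).
Proof.
rewrite /spectral_proj (@big_morph _ _ (interp h) 1 *%R) //=.
by apply: eq_bigr => y _; rewrite scal_sign.
Qed.

Lemma sat_inP : sat_in B A <-> exists h, operator_solution h.
Proof.
rewrite /sat_in /bcs_alg presented_homP.
split=> -[h hr]; exists h.
  split=> [x|x|i x y xi yi|i phi phiN].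
  - exact/(hr _ _ (bcs_con (con_sqr _ x))).
  - exact/(hr _ _ (bcs_con (con_star _ x))).
  - exact/(hr _ _ (bcs_con (con_comm _ xi yi))).
  - by rewrite -eval_spectral_proj (hr _ _ (bcs_unsat _ phiN)).
move=> _ _ [_ _ [x|x|i x y xi yi]|i phi phiN] /=.
- exact: op_sqr hr x.
- exact: op_star hr x.
- exact: op_comm hr i x y xi yi.
- by rewrite eval_spectral_proj (op_unsat hr).
Qed.

End BCSAlgebra.

Section LinearSystems.
Variables (C : numClosedFieldType) (A : starAlgType C) (X : Type).

Definition equation := (X * X * X * bool)%type.

(** Commutation is asked of [x] and [y] only: for involutions the equation gives
    [f z = (-1) ^+ b * (f x * f y)], which then commutes with both. *)
Definition holds (f : X -> A) (e : equation) : Prop :=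
  let: (x, y, z, b) := e in
  f x * f y = f y * f x /\ f x * f y * f z = (-1) ^+ b.

Definition involutive_family (f : X -> A) : Prop :=
  (forall x, f x * f x = 1) /\ (forall x, star (f x) = f x).

Definition solves (n : nat) (e : 'I_n -> equation) (f : X -> A) : Prop :=
  involutive_family f /\ forall i, holds f (e i).

End LinearSystems.

(** * Operators acting by signs on orthogonal projections *)

Section OrthogonalProjections.
Variables (C : numClosedFieldType) (A : starAlgType C) (I : finType) (E : I -> A).
Hypotheses (E_idem : forall p, E p * E p = E p) (E_star : forall p, star (E p) = E p).
Hypothesis E_orth : forall p q, p != q -> E p * E q = 0.
Hypothesis E_sum : \sum_p E p = 1.

Definition sign_sum (s : I -> bool) : A := \sum_p (-1) ^+ s p * E p.

Lemma sign_sumE s p : sign_sum s * E p = (-1) ^+ s p * E p.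
Proof.
rewrite /sign_sum mulr_suml (bigD1 p) //= -mulrA E_idem big1 ?addr0 // => q qp.
by rewrite -mulrA E_orth ?mulr0.
Qed.

Lemma sign_sum_eq a (s : I -> bool) : (forall p, a * E p = (-1) ^+ s p * E p) -> a = sign_sum s.
Proof.
move=> aE; rewrite -[a]mulr1 -E_sum mulr_sumr /sign_sum.
exact: eq_bigr.
Qed.

Lemma sign_sumM s t : sign_sum s * sign_sum t = sign_sum (fun p => s p (+) t p).
Proof.
apply: sign_sum_eq => p; rewrite -mulrA sign_sumE mulrA comm_sign -mulrA sign_sumE.
by rewrite mulrA -signr_addb addbC.
Qed.

Lemma sign_sumC s t : sign_sum s * sign_sum t = sign_sum t * sign_sum s.
Proof. by rewrite !sign_sumM; apply: eq_bigr => p _; rewrite addbC. Qed.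

Lemma sign_sum_sqr s : sign_sum s * sign_sum s = 1.
Proof.
rewrite sign_sumM -E_sum; apply: eq_bigr => p _.
by rewrite addbb expr0 mul1r.
Qed.

Lemma sign_sum_star s : star (sign_sum s) = sign_sum s.
Proof.
rewrite star_sum; apply: eq_bigr => p _.
by rewrite starM star_sign E_star comm_sign.
Qed.

End OrthogonalProjections.

Section JointEigenprojections.
Variables (C : numClosedFieldType) (A : starAlgType C) (a b : A).
Hypotheses (aa : a * a = 1) (bb : b * b = 1) (sa : star a = a) (sb : star b = b).
Hypothesis ab : a * b = b * a.

Definition joint_proj (p : bool * bool) : A := eigenproj p.1 a * eigenproj p.2 b.

Let comm_proj c d : eigenproj c a * eigenproj d b = eigenproj d b * eigenproj c a.
Proof. by apply/comm_eigenproj/commr_sym/comm_eigenproj/commr_sym. Qed.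

Lemma joint_proj_idem p : joint_proj p * joint_proj p = joint_proj p.
Proof.
rewrite /joint_proj mulrA -[_ * _ * eigenproj _ a]mulrA -comm_proj.
by rewrite !mulrA eigenproj_sqr // -mulrA eigenproj_sqr.
Qed.

Lemma joint_proj_star p : star (joint_proj p) = joint_proj p.
Proof. by rewrite starM !star_eigenproj // -comm_proj. Qed.

Lemma joint_projl p : a * joint_proj p = (-1) ^+ p.1 * joint_proj p.
Proof. by rewrite /joint_proj mulrA eigenprojE // mulrA. Qed.

Lemma joint_projr p : b * joint_proj p = (-1) ^+ p.2 * joint_proj p.
Proof. by rewrite /joint_proj comm_proj mulrA eigenprojE // mulrA. Qed.

Lemma eigenproj_orth c (d : A) : d * d = 1 ->
  eigenproj (~~ c) d * eigenproj c d = 0.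
Proof.
move=> dd; rewrite {1}/eigenproj -scalAl mulrDl mul1r -mulrA eigenprojE //.
rewrite mulrA -signr_addb; case: c => /=;
  by rewrite expr1 mulN1r subrr scal_r0.
Qed.

Lemma joint_proj_orth p q : p != q -> joint_proj p * joint_proj q = 0.
Proof.
move=> pq; rewrite /joint_proj; have [e1|n1] := eqVneq p.1 q.1.
  have n2 : p.2 != q.2.
    by apply: contra pq => /eqP e2; rewrite [p]surjective_pairing e1 e2 -surjective_pairing.
  rewrite [eigenproj q.1 _ * _]comm_proj mulrA -[_ * _ * eigenproj q.2 b]mulrA.
  have -> : p.2 = ~~ q.2 by case: p.2 q.2 n2 => -[].
  by rewrite eigenproj_orth // mulr0 mul0r.
rewrite mulrA [eigenproj p.1 _ * _]comm_proj -[_ * _ * eigenproj q.1 a]mulrA.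
have -> : p.1 = ~~ q.1 by case: p.1 q.1 n1 => -[].
by rewrite eigenproj_orth // mulr0 mul0r.
Qed.

Lemma joint_proj_sum : \sum_p joint_proj p = 1.
Proof.
have -> : \sum_p joint_proj p = \sum_c \sum_d joint_proj (c, d).
  by rewrite pair_bigA; apply: eq_bigr => -[].
under eq_bigr => c _ do rewrite /joint_proj /= -mulr_sumr.
rewrite -mulr_suml !big_bool /= ![eigenproj true _ + _]addrC !eigenproj_sum.
exact: mulr1.
Qed.

End JointEigenprojections.

(** * From linear equations to constraint systems over the language *)

Section Assembly.
Variable L : language.
Hypothesis L_parity : forall (Y : Type) (s t u v : term Y),
  pp L (fun phi => term_val phi s (+) term_val phi t (+) term_val phi u =
    term_val phi v).
Variables (X : finType) (n : nat) (e : 'I_n -> equation X).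

Let x_ i := (e i).1.1.1.
Let y_ i := (e i).1.1.2.
Let z_ i := (e i).1.2.
Let b_ i := (e i).2.

Section Construction.
Variables (Z : finType) (V : bcs ('I_4 + Z)).

(** Each equation has its own copy of the auxiliary variables, so each of them lies in one context
    only and must commute with nothing outside it. *)
Definition sys_var : finType := (X + 'I_n * Z)%type.

Definition sys_ctx (i : 'I_n) : {set sys_var} :=
  [set v | match v with
           | inl x => x \in [:: x_ i; y_ i; z_ i]
           | inr jz => jz.1 == i
           end].

(** The default concerns variables outside the context; [sys_args] passes none. *)
Definition sys_term (i : 'I_n) (v : sys_var) : term {v | v \in sys_ctx i} :=
  if insub v is Some u then Var u else Const false.

(** At [k = 3] the default of [nth] supplies the right-hand side of the equation. *)
Definition sys_args (i : 'I_n) (t : 'I_4 + Z) : term {v | v \in sys_ctx i} :=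
  match t with
  | inl k => nth (Const (b_ i)) [:: sys_term i (inl (x_ i));
      sys_term i (inl (y_ i)); sys_term i (inl (z_ i))] k
  | inr z => sys_term i (inr (i, z))
  end.

Definition sys_bcs_ctx : bcs_ctx :=
  @BCSCtx sys_var n sys_ctx (fun i => bcs_bind (sys_args i) V).

Definition quad (s t u v : bool) (k : 'I_4) : bool := nth v [:: s; t; u] k.

Lemma sys_sat i phi :
  satisfying (bcs_bind (sys_args i) V) phi =
  satisfying V (sum_val
    (quad (term_val phi (sys_term i (inl (x_ i))))
       (term_val phi (sys_term i (inl (y_ i))))
       (term_val phi (sys_term i (inl (z_ i)))) (b_ i))
    (fun z => term_val phi (sys_term i (inr (i, z))))).
Proof.
rewrite bcs_bind_sat; apply: satisfying_ext => -[k|z] //=.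
by case: k => -[|[|[|[|]]]].
Qed.

Lemma sys_term_val i phi (u : {v | v \in sys_ctx i}) :
  term_val phi (sys_term i (val u)) = phi u.
Proof. by rewrite /sys_term valK. Qed.

Hypothesis VP : forall phi : 'I_4 -> bool,
  phi (inord 0) (+) phi (inord 1) (+) phi (inord 2) = phi (inord 3) <->
  exists psi, satisfying V (sum_val phi psi).

Lemma quadP s t u v : s (+) t (+) u = v <->
  exists psi, satisfying V (sum_val (quad s t u v) psi).
Proof. by rewrite -VP /quad !inordK. Qed.

Variables (C : numClosedFieldType) (A : starAlgType C).

(** The spectral projections of a context sum to 1, and those of non-satisfying assignments vanish.
    On each remaining one the operators act by the signs of an assignment of the right parity, so
    the equation can be checked projection by projection. *)
Lemma solves_of_operator_solution (h : sys_var -> A) :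
  @operator_solution C A sys_bcs_ctx h -> solves e (h \o inl).
Proof.
move=> hh; split=> [|i].
  by split=> x; [exact: (op_sqr hh)|exact: (op_star hh)].
have xP : inl (x_ i) \in sys_ctx i by rewrite inE mem_head.
have yP : inl (y_ i) \in sys_ctx i by rewrite !inE eqxx orbT.
have zP : inl (z_ i) \in sys_ctx i by rewrite !inE eqxx !orbT.
have hc := @op_comm _ _ sys_bcs_ctx _ hh i.
rewrite (surjective_pairing (e i)) (surjective_pairing (e i).1)
  (surjective_pairing (e i).1.1); split; first exact: hc.
pose F (y : {v | v \in sys_ctx i}) c := eigenproj c (h (val y)).
have F1 : \sum_(phi : {ffun {v | v \in sys_ctx i} -> bool})
    \prod_y F y (phi y) = 1.
  rewrite -(bigA_distr_bigA F) big1 // => y _.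
  by rewrite big_bool; apply: etrans (addrC _ _) (eigenproj_sum _).
have Fx (phi : {ffun {v | v \in sys_ctx i} -> bool}) v : v \in sys_ctx i ->
    h v * \prod_y F y (phi y) =
    (-1) ^+ term_val phi (sys_term i v) * \prod_y F y (phi y).
  move=> vi; rewrite -[v](SubK {v | v \in sys_ctx i} vi) sys_term_val.
  apply: (prod_eigenproj (h := fun y => h (val y))) => [j k _ _|j|].
  - by apply: hc; exact: valP.
  - exact: (op_sqr hh).
  - exact: mem_index_enum.
rewrite -[LHS]mulr1 -[RHS]mulr1 -[in X in _ * X = _]F1 -[in X in _ = _ * X]F1.
rewrite !mulr_sumr; apply: eq_bigr => phi _.
case: (boolP (satisfying (bcs_bind (sys_args i) V) phi)) => [|phiN]; last first.
  by rewrite (@op_unsat _ _ sys_bcs_ctx h hh i phi phiN) !mulr0.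
rewrite sys_sat => sat; have /quadP : exists psi, satisfying V (sum_val
  (quad (term_val phi (sys_term i (inl (x_ i))))
       (term_val phi (sys_term i (inl (y_ i))))
       (term_val phi (sys_term i (inl (z_ i)))) (b_ i)) psi) by eexists; exact: sat.
rewrite -/(b_ i) => <-; rewrite /= -/(x_ i) -/(y_ i) -/(z_ i).
rewrite -!mulrA (Fx _ _ zP) [h (inl (y_ i)) * _]mulrA comm_sign -mulrA (Fx _ _ yP).
rewrite !mulrA comm_sign -2!mulrA [h _ * _]mulrA comm_sign -mulrA (Fx _ _ xP).
by rewrite !mulrA -!signr_addb addbC addbA addbAC addbC addbA.
Qed.

(* On a joint eigenspace of the operators of [x] and [y] the values of [x], [y]
   and [z] satisfy the parity constraint; the auxiliary variables act there by a
   chosen satisfying extension. *)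
Lemma operator_solution_of_solves (f : X -> A) : solves e f ->
  exists h, @operator_solution C A sys_bcs_ctx h.
Proof.
move=> [[sqr str] hold].
have hxy i : f (x_ i) * f (y_ i) = f (y_ i) * f (x_ i).
  by have := hold i; rewrite (surjective_pairing (e i)) (surjective_pairing (e i).1)
    (surjective_pairing (e i).1.1) => -[].
have hz i : f (x_ i) * f (y_ i) * f (z_ i) = (-1) ^+ b_ i.
  by have := hold i; rewrite (surjective_pairing (e i)) (surjective_pairing (e i).1)
    (surjective_pairing (e i).1.1) => -[].
pose E i := joint_proj (f (x_ i)) (f (y_ i)).
have E_idem i p : E i p * E i p = E i p by exact: joint_proj_idem.
have E_star i p : star (E i p) = E i p by exact: joint_proj_star.
have E_orth i p q : p != q -> E i p * E i q = 0 by apply: joint_proj_orth.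
have E_sum i : \sum_p E i p = 1 by exact: joint_proj_sum.
pose par i (p : bool * bool) := p.1 (+) p.2 (+) b_ i.
have /choice[psi psiP] : forall ip : 'I_n * (bool * bool), exists psi,
    satisfying V (sum_val (quad ip.2.1 ip.2.2 (par ip.1 ip.2) (b_ ip.1)) psi).
  by move=> [i p]; apply/quadP; rewrite /par /= addbA addbb.
pose h (v : sys_var) : A := match v with
  | inl x => f x
  | inr jz => sign_sum (E jz.1) (fun p => psi (jz.1, p) jz.2)
  end.
have fx i p : f (x_ i) * E i p = (-1) ^+ p.1 * E i p by exact: joint_projl.
have fy i p : f (y_ i) * E i p = (-1) ^+ p.2 * E i p by exact: joint_projr.
have fz i p : f (z_ i) * E i p = (-1) ^+ par i p * E i p.
  have -> : f (z_ i) = (-1) ^+ b_ i * (f (x_ i) * f (y_ i)).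
    have <- : f (y_ i) * (f (x_ i) * (f (x_ i) * f (y_ i) * f (z_ i))) = f (z_ i).
      by rewrite -!mulrA [f (x_ i) * (f (x_ i) * _)]mulrA sqr mul1r mulrA sqr mul1r.
    by rewrite hz mulrA -hxy comm_sign.
  rewrite -!mulrA fy [f _ * _]mulrA comm_sign -mulrA fx !mulrA -!signr_addb.
  by rewrite /par addbC addbA addbAC addbC addbA.
have faux i z p : h (inr (i, z)) * E i p = (-1) ^+ psi (i, p) z * E i p.
  exact: (sign_sumE (E_idem i) (E_orth i)).
have eig i v : v \in sys_ctx i ->
    exists s : bool * bool -> bool, forall p, h v * E i p = (-1) ^+ s p * E i p.
  case: v => [x|[j z]]; rewrite inE => /=; last first.
    by move=> /eqP->; exists (fun p => psi (i, p) z) => p; exact: faux.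
  by rewrite !inE => /or3P[] /eqP->; [exists fst|exists snd|exists (par i)].
have h_sqr v : h v * h v = 1.
  by case: v => [x|[j z]] /=; [exact: sqr|exact: (sign_sum_sqr (E_idem _) (@E_orth _) (E_sum _))].
exists h; split=> //.
- by case=> [x|[j z]] /=; [exact: str|exact: (sign_sum_star (E_star _))].
- move=> i v w /eig[s hs] /eig[t ht].
  rewrite (sign_sum_eq (E_sum i) hs) (sign_sum_eq (E_sum i) ht).
  exact: (sign_sumC (E_idem _) (@E_orth _) (E_sum _)).
move=> i phi phiN; rewrite -[LHS]mulr1 -[in X in _ * X](E_sum i) mulr_sumr big1 // => p _.
have kill v (c : bool) (vi : v \in sys_ctx i) : h v * E i p = (-1) ^+ c * E i p ->
    term_val phi (sys_term i v) != c ->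
    \prod_(y : {v | v \in sys_ctx i}) eigenproj (phi y) (h (val y)) * E i p = 0.
  move=> hc nc; have /choice[s hs] : forall y : {v | v \in sys_ctx i},
      exists t : bool, h (val y) * E i p = (-1) ^+ t * E i p.
    by move=> y; have [t ht] := eig i _ (valP y); exists (t p).
  pose u : {v | v \in sys_ctx i} := Sub v vi.
  apply: (prod_eigenvector (psi := fun y => if y == u then c else s y)) => [y|].
    by case: eqP => [->|_]; [rewrite SubK|exact: hs].
  apply/hasP; exists u; first exact: mem_index_enum.
  by rewrite eqxx -(sys_term_val phi u) SubK.
have xP : inl (x_ i) \in sys_ctx i by rewrite inE mem_head.
have yP : inl (y_ i) \in sys_ctx i by rewrite !inE eqxx orbT.
have zP : inl (z_ i) \in sys_ctx i by rewrite !inE eqxx !orbT.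
have [ex|/eqP nx] := eqVneq (term_val phi (sys_term i (inl (x_ i)))) p.1; last first.
  by apply: (kill _ _ xP (fx i p)); apply/eqP.
have [ey|/eqP ny] := eqVneq (term_val phi (sys_term i (inl (y_ i)))) p.2; last first.
  by apply: (kill _ _ yP (fy i p)); apply/eqP.
have [ez|/eqP nz] := eqVneq (term_val phi (sys_term i (inl (z_ i)))) (par i p); last first.
  by apply: (kill _ _ zP (fz i p)); apply/eqP.
(* If [phi] also agreed with the chosen extension on all auxiliary variables, it would satisfy the
   context. *)
have [z zN] : exists z, term_val phi (sys_term i (inr (i, z))) != psi (i, p) z.
  apply: contrapT => /forallNP allz; case/negP: phiN.
  rewrite /= sys_sat ex ey ez; apply: satisfying_eq1 (psiP (i, p)) => -[//|z] /=.
  by have /negP/negPn/eqP := allz z.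
by apply: (kill _ _ _ (faux i z p) zN); rewrite inE /=.
Qed.

End Construction.

Lemma bcs_of_linear_system : exists B : bcs_ctx, over_language L B /\
  forall (C : numClosedFieldType) (A : starAlgType C),
    sat_in B A <-> exists f : X -> A, solves e f.
Proof.
have [Z [V [VL VP]]] := @L_parity 'I_4 (Var (inord 0)) (Var (inord 1))
  (Var (inord 2)) (Var (inord 3)).
exists (sys_bcs_ctx V); split=> [i j|C A]; first exact: VL.
rewrite sat_inP; split=> [[h /(solves_of_operator_solution VP) hs]|[f]].
  by exists (h \o inl).
exact: operator_solution_of_solves.
Qed.

End Assembly.

(** * Commutators from magic squares *)

Section Reflections.
Variables (C : numClosedFieldType) (A : starAlgType C).
Implicit Types a b c : A.

Definition reflection a := a * a = 1 /\ star a = a.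

Lemma reflectionM a b : reflection a -> reflection b -> GRing.comm a b ->
  reflection (a * b).
Proof.
move=> [aa sa] [bb sb] ab; split; last by rewrite starM sa sb ab.
by rewrite {1}ab -mulrA [a * (a * b)]mulrA aa mul1r bb.
Qed.

Lemma reflectionJ a b : reflection a -> reflection b -> reflection (a * b * a).
Proof.
move=> [aa sa] [bb sb]; split; last by rewrite !starM sa sb mulrA.
by rewrite -!mulrA [a * (a * _)]mulrA aa mul1r [b * (b * _)]mulrA bb mul1r.
Qed.

Lemma reflection_sign (c : bool) : reflection ((-1) ^+ c : A).
Proof. by split; [rewrite -signr_addb addbb|exact: star_sign]. Qed.

Lemma triple_solve a b c : reflection a -> reflection b -> a * b * c = 1 ->
  c = b * a.
Proof.
move=> [aa _] [bb _] abc; rewrite -[b * a]mulr1 -abc -!mulrA.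
by rewrite [a * (a * _)]mulrA aa mul1r mulrA bb mul1r.
Qed.

Lemma triple_prod a b : reflection a -> reflection b -> GRing.comm a b ->
  a * b * (a * b) = 1.
Proof. by move=> ra rb ab; case: (reflectionM ra rb ab). Qed.

End Reflections.

Section MagicSquare.
Variables (C : numClosedFieldType) (A : starAlgType C).
Variables (x y w : A).

(* A Mermin-Peres square in which the product of the last column is [w]. *)
Lemma square_commutator (b c d f g h i k : A) :
  reflection x -> reflection y -> reflection b -> reflection d ->
  reflection c -> reflection f -> reflection g -> reflection h ->
  reflection i -> reflection k -> reflection w ->
  x * b * c = 1 -> d * y * f = 1 -> g * h * i = 1 ->
  x * d * g = 1 -> b * y * h = 1 -> c * f * k = 1 -> k * i * w = 1 ->
  x * b = b * x -> d * y = y * d -> g * h = h * g -> w * d = d * w ->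
  x * y = w * y * x.
Proof.
move=> rx ry rb rd rc rf rg rh ri rk rw exc eyf ei eg eh ek ew xb dy gh wd.
have cE := triple_solve rx rb exc; have fE := triple_solve rd ry eyf.
have iE := triple_solve rg rh ei; have gE := triple_solve rx rd eg.
have hE := triple_solve rb ry eh; have kE := triple_solve rc rf ek.
have wE := triple_solve rk ri ew.
(* After substitution of the other entries this reads [d x y b = w d y x b]; [b] cancels on the
   right, [w] passes [d], and [d] cancels on the left. *)
have : i = w * k by rewrite wE -mulrA rk.1 mulr1.
rewrite iE -gh gE hE kE fE cE -xb -dy -!mulrA => /(congr1 (fun z => z * b)).
rewrite -!mulrA rb.1 !mulr1 [w * (d * _)]mulrA wd -mulrA.
by move=> /(congr1 (fun z => d * z)); rewrite ![d * (d * _)]mulrA rd.1 !mul1r.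
Qed.

(** The operator [u] controlled by [w]: it is 1 where [w = 1] and [u] where [w = -1]. Controlling
    two anticommuting reflections gives a pair whose commutator is exactly [w]. *)
Definition twist (u : A) : A := eigenproj false w + eigenproj true w * u.

Hypothesis rw : reflection w.

Let pE c : w * eigenproj c w = (-1) ^+ c * eigenproj c w.
Proof. by apply: eigenprojE; exact: rw.1. Qed.

Lemma comm_twist a u : GRing.comm a w -> GRing.comm a u -> GRing.comm a (twist u).
Proof.
by move=> aw au; apply: commrD; [|apply: commrM => //]; apply: comm_eigenproj.
Qed.

Lemma twistM u v : GRing.comm w u -> GRing.comm w v ->
  twist u * twist v = twist (u * v).
Proof.
move=> wu wv; rewrite /twist mulrDl !mulrDr.
rewrite eigenproj_sqr ?rw.1 // mulrA (@eigenproj_orth _ _ true) ?rw.1 // mul0r addr0.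
have cu c : GRing.comm u (eigenproj c w) by apply/comm_eigenproj/commr_sym.
rewrite -[_ * u * eigenproj false w]mulrA cu mulrA (@eigenproj_orth _ _ false) ?rw.1 //.
rewrite mul0r add0r -[_ * u * _]mulrA [u * (_ * v)]mulrA cu !mulrA.
by rewrite eigenproj_sqr ?rw.1.
Qed.

Lemma twist1 : twist 1 = 1.
Proof. by rewrite /twist mulr1 eigenproj_sum. Qed.

Lemma twist_reflection u : reflection u -> GRing.comm w u -> reflection (twist u).
Proof.
move=> [uu su] wu; split; first by rewrite twistM // uu twist1.
have sp c : star (eigenproj c w) = eigenproj c w by apply: star_eigenproj; exact: rw.2.
rewrite starD starM su !sp; congr (_ + _).
by apply/comm_eigenproj/commr_sym.
Qed.

Lemma twist_commutator u v : GRing.comm w u -> GRing.comm w v -> u * v = - (v * u) ->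
  twist u * twist v = w * (twist v * twist u).
Proof.
move=> wu wv uv; rewrite !twistM // uv /twist mulrDr mulrA !pE.
by rewrite expr0 mul1r expr1 mulN1r mulrN mulNr.
Qed.

End MagicSquare.

Section CommutatorSystems.
Variables (L : language) (V J M : finType).
Hypothesis L_parity : forall (Y : Type) (s t u v : term Y),
  pp L (fun phi => term_val phi s (+) term_val phi t (+) term_val phi u =
    term_val phi v).
Variables (e : J -> equation V) (c : M -> V * V * V).

Definition commutator_holds (C : numClosedFieldType) (A : starAlgType C)
    (f : V -> A) (t : V * V * V) : Prop :=
  let: (x, y, w) := t in f x * f y = f w * f y * f x.

Definition commutator_central (C : numClosedFieldType) (A : starAlgType C)
    (f : V -> A) (t : V * V * V) : Prop :=
  let: (x, y, w) := t in f w * f x = f x * f w /\ f w * f y = f y * f w.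

(** The entries [a 0] to [a 7] are [b c d f g h i k] of [square_commutator]. The eighth equation
    makes [w] commute with [d], and [a 8] is their product. *)
Definition square_eqs (m : M) : seq (equation (V + M * 'I_9)) :=
  let: (x, y, w) := c m in
  let v x : V + M * 'I_9 := inl x in
  let a k : V + M * 'I_9 := inr (m, inord k) in
  [:: (v x, a 0, a 1, false); (a 2, v y, a 3, false); (a 4, a 5, a 6, false);
      (v x, a 2, a 4, false); (a 0, v y, a 5, false); (a 1, a 3, a 7, false);
      (a 7, a 6, v w, false); (v w, a 2, a 8, false)]%N.

Definition lift_eq (q : equation V) : equation (V + M * 'I_9) :=
  let: (x, y, z, b) := q in (inl x, inl y, inl z, b).

Definition full_system : seq (equation (V + M * 'I_9)) :=
  [seq lift_eq (e j) | j <- enum J] ++ flatten [seq square_eqs m | m <- enum M].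

(** For the converse each square has to be completed. Its remaining entries combine [f x] and [f y]
    with the twists [X] and [Z] of the spare pair; [f x, f y] and [X, Z] have the same commutator
    [w], so in products that must commute the two factors [w] cancel. *)
Lemma bcs_of_commutator_system : exists B : bcs_ctx, over_language L B /\
  forall (C : numClosedFieldType) (A : starAlgType C),
    (sat_in B A -> exists f : V -> A, [/\ forall x, reflection (f x),
      forall j, holds f (e j) & forall m, commutator_holds f (c m)]) /\
    (forall (f : V -> A) (u v : A), (forall x, reflection (f x)) ->
      (forall j, holds f (e j)) -> (forall m, commutator_holds f (c m)) ->
      (forall m, commutator_central f (c m)) ->
      reflection u -> reflection v -> u * v = - (v * u) ->
      (forall x, GRing.comm (f x) u) -> (forall x, GRing.comm (f x) v) ->
      sat_in B A).
Proof.
pose s := full_system.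
have [B [BL BP]] := bcs_of_linear_system L_parity (tnth (in_tuple s)).
have sP (C : numClosedFieldType) (A : starAlgType C) (g : V + M * 'I_9 -> A) :
    (forall i, holds g (tnth (in_tuple s) i)) <-> (forall q, q \in s -> holds g q).
  split=> [h q /(nthP q)[i i_s <-]|h i]; last by apply: h; exact: mem_tnth.
  by have := h (Ordinal i_s); rewrite (tnth_nth q).
exists B; split=> // C A; split=> [/(BP C A).1[g [[gg gs] /sP gh]]|].
  have rg x : reflection (g x) by [].
  exists (g \o inl); split=> [x|j|m]; first exact: rg.
    have : holds g (lift_eq (e j)).
      apply: gh; rewrite mem_cat; apply/orP; left.
      by apply: (map_f (fun j => lift_eq (e j))); rewrite mem_enum.
    by case: (e j) => [[[x y] z] b].
  have sub q : q \in square_eqs m -> holds g q.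
    move=> qm; apply: gh; rewrite mem_cat; apply/orP; right.
    by apply/flattenP; exists (square_eqs m) => //; apply: map_f; rewrite mem_enum.
  move: sub; rewrite /square_eqs /commutator_holds.
  case: (c m) => [[x y] w] sub.
  have hq k : (k < 8)%N -> holds g (nth (inl x, inl x, inl x, false)
     [:: (inl x, inr (m, inord 0), inr (m, inord 1), false);
         (inr (m, inord 2), inl y, inr (m, inord 3), false);
         (inr (m, inord 4), inr (m, inord 5), inr (m, inord 6), false);
         (inl x, inr (m, inord 2), inr (m, inord 4), false);
         (inr (m, inord 0), inl y, inr (m, inord 5), false);
         (inr (m, inord 1), inr (m, inord 3), inr (m, inord 7), false);
         (inr (m, inord 7), inr (m, inord 6), inl w, false);
         (inl w, inr (m, inord 2), inr (m, inord 8), false)] k).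
    by move=> k8; apply: sub; apply: mem_nth.
  have [h1 e1] := hq 0%N isT; have [h2 e2] := hq 1%N isT.
  have [h3 e3] := hq 2%N isT; have [h4 e4] := hq 3%N isT.
  have [h5 e5] := hq 4%N isT; have [h6 e6] := hq 5%N isT.
  have [h7 e7] := hq 6%N isT; have [h8 e8] := hq 7%N isT.
  rewrite expr0 in e1 e2 e3 e4 e5 e6 e7.
  exact: (square_commutator (rg _) (rg _) (rg _) (rg _) (rg _) (rg _) (rg _)
    (rg _) (rg _) (rg _) (rg _) e1 e2 e3 e4 e5 e6 e7 h1 h2 h3 h8).
move=> f u v rf fe fc fw ru rv uv fu fv; apply/(BP C A).
(* The entries [b c d f g h i k], followed by the product of [w] with [d]. *)
pose sq (t : V * V * V) (k : nat) : A :=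
  let: (x, y, w) := t in let X := twist (f w) u in let Z := twist (f w) v in
  nth 0 [:: X; f x * X; Z; Z * f y; f x * Z; X * f y;
    (f x * Z) * (X * f y); (f x * X) * (Z * f y); f w * Z] k.
pose g (t : V + M * 'I_9) : A :=
  match t with inl x => f x | inr mk => sq (c mk.1) mk.2 end.
have key m : (forall k : 'I_9, reflection (sq (c m) k)) /\
    forall q, q \in square_eqs m -> holds g q.
  have gE k : (k < 9)%N -> g (inr (m, inord k)) = sq (c m) k.
    by move=> k9; rewrite /g /= inordK.
  have := fc m; have := fw m; move: gE; rewrite /commutator_holds /commutator_central /square_eqs.
  case: (c m) => [[x y] w] gE [wx wy] xy.
  have ? := rf x; have ? := rf y; have ? := rf w.
  set X := twist (f w) u; set Z := twist (f w) v.
  have rX : reflection X by exact: twist_reflection.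
  have rZ : reflection Z by exact: twist_reflection.
  have XZ : X * Z = f w * (Z * X) by exact: twist_commutator.
  have cX t : GRing.comm (f t) (f w) -> GRing.comm (f t) X.
    by move=> tw; apply: comm_twist.
  have cZ t : GRing.comm (f t) (f w) -> GRing.comm (f t) Z.
    by move=> tw; apply: comm_twist.
  have xX : GRing.comm (f x) X by exact: cX.
  have xZ : GRing.comm (f x) Z by exact: cZ.
  have yX : GRing.comm (f y) X by exact: cX.
  have yZ : GRing.comm (f y) Z by exact: cZ.
  have wX : GRing.comm (f w) X by exact: cX.
  have wZ : GRing.comm (f w) Z by exact: cZ.
  have wxy : f w * (f y * f x) = f x * f y by rewrite mulrA.
  have rC : reflection (f x * X) by exact: reflectionM.
  have rF : reflection (Z * f y) by apply: reflectionM => //; exact: commr_sym.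
  have rG : reflection (f x * Z) by exact: reflectionM.
  have rH : reflection (X * f y) by apply: reflectionM => //; exact: commr_sym.
  have yx : f y * f x = f w * (f x * f y) by rewrite -wxy mulrA (rf w).1 mul1r.
  have wxC t : f x * (f w * t) = f w * (f x * t) by rewrite mulrA -wx -mulrA.
  have CFE : f x * X * (Z * f y) = f w * (f x * (Z * (X * f y))).
    by rewrite -!mulrA [X * (Z * _)]mulrA XZ -!mulrA wxC.
  have CF : GRing.comm (f x * X) (Z * f y).
    rewrite /GRing.comm CFE -!mulrA [f y * (f x * X)]mulrA yx -!mulrA yX.
    by rewrite [RHS]mulrA -wZ -mulrA [Z * (f x * _)]mulrA -xZ -!mulrA.
  have GH : GRing.comm (f x * Z) (X * f y).
    rewrite /GRing.comm -!mulrA [f y * (f x * Z)]mulrA yx -!mulrA yZ.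
    rewrite [RHS]mulrA -wX -mulrA [X * (f x * _)]mulrA -xX -mulrA.
    by rewrite [X * (Z * _)]mulrA XZ -!mulrA wxC [RHS]mulrA (rf w).1 mul1r.
  have rI := reflectionM rG rH GH; have rK := reflectionM rC rF CF.
  have rT := reflectionM (rf w) rZ wZ.
  have KI : (f x * X) * (Z * f y) = f w * ((f x * Z) * (X * f y)).
    by rewrite CFE -!mulrA.
  have wy' : GRing.comm (f w) (f y) by [].
  have wI : GRing.comm (f w) ((f x * Z) * (X * f y)).
    by do !apply: commrM => //.
  have wK : GRing.comm ((f x * X) * (Z * f y)) ((f x * Z) * (X * f y)).
    rewrite KI; apply/commr_sym/commrM; last exact: commr_refl.
    exact: commr_sym.
  split; first by case=> -[|[|[|[|[|[|[|[|[|]]]]]]]]].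
  move=> q; rewrite !inE => h.
  repeat (case/predU1P: h => [->|h]; first (rewrite /holds !gE //= expr0; split=> //));
    try (by apply: triple_prod => //; exact: commr_sym);
    try (by exact: commr_sym).
    by rewrite KI -(mulrA (f w)) rI.1 mulr1 (rf w).1.
  case/eqP: h => ->; rewrite /holds !gE //= expr0; split=> //.
  exact: triple_prod.
exists g; split=> [|i].
  split=> -[x|[m k]] /=; try exact: (rf x).1; try exact: (rf x).2.
    exact: ((key m).1 k).1.
  exact: ((key m).1 k).2.
apply/sP: i => q; rewrite mem_cat => /orP[/mapP[j _ ->]|/flattenP[_ /mapP[m _ ->]]].
  by have := fe j; rewrite /lift_eq; case: (e j) => [[[x y] z] b].
exact: (key m).2.
Qed.

End CommutatorSystems.

(** * The Hilbert space of square-summable functions *)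

Section ComplexParts.
Variable R : realType.
Implicit Types (z w : R[i]) (a : R).

Lemma cplxP z w : complex.Re z = complex.Re w -> complex.Im z = complex.Im w -> z = w.
Proof. by case: z w => [a b] [c d] /= -> ->. Qed.

Lemma cImD z w : complex.Im (z + w) = complex.Im z + complex.Im w.
Proof. by case: z w => [a b] [c d]. Qed.

Lemma cReM z w :
  complex.Re (z * w) = complex.Re z * complex.Re w - complex.Im z * complex.Im w.
Proof. by case: z w => [a b] [c d]. Qed.

Lemma cImM z w :
  complex.Im (z * w) = complex.Re z * complex.Im w + complex.Im z * complex.Re w.
Proof. by case: z w => [a b] [c d]. Qed.

Lemma cIm_conj z : complex.Im (z^*) = - complex.Im z.
Proof. by case: z. Qed.

Lemma cRe_sum (I : Type) (r : seq I) (F : I -> R[i]) :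
  complex.Re (\sum_(i <- r) F i) = \sum_(i <- r) complex.Re (F i).
Proof. by apply: (big_morph (@complex.Re R)) => //; exact: cReD. Qed.

Lemma cIm_sum (I : Type) (r : seq I) (F : I -> R[i]) :
  complex.Im (\sum_(i <- r) F i) = \sum_(i <- r) complex.Im (F i).
Proof. by apply: (big_morph (@complex.Im R)) => //; exact: cImD. Qed.

Definition nsq z : R := complex.Re z ^+ 2 + complex.Im z ^+ 2.

Lemma nsq_ge0 z : 0 <= nsq z. Proof. by rewrite addr_ge0 ?sqr_ge0. Qed.

Lemma nsqE z : z * z^* = (nsq z)%:C%C.
Proof. by apply: cplxP; rewrite ?cReM ?cImM cRe_conj cIm_conj /nsq /=; ring. Qed.

Lemma nsqM z w : nsq (z * w) = nsq z * nsq w.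
Proof. by rewrite /nsq cReM cImM; ring. Qed.

Lemma nsqD_le z w : nsq (z + w) <= 2 * (nsq z + nsq w).
Proof.
case: z w => [a b] [c d]; rewrite /nsq /=.
by have := sqr_ge0 (a - c); have := sqr_ge0 (b - d); lra.
Qed.

Lemma nsq0 : nsq 0 = 0. Proof. by rewrite /nsq /= expr0n /= addr0. Qed.

Lemma nsq_eq0 z : nsq z = 0 -> z = 0.
Proof.
move/eqP; rewrite paddr_eq0 ?sqr_ge0 // !sqrf_eq0 => /andP[/eqP a /eqP b].
exact: cplxP.
Qed.

Lemma nsqN z : nsq (- z) = nsq z.
Proof. by case: z => a b; rewrite /nsq /=; ring. Qed.

Lemma nsq_sign (c : bool) z : nsq ((-1) ^+ c * z) = nsq z.
Proof. by case: c; rewrite ?expr1 ?expr0 ?mulN1r ?mul1r ?nsqN. Qed.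

Lemma cRe_mul_le z w : `|complex.Re (z * w^*)| <= nsq z + nsq w.
Proof.
case: z w => [a b] [c d]; rewrite cReM cRe_conj cIm_conj /nsq ler_norml /=.
have := sqr_ge0 (a - c); have := sqr_ge0 (b - d).
have := sqr_ge0 (a + c); have := sqr_ge0 (b + d).
have := sqr_ge0 a; have := sqr_ge0 b; have := sqr_ge0 c; have := sqr_ge0 d.
by move=> ? ? ? ? ? ? ? ?; apply/andP; split; lra.
Qed.

Lemma cIm_mul_le z w : `|complex.Im (z * w^*)| <= nsq z + nsq w.
Proof.
case: z w => [a b] [c d]; rewrite cImM cRe_conj cIm_conj /nsq ler_norml /=.
have := sqr_ge0 (a - d); have := sqr_ge0 (b - c).
have := sqr_ge0 (a + d); have := sqr_ge0 (b + c).
have := sqr_ge0 a; have := sqr_ge0 b; have := sqr_ge0 c; have := sqr_ge0 d.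
by move=> ? ? ? ? ? ? ? ?; apply/andP; split; lra.
Qed.

End ComplexParts.

(** * Summation along an exhaustion by finite sets *)

Section ExhaustedSums.
Variables (R : realType) (G : eqType) (F : nat -> seq G).
Hypothesis F_uniq : forall m, uniq (F m).
Hypothesis F_mono : forall m n, (m <= n)%N -> {subset F m <= F n}.
Hypothesis F_cover : forall g, exists m, g \in F m.
Implicit Types f : G -> R.

(** Sums are taken along a fixed exhaustion because its members will be finite subgroups, which
    translations eventually permute. *)
Definition psum f m : R := \sum_(g <- F m) f g.

Lemma psum_split f m n : (m <= n)%N ->
  psum f n = psum f m + \sum_(g <- F n | g \notin F m) f g.
Proof.
move=> mn; rewrite {1}/psum (bigID (fun g => g \in F m)) /=; congr (_ + _).
rewrite -big_filter; apply: perm_big; apply: uniq_perm => //.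
  exact: filter_uniq.
move=> g; rewrite mem_filter; case: (boolP (g \in F m)) => //= gm.
exact: F_mono gm.
Qed.

Lemma psum_le f m n : (forall g, 0 <= f g) -> (m <= n)%N -> psum f m <= psum f n.
Proof. by move=> f0 mn; rewrite (psum_split f mn) lerDl sumr_ge0. Qed.

Lemma psumD f f' m : psum (fun g => f g + f' g) m = psum f m + psum f' m.
Proof. exact: big_split. Qed.

Lemma psumZ k f m : psum (fun g => k * f g) m = k * psum f m.
Proof. by rewrite /psum mulr_sumr. Qed.

Lemma ler_psum f f' m : (forall g, f g <= f' g) -> psum f m <= psum f' m.
Proof. by move=> h; apply: ler_sum => g _; exact: h. Qed.

Definition summable f := exists c, forall m, psum (fun g => `|f g|) m <= c.

Definition rsum f : R := limn (psum f).

Lemma psum_bounded_cvg f : (forall g, 0 <= f g) ->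
  (exists c, forall m, psum f m <= c) -> cvgn (psum f).
Proof.
move=> f0 [c fc]; apply: nondecreasing_is_cvgn.
  by move=> m n mn; exact: psum_le.
by exists c => _ [m _ <-].
Qed.

Lemma summable_le f f' : (forall g, `|f g| <= f' g) ->
  (exists c, forall m, psum f' m <= c) -> summable f.
Proof. by move=> ff' [c h]; exists c => m; exact: le_trans (ler_psum _ ff') (h m). Qed.

Lemma summable_cvg f : summable f -> cvgn (psum f).
Proof.
move=> [c fc].
have -> : psum f = (fun m => psum (fun g => f g + `|f g|) m) \- psum (fun g => `|f g|).
  by apply/funext => m /=; rewrite psumD addrK.
apply: is_cvgB; apply: psum_bounded_cvg.
- by move=> g; have := ler_norm (- f g); rewrite normrN; lra.
- exists (c + c) => m; rewrite psumD lerD //.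
  by apply: le_trans (fc m); apply: ler_psum => g; exact: ler_norm.
- by [].
- by exists c.
Qed.

Lemma summableD f f' : summable f -> summable f' -> summable (fun g => f g + f' g).
Proof.
move=> [c fc] [c' fc']; apply: summable_le (fun g => ler_normD (f g) (f' g)) _.
by exists (c + c') => m; rewrite psumD lerD.
Qed.

Lemma summableZ k f : summable f -> summable (fun g => k * f g).
Proof.
move=> [c fc]; apply: (@summable_le _ (fun g => `|k| * `|f g|)) => [g|].
  by rewrite normrM.
by exists (`|k| * c) => m; rewrite psumZ ler_wpM2l.
Qed.

Lemma rsumD f f' : summable f -> summable f' ->
  rsum (fun g => f g + f' g) = rsum f + rsum f'.
Proof.
move=> /summable_cvg cf /summable_cvg cf'; rewrite /rsum -limD //.
suff -> : psum (fun g => f g + f' g) = psum f + psum f' by [].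
by apply/funext => m; rewrite psumD.
Qed.

Lemma rsumZ k f : summable f -> rsum (fun g => k * f g) = k * rsum f.
Proof.
move=> /summable_cvg cf; apply: cvg_lim => //.
have -> : psum (fun g => k * f g) = (fun m => k * psum f m).
  by apply/funext => m; rewrite psumZ.
exact: cvgM (cvg_cst k) cf.
Qed.

Lemma rsum_ge_psum f m : (forall g, 0 <= f g) -> summable f -> psum f m <= rsum f.
Proof.
move=> f0 /summable_cvg cf; apply: nondecreasing_cvgn_le => //.
by move=> n p; exact: psum_le.
Qed.

Lemma rsum_le f c : summable f -> (forall m, psum f m <= c) -> rsum f <= c.
Proof. by move=> /summable_cvg cf h; apply: limr_le => //; exact: nearW. Qed.

Lemma term_le_psum f m g : (forall g, 0 <= f g) -> g \in F m -> f g <= psum f m.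
Proof.
by move=> f0 gm; rewrite /psum (big_rem g) //= lerDl sumr_ge0.
Qed.

Lemma rsum_point f g : (forall h, h != g -> f h = 0) -> rsum f = f g.
Proof.
move=> f0; have [m gm] := F_cover g.
apply: cvg_lim => //; apply: cvg_near_cst.
exists m => // n /= mn; rewrite /psum (bigD1_seq g) //=; last exact: F_mono gm.
by rewrite big1 ?addr0 // => h hg; exact: f0.
Qed.

(** Meant for translations: their partial sums agree as soon as the finite subgroup contains the
    translating element. *)
Lemma rsum_eq_near f f' : summable f ->
  (exists m, forall n, (m <= n)%N -> psum f' n = psum f n) -> rsum f' = rsum f.
Proof.
move=> /summable_cvg cf [m h]; apply: cvg_lim => //.
have -> : psum f' = psum f + (psum f' - psum f) by rewrite addrCA subrr addr0.
rewrite -[rsum f]addr0; apply: cvgD => //; apply: cvg_near_cst.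
by exists m => // n /= mn; rewrite /GRing.add /= /GRing.opp /= h // subrr.
Qed.

End ExhaustedSums.

Section Ell2.
Variables (R : realType) (G : eqType) (F : nat -> seq G).
Hypothesis F_uniq : forall m, uniq (F m).
Hypothesis F_mono : forall m n, (m <= n)%N -> {subset F m <= F n}.
Hypothesis F_cover : forall g, exists m, g \in F m.

Definition l2 (x : G -> R[i]) : Prop :=
  exists c, forall m, psum F (fun g => nsq (x g)) m <= c.

Record ell2 := Ell2 { ell2_fun :> G -> R[i]; ell2P : l2 ell2_fun }.

Lemma ell2_ext (x y : ell2) : x =1 y -> x = y.
Proof.
case: x y => [x xP] [y yP] /= /funext xy; rewrite -xy in yP *.
by congr Ell2; exact: Prop_irrelevance.
Qed.

HB.instance Definition _ := gen_eqMixin ell2.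
HB.instance Definition _ := gen_choiceMixin ell2.

Fact l2_0 : l2 (fun=> 0).
Proof. by exists 0 => m; rewrite /psum big1 // => g _; rewrite nsq0. Qed.

Fact l2D x y : l2 x -> l2 y -> l2 (fun g => x g + y g).
Proof.
move=> [c xc] [d yd]; exists (2 * (c + d)) => m.
apply: (@le_trans _ _ (psum F (fun g => 2 * (nsq (x g) + nsq (y g))) m)).
  by apply: ler_psum => g; exact: nsqD_le.
by rewrite psumZ psumD ler_wpM2l // lerD.
Qed.

Fact l2Z k x : l2 x -> l2 (fun g => k * x g).
Proof.
move=> [c xc]; exists (nsq k * c) => m.
suff -> : psum F (fun g => nsq (k * x g)) m = nsq k * psum F (fun g => nsq (x g)) m.
  by rewrite ler_wpM2l ?nsq_ge0.
by rewrite -psumZ; apply: eq_bigr => g _; rewrite nsqM.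
Qed.

Fact l2N x : l2 x -> l2 (fun g => - x g).
Proof.
move=> [c h]; exists c => m; suff -> : psum F (fun g => nsq (- x g)) m =
  psum F (fun g => nsq (x g)) m by [].
by apply: eq_bigr => g _; rewrite nsqN.
Qed.

Definition ell2_0 := Ell2 l2_0.
Definition ell2_opp (x : ell2) := Ell2 (l2N (ell2P x)).
Definition ell2_add (x y : ell2) := Ell2 (l2D (ell2P x) (ell2P y)).
Definition ell2_scale (k : R[i]) (x : ell2) := Ell2 (l2Z k (ell2P x)).

Fact ell2_addA : associative ell2_add.
Proof. by move=> x y z; apply: ell2_ext => g /=; rewrite addrA. Qed.
Fact ell2_addC : commutative ell2_add.
Proof. by move=> x y; apply: ell2_ext => g /=; rewrite addrC. Qed.
Fact ell2_add0 : left_id ell2_0 ell2_add.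
Proof. by move=> x; apply: ell2_ext => g /=; rewrite add0r. Qed.
Fact ell2_addN : left_inverse ell2_0 ell2_opp ell2_add.
Proof. by move=> x; apply: ell2_ext => g /=; rewrite addNr. Qed.

HB.instance Definition _ := GRing.isZmodule.Build ell2
  ell2_addA ell2_addC ell2_add0 ell2_addN.

Fact ell2_scaleA k l x : ell2_scale k (ell2_scale l x) = ell2_scale (k * l) x.
Proof. by apply: ell2_ext => g /=; rewrite mulrA. Qed.
Fact ell2_scale1 : left_id 1 ell2_scale.
Proof. by move=> x; apply: ell2_ext => g /=; rewrite mul1r. Qed.
Fact ell2_scaleDr : right_distributive ell2_scale +%R.
Proof. by move=> k x y; apply: ell2_ext => g /=; rewrite mulrDr. Qed.
Fact ell2_scaleDl x : {morph ell2_scale^~ x : k l / k + l}.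
Proof. by move=> k l; apply: ell2_ext => g /=; rewrite mulrDl. Qed.

HB.instance Definition _ := GRing.Zmodule_isLmodule.Build R[i] ell2
  ell2_scaleA ell2_scale1 ell2_scaleDr ell2_scaleDl.

Lemma ell2DE (x y : ell2) g : (x + y) g = x g + y g. Proof. by []. Qed.
Lemma ell2ZE k (x : ell2) g : (k *: x) g = k * x g. Proof. by []. Qed.

Definition csummable (f : G -> R[i]) :=
  summable F (fun g => complex.Re (f g)) /\ summable F (fun g => complex.Im (f g)).

Definition csum (f : G -> R[i]) : R[i] :=
  (rsum F (fun g => complex.Re (f g)) +i* rsum F (fun g => complex.Im (f g)))%C.

Let RD := @rsumD R G F F_uniq F_mono.
Let RZ := @rsumZ R G F F_uniq F_mono.

Lemma csumD f f' : csummable f -> csummable f' ->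
  csum (fun g => f g + f' g) = csum f + csum f'.
Proof.
move=> [rf jf] [rf' jf']; apply: cplxP.
  by rewrite cReD /= -RD //; congr rsum; apply/funext => g; rewrite cReD.
by rewrite cImD /= -RD //; congr rsum; apply/funext => g; rewrite cImD.
Qed.

Lemma csumZ k f : csummable f -> csum (fun g => k * f g) = k * csum f.
Proof.
move=> [rf jf]; apply: cplxP.
  rewrite cReM /= -mulNr -!RZ // -RD; [|exact: summableZ..].
  by congr rsum; apply/funext => g; rewrite cReM mulNr.
rewrite cImM /= -!RZ // -RD; [|exact: summableZ..].
by congr rsum; apply/funext => g; rewrite cImM.
Qed.

Lemma csummableZ k f : csummable f -> csummable (fun g => k * f g).
Proof.
move=> [rf jf]; split.
  have -> : (fun g => complex.Re (k * f g)) =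
      (fun g => complex.Re k * complex.Re (f g) + - complex.Im k * complex.Im (f g)).
    by apply/funext => g; rewrite cReM mulNr.
  by apply: summableD; exact: summableZ.
have -> : (fun g => complex.Im (k * f g)) =
    (fun g => complex.Re k * complex.Im (f g) + complex.Im k * complex.Re (f g)).
  by apply/funext => g; rewrite cImM.
by apply: summableD; exact: summableZ.
Qed.

Lemma csum_conj f : csummable f -> csum (fun g => (f g)^*) = (csum f)^*.
Proof.
move=> [rf jf]; apply: cplxP; rewrite ?cRe_conj ?cIm_conj /=.
  by congr rsum; apply/funext => g; rewrite cRe_conj.
rewrite -mulN1r -RZ //.
by congr rsum; apply/funext => g; rewrite cIm_conj mulN1r.
Qed.

Lemma csum_point f g : (forall h, h != g -> f h = 0) -> csum f = f g.
Proof.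
move=> f0; apply: cplxP; rewrite /=;
  by apply: (rsum_point F_uniq F_mono F_cover) => h /f0->.
Qed.

Lemma csum_eq_near f f' : csummable f ->
  (exists m, forall n, (m <= n)%N -> \sum_(g <- F n) f' g = \sum_(g <- F n) f g) ->
  csum f' = csum f.
Proof.
move=> [rf jf] [m h]; apply: cplxP => /=;
  apply: (rsum_eq_near F_uniq F_mono) => //; exists m => n /h e;
  by rewrite /psum -!(cRe_sum, cIm_sum) e.
Qed.

Lemma ell2_csummable (x y : ell2) : csummable (fun g => x g * (y g)^*).
Proof.
have [c xc] := ell2P x; have [d yd] := ell2P y.
have b : exists c, forall m, psum F (fun g => nsq (x g) + nsq (y g)) m <= c.
  by exists (c + d) => m; rewrite psumD lerD.
split; apply: (summable_le _ b) => g; [exact: cRe_mul_le|exact: cIm_mul_le].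
Qed.

Definition ell2_ip (x y : ell2) : R[i] := csum (fun g => x g * (y g)^*).

Fact ell2_ip_herm x y : ell2_ip x y = (-1) ^+ false * (ell2_ip y x)^*.
Proof.
rewrite expr0 mul1r -csum_conj; last exact: ell2_csummable.
by congr csum; apply/funext => g; rewrite rmorphM /= conjCK mulrC.
Qed.

Fact ell2_ip_linl z : GRing.linear_for *%R (ell2_ip ^~ z).
Proof.
move=> k x y; rewrite /ell2_ip -csumZ; last exact: ell2_csummable.
rewrite -csumD; [|exact/csummableZ/ell2_csummable|exact: ell2_csummable].
by congr csum; apply/funext => g; rewrite ell2DE ell2ZE mulrDl mulrA.
Qed.

Fact ell2_ip_linr x : GRing.linear_for (Num.conj \; *%R) (ell2_ip x).
Proof.
move=> k y z; have H := ell2_ip_herm; rewrite H ell2_ip_linl H [ell2_ip x z]H.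
by rewrite /= !expr0 !mul1r rmorphD rmorphM /= conjCK.
Qed.

Lemma ell2_ipxx x : ell2_ip x x = (rsum F (fun g => nsq (x g)))%:C%C.
Proof.
apply: cplxP => /=.
  by congr rsum; apply/funext => g; rewrite nsqE.
by apply: cvg_lim => //; apply: cvg_near_cst; apply: nearW => m;
  rewrite /psum big1 // => g _; rewrite nsqE.
Qed.

Lemma ell2_summable (x : ell2) : summable F (fun g => nsq (x g)).
Proof.
have [c xc] := ell2P x; exists c => m.
suff -> : psum F (fun g => `|nsq (x g)|) m = psum F (fun g => nsq (x g)) m by [].
by apply: eq_bigr => g _; rewrite ger0_norm ?nsq_ge0.
Qed.

Lemma nsq_le_ip (x : ell2) g : nsq (x g) <= rsum F (fun g => nsq (x g)).
Proof.
have [m gm] := F_cover g.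
apply: le_trans (rsum_ge_psum F_uniq F_mono m _ (ell2_summable x)) => [|h].
  by apply: (term_le_psum (f := fun g => nsq (x g))) => // h; exact: nsq_ge0.
exact: nsq_ge0.
Qed.

Fact ell2_ip_gt0 x : x != 0 -> 0 < ell2_ip x x.
Proof.
move=> x0; rewrite ell2_ipxx ltcR lt_neqAle eq_sym; apply/andP; split.
  apply: contra x0 => /eqP s0; apply/eqP/ell2_ext => g; apply: nsq_eq0.
  by apply/eqP; rewrite eq_le nsq_ge0 andbT -s0 nsq_le_ip.
apply: le_trans (rsum_ge_psum F_uniq F_mono 0 _ (ell2_summable x)) => [|h];
  last exact: nsq_ge0.
by apply: sumr_ge0 => h _; exact: nsq_ge0.
Qed.

HB.instance Definition _ := bilinear_isBilinear.Build R[i] ell2 ell2 R[i]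
  *%R (Num.conj \; *%R) ell2_ip (ell2_ip_linl, ell2_ip_linr).
HB.instance Definition _ := isHermitianSesquilinear.Build R[i] ell2 false Num.conj
  ell2_ip ell2_ip_herm.
HB.instance Definition _ := isDotProduct.Build R[i] ell2 ell2_ip ell2_ip_gt0.


Local Notation ipn := (ip_norm ell2_ip).

Lemma ip_normE (x : ell2) : ipn x = Num.sqrt (rsum F (fun g => nsq (x g))).
Proof. by rewrite /ip_norm ell2_ipxx. Qed.

Lemma nsq_le_ip_norm (x : ell2) g : nsq (x g) <= ipn x ^+ 2.
Proof.
rewrite ip_normE sqr_sqrtr ?nsq_le_ip //.
exact: le_trans (nsq_ge0 (x g)) (nsq_le_ip x g).
Qed.

Lemma ip_norm_le (x : ell2) c : 0 <= c -> (forall m, psum F (fun g => nsq (x g)) m <= c ^+ 2) ->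
  ipn x <= c.
Proof.
move=> c0 h; rewrite ip_normE -(ger0_norm c0) -sqrtr_sqr ler_wsqrtr //.
exact: (rsum_le F_uniq F_mono (ell2_summable x)).
Qed.

Lemma psum_le_ip_norm (x : ell2) m : psum F (fun g => nsq (x g)) m <= ipn x ^+ 2.
Proof.
have h := rsum_ge_psum F_uniq F_mono m (fun g => nsq_ge0 (x g)) (ell2_summable x).
rewrite ip_normE sqr_sqrtr //; apply: le_trans h.
by apply: sumr_ge0 => g _; exact: nsq_ge0.
Qed.

Lemma cauchy_real_cvg (v : nat -> R) :
  (forall e, 0 < e -> exists N, forall m n, (N <= m)%N -> (N <= n)%N ->
    `|v m - v n| < e) -> cvgn v.
Proof.
move=> h; apply: cauchy_cvg; apply: cauchy_exP => e e0; have [N hN] := h e e0.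
by exists (v N); exists N => // n /= Nn; exact: hN.
Qed.

Lemma cvg_psum (v : nat -> G -> R) (l : G -> R) M :
  (forall g, (v^~ g @ \oo --> l g)%classic) ->
  ((fun n => psum F (v n) M) @ \oo --> psum F l M)%classic.
Proof.
move=> h; rewrite /psum; elim: (F M) => [|g s IH].
  rewrite big_nil; have -> : (fun n => \sum_(g <- [::]) v n g) = (fun=> 0).
    by apply/funext => n; rewrite big_nil.
  exact: cvg_cst.
rewrite big_cons; have -> : (fun n => \sum_(g0 <- g :: s) v n g0) =
    (fun n => v n g + \sum_(g0 <- s) v n g0).
  by apply/funext => n; rewrite big_cons.
exact: cvgD (h g) IH.
Qed.

(** The pointwise limit is the candidate. The Cauchy bound on a finite partial sum passes to the
    limit with a constant independent of the sum, which gives both square-summability and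
    convergence. *)
Lemma ell2_complete (u : nat -> ell2) :
  (forall e : R, 0 < e -> exists N, forall m n, (N <= m)%N -> (N <= n)%N ->
      ipn (u m - u n) < e) ->
  exists l, ((fun n => ipn (u n - l)) @ \oo --> (0 : R))%classic.
Proof.
move=> hu.
have part (p : R[i] -> R) : (forall z w, p (z - w) = p z - p w) ->
    (forall z, p z ^+ 2 <= nsq z) -> forall g, cvgn (fun n => p (u n g)).
  move=> pB pn g; apply: cauchy_real_cvg => e e0; have [N hN] := hu e e0.
  exists N => m n Nm Nn; rewrite -pB -(ltr_pXn2r (n := 2)) ?nnegrE ?(ltW e0) //.
  rewrite real_normK ?num_real //; apply: le_lt_trans (pn _) _.
  apply: le_lt_trans (nsq_le_ip_norm (u m - u n) g) _.
  by rewrite ltr_pXn2r ?nnegrE ?sqrtr_ge0 ?(ltW e0) // hN.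
have cR := part (@complex.Re R); have cI := part (@complex.Im R).
pose l g : R[i] := (limn (fun n => complex.Re (u n g)) +i*
                    limn (fun n => complex.Im (u n g)))%C.
have lP x g : ((fun n => nsq (x - u n g)) @ \oo --> nsq (x - l g))%classic.
  have hR : ((fun n => complex.Re (u n g)) @ \oo --> complex.Re (l g))%classic.
    apply: cR => [z w|z]; first by rewrite cReD cReN.
    by rewrite /nsq lerDl sqr_ge0.
  have hI : ((fun n => complex.Im (u n g)) @ \oo --> complex.Im (l g))%classic.
    apply: cI => [z w|z]; first by case: z w => [a b] [c d].
    by rewrite /nsq lerDr sqr_ge0.
  have -> : (fun n => nsq (x - u n g)) = (fun n =>
      (complex.Re x - complex.Re (u n g)) * (complex.Re x - complex.Re (u n g)) +
      (complex.Im x - complex.Im (u n g)) * (complex.Im x - complex.Im (u n g))).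
    by apply/funext => n; rewrite /nsq; case: x (u n g) => [a b] [c d] /=; rewrite !expr2.
  have -> : nsq (x - l g) =
      (complex.Re x - complex.Re (l g)) * (complex.Re x - complex.Re (l g)) +
      (complex.Im x - complex.Im (l g)) * (complex.Im x - complex.Im (l g)).
    by rewrite /nsq; case: x (l g) => [a b] [c d] /=; rewrite !expr2.
  by apply: cvgD; apply: cvgM; apply: cvgB => //; exact: cvg_cst.
have tail e N : 0 < e -> (forall m n, (N <= m)%N -> (N <= n)%N -> ipn (u m - u n) < e) ->
    forall n, (N <= n)%N -> forall M, psum F (fun g => nsq (u n g - l g)) M <= e ^+ 2.
  move=> e0 hN n Nn M.
  have h := @cvg_psum (fun m g => nsq (u n g - u m g)) _ M (fun g => lP (u n g) g).
  apply: (cvgr_to_le h); exists N => // m /= Nm; apply: le_trans (psum_le_ip_norm (u n - u m) M) _.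
  by rewrite ler_pXn2r ?nnegrE ?sqrtr_ge0 ?(ltW e0) // ltW // hN.
have l_l2 : l2 l.
  have [N hN] := hu 1 ltr01; have [c uc] := ell2P (u N).
  exists (2 * (c + 1 ^+ 2)) => m.
  apply: (@le_trans _ _ (psum F (fun g => 2 * (nsq (u N g) + nsq (u N g - l g))) m)).
    apply: ler_psum => g; have := nsqD_le (u N g) (- (u N g - l g)).
    by rewrite nsqN subKr.
  rewrite psumZ psumD ler_wpM2l // lerD //; exact: (tail _ _ ltr01 hN).
exists (Ell2 l_l2); apply/cvgr0Pnorm_le => e e0; have [N hN] := hu e e0.
exists N => // n /= Nn; rewrite ger0_norm ?sqrtr_ge0 //; apply: ip_norm_le (ltW e0) _ => M.
exact: (tail _ _ e0 hN).
Qed.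

Definition ell2_hilbert : hilbert R := Hilbert (ip := ell2_ip) ell2_complete.

End Ell2.

(** * Twisted group von Neumann algebras *)

Section Commutants.
Variables (R : realType) (H : hilbert R).
Implicit Types A : set (bop H).

Lemma commutant_star_subalgebra A : (forall T, A T -> A (star T)) ->
  star_subalgebra (commutant A).
Proof.
move=> As; split=> [S _|S T cS cT V AV|k T cT V AV|S T cS cT V AV|T cT V AV].
- by rewrite mulr1 mul1r.
- by rewrite mulrDr mulrDl cS // cT.
- by rewrite -scalAr -scalAl cT.
- by rewrite mulrA cS // -mulrA cT // mulrA.
- by rewrite -[V]starK -!starM cT //; exact: As.
Qed.

Lemma commutant_star A : (forall T, A T -> A (star T)) ->
  forall T, commutant A T -> commutant A (star T).
Proof. by move=> /commutant_star_subalgebra[]. Qed.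

Lemma sub_bicommutant A T : A T -> commutant (commutant A) T.
Proof. by move=> AT S cS; rewrite cS. Qed.

Lemma tricommutant A : commutant (commutant (commutant A)) = commutant A.
Proof.
apply/seteqP; split=> T cT S AS; first by apply: cT => V cV; rewrite cV.
by rewrite AS.
Qed.

Lemma bicommutant_von_neumann A : (forall T, A T -> A (star T)) ->
  von_neumann_algebra (commutant (commutant A)).
Proof.
move=> As; split; last by rewrite tricommutant.
exact/commutant_star_subalgebra/commutant_star.
Qed.

End Commutants.

Section TwistedGroupAlgebra.
Variables (R : realType) (G : zmodType) (F : nat -> seq G).
Hypothesis F_uniq : forall m, uniq (F m).
Hypothesis F_mono : forall m n, (m <= n)%N -> {subset F m <= F n}.
Hypothesis F_cover : forall g, exists m, g \in F m.
Hypothesis F_add : forall m g h, g \in F m -> h \in F m -> g + h \in F m.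
Hypothesis F_large : forall n, exists m, (n < size (F m))%N.
Hypothesis addgg : forall g : G, g + g = 0.
Variable B : G -> G -> bool.
Hypothesis BDl : forall g h k, B (g + h) k = B g k (+) B h k.
Hypothesis BDr : forall g h k, B g (h + k) = B g h (+) B g k.
Hypothesis B_nondeg : forall h, (forall g, B g h = B h g) -> h = 0.

Notation H := (ell2_hilbert R F_uniq F_mono F_cover).

Lemma addKg g h : g + (g + h) = h :> G.
Proof. by rewrite addrA addgg add0r. Qed.

Lemma B0l g : B 0 g = false.
Proof. by have := BDl 0 0 g; rewrite addr0 addbb. Qed.

Lemma B0r g : B g 0 = false.
Proof. by have := BDr g 0 0; rewrite addr0 addbb. Qed.

Lemma sum_translate (V : nmodType) m (f : G -> V) g : g \in F m ->
  \sum_(h <- F m) f (g + h) = \sum_(h <- F m) f h.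
Proof.
move=> gm; rewrite -(big_map (+%R g) xpredT f); apply: perm_big.
apply: uniq_perm => //; first by rewrite map_inj_uniq //; exact: addrI.
move=> h; apply/mapP/idP => [[k km ->]|hm]; first exact: F_add.
by exists (g + h); [exact: F_add|rewrite addKg].
Qed.

Lemma shift_l2 (x : G -> R[i]) g (s : G -> bool) : l2 F x ->
  l2 F (fun h => (-1) ^+ s h * x (g + h)).
Proof.
move=> [c xc]; exists c => m; have [m0 gm] := F_cover g.
(* The larger set contains [g] and is closed under addition, so translation by [g] permutes it. *)
apply: (@le_trans _ _ (psum F (fun h => nsq (x (g + h))) (maxn m m0))).
  rewrite /psum; under eq_bigr => h _ do rewrite nsq_sign.
  by apply: (psum_le F_uniq F_mono (fun h => nsq_ge0 (x (g + h)))); exact: leq_maxl.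
rewrite /psum (sum_translate (fun h => nsq (x h))) ?xc //.
exact: F_mono (leq_maxr _ _) _ gm.
Qed.

Definition shift_fun g (s : G -> bool) (x : H) : H := Ell2 (shift_l2 g s (ell2P x)).

Lemma shift_adjoint g s : adjoint (shift_fun g s) (shift_fun g (fun h => s (g + h))).
Proof.
move=> x y; rewrite /ip /= /ell2_ip; have [m gm] := F_cover g.
apply: csum_eq_near => //; first exact: (ell2_csummable x (shift_fun g _ y)).
exists m => n mn; rewrite -[RHS](@sum_translate _ n _ g); last exact: F_mono gm.
apply: eq_bigr => h _ /=; rewrite addKg rmorphM rmorph_sign /=.
by rewrite -mulrA mulrCA.
Qed.

Lemma shift_shift g s (x : H) :
  shift_fun g (fun h => s (g + h)) (shift_fun g s x) = x.
Proof.
apply: ell2_ext => h /=; rewrite addKg mulrA -signr_addb addbb expr0 mul1r //.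
Qed.

Lemma shift_bound g s : sq_bound 1 (shift_fun g s).
Proof.
split=> // x; rewrite mul1r /hsq shift_adjoint shift_shift //.
Qed.

Definition shift g s : bop H :=
  mk_bop (@shift_adjoint g s) (ex_intro _ 1 (shift_bound g s)).

(** With [rho], the left and right regular representations twisted by the cocycle [(-1) ^+ B]. As
    the group has exponent two, translation by [g] reads the value at [g + h]. *)
Definition lam g : bop H := shift g (fun h => B g (g + h)).
Definition rho g : bop H := shift g (fun h => B (g + h) g).

Lemma lamE g (x : H) h : (lam g x : H) h = (-1) ^+ B g (g + h) * (x : ell2 R F) (g + h).
Proof. by []. Qed.

Lemma rhoE g (x : H) h : (rho g x : H) h = (-1) ^+ B (g + h) g * (x : ell2 R F) (g + h).
Proof. by []. Qed.

Lemma bop_ext (S T : bop H) : (forall x h, (S x : ell2 R F) h = (T x : ell2 R F) h) -> S = T.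
Proof. by move=> ST; apply: bopP => x; apply: ell2_ext => h; exact: ST. Qed.

Lemma lamM g h : lam g * lam h = (-1) ^+ B g h * lam (g + h).
Proof.
rewrite -scal_sign; apply: bop_ext => x k.
rewrite [LHS](lamE g (lam h x) k) lamE [RHS]/= mulrA -signr_addb.
rewrite [RHS](_ : _ = (-1) ^+ B g h * ((-1) ^+ B (g + h) (g + h + k) * (x : ell2 R F) (g + h + k))) //.
rewrite mulrA -signr_addb [h + _]addrCA addrA.
congr (_ * _); congr ((-1) ^+ (nat_of_bool _)).
rewrite !BDr !BDl; move: (B g g) (B g h) (B g k) (B h g) (B h h) (B h k).
by do 6 case.
Qed.

Lemma lam0 : lam 0 = 1.
Proof. by apply: bop_ext => x h; rewrite lamE B0l add0r mul1r. Qed.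

Lemma lam_star g : star (lam g) = (-1) ^+ B g g * lam g.
Proof.
rewrite -scal_sign; apply: bop_ext => x h.
rewrite [LHS](_ : _ = (-1) ^+ B g (g + (g + h)) * (x : ell2 R F) (g + h)) //.
rewrite [RHS](_ : _ = (-1) ^+ B g g * ((-1) ^+ B g (g + h) * (x : ell2 R F) (g + h))) //.
by rewrite mulrA -signr_addb BDr.
Qed.

Lemma lam_rho g h : lam g * rho h = rho h * lam g.
Proof.
apply: bop_ext => x k.
rewrite [LHS](lamE g (rho h x) k) [RHS](rhoE h (lam g x) k) lamE rhoE.
rewrite !mulrA -!signr_addb [h + _]addrCA; congr (_ * _).
congr ((-1) ^+ (nat_of_bool _)); rewrite !BDr !BDl.
move: (B g g) (B g h) (B g k) (B h g) (B h h) (B h k) (B k h).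
by do 7 case.
Qed.

Fact delta_l2 g : l2 F (fun h => (h == g)%:R : R[i]).
Proof.
exists 1 => m; rewrite /psum.
have [gm|gm] := boolP (g \in F m); last first.
  rewrite big_seq big1 ?ler01 // => h hm.
  by rewrite (negbTE (memPn gm h hm)) nsq0.
rewrite (bigD1_seq g) //= eqxx big1 => [|h hg]; last by rewrite (negbTE hg) nsq0.
by rewrite /nsq /= expr0n /= expr1n !addr0.
Qed.

Definition delta g : H := Ell2 (delta_l2 g).

Lemma ip_delta (x : H) g : ip x (delta g) = (x : ell2 R F) g.
Proof.
rewrite /ip /= /ell2_ip (csum_point F_uniq F_mono F_cover (g := g)) /=.
  by rewrite eqxx rmorph1 mulr1.
by move=> h hg; rewrite (negbTE hg) rmorph0 mulr0.
Qed.

Lemma lam_delta g h : lam g (delta h) = (-1) ^+ B g h *: delta (g + h).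
Proof.
apply: ell2_ext => k; rewrite lamE ell2ZE /=.
have -> : (g + k == h) = (k == g + h).
  by apply/eqP/eqP => [<-|->]; rewrite addKg.
by case: eqP => [->|_]; rewrite ?addKg ?mulr0.
Qed.

Lemma rho_delta0 h : rho h (delta 0) = delta h.
Proof.
apply: ell2_ext => k; rewrite rhoE /=.
have -> : (h + k == 0) = (k == h).
  by apply/eqP/eqP => [hk|->//]; rewrite -[k](addKg h) hk addr0.
by case: eqP => [->|_]; rewrite ?mulr0 // addgg B0l mulr1.
Qed.

Local Open Scope classical_set_scope.

Definition lam_span n : set (bop H) :=
  [set T | exists c : G -> R[i], T = \sum_(g <- F n) scal (c g) (lam g)].

Lemma lam_spanD n S T : lam_span n S -> lam_span n T -> lam_span n (S + T).
Proof.
move=> [c ->] [d ->]; exists (fun g => c g + d g).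
by rewrite -big_split; apply: eq_bigr => g _; rewrite scalDl.
Qed.

Lemma lam_spanZ n k T : lam_span n T -> lam_span n (scal k T).
Proof.
move=> [c ->]; exists (fun g => k * c g).
by rewrite scal_sum; apply: eq_bigr => g _; rewrite scalA.
Qed.

Lemma lam_span_sum n (I : eqType) (r : seq I) (T : I -> bop H) :
  (forall i, i \in r -> lam_span n (T i)) -> lam_span n (\sum_(i <- r) T i).
Proof.
move=> h; rewrite big_seq; apply: big_ind => //; last exact: lam_spanD.
by exists (fun=> 0); rewrite big1 // => g _; rewrite scal0.
Qed.

Lemma lam_span_lam n g : g \in F n -> lam_span n (lam g).
Proof.
move=> gn; exists (fun h => (h == g)%:R); rewrite (bigD1_seq g) //= eqxx scal1.
by rewrite big1 ?addr0 // => h /negbTE->; rewrite scal0.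
Qed.

Lemma lam_span_sign n (c : bool) T : lam_span n T -> lam_span n ((-1) ^+ c * T).
Proof. by rewrite -scal_sign; exact: lam_spanZ. Qed.

Lemma lam_span_mono m n : (m <= n)%N -> lam_span m `<=` lam_span n.
Proof.
move=> mn _ [c ->]; apply: lam_span_sum => g gm; apply: lam_spanZ.
exact/lam_span_lam/(F_mono mn).
Qed.

Hypothesis F_nonempty : forall n, 0 \in F n.

Lemma lam_span_star_subalgebra n : star_subalgebra (lam_span n).
Proof.
split=> [|S T|k T|_ _ [c ->] [d ->]|_ [c ->]].
- by rewrite -lam0; exact: lam_span_lam.
- exact: lam_spanD.
- exact: lam_spanZ.
- rewrite mulr_suml; apply: lam_span_sum => g gn.
  rewrite mulr_sumr; apply: lam_span_sum => h hn.
  rewrite -scalAl -scalAr lamM; do 2 apply: lam_spanZ; apply: lam_span_sign.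
  exact/lam_span_lam/F_add.
- rewrite star_sum; apply: lam_span_sum => g gn.
  by rewrite starZ lam_star; apply/lam_spanZ/lam_span_sign/lam_span_lam.
Qed.

Lemma lam_span_finite_dimensional n : finite_dimensional (lam_span n).
Proof.
exists (size (F n)), (fun i => lam (nth 0 (F n) i)) => _ [c ->].
exists (fun i : 'I_(size (F n)) => c (nth 0 (F n) i)).
by rewrite (big_nth 0) big_mkord.
Qed.

Definition lam_union : set (bop H) := \bigcup_n lam_span n.

Definition tga : set (bop H) := commutant (commutant lam_union).

Lemma lam_union_star T : lam_union T -> lam_union (star T).
Proof. by move=> [n _ Tn]; exists n => //; have [_ _ _ _] := lam_span_star_subalgebra n; apply. Qed.

Lemma lam_span_tga n : lam_span n `<=` tga.
Proof. by move=> T Tn; apply: sub_bicommutant; exists n. Qed.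

Lemma tga_von_neumann : von_neumann_algebra tga.
Proof. exact/bicommutant_von_neumann/lam_union_star. Qed.

Lemma tga_star T : tga T -> tga (star T).
Proof. by have [[_ _ _ _ h] _] := tga_von_neumann; exact: h. Qed.

Lemma rho_commutant h : commutant lam_union (rho h).
Proof.
move=> _ [n _ [c ->]]; rewrite mulr_suml mulr_sumr; apply: eq_bigr => g _.
by rewrite -scalAl -scalAr lam_rho.
Qed.

(** Right translations commute with the algebra and carry [delta 0] to every [delta h]; so [T] is
    determined by the vector [T (delta 0)]. *)
Lemma tga_delta T h : tga T -> T (delta h) = rho h (T (delta 0)).
Proof.
move=> MT; have e := MT _ (rho_commutant h).
by rewrite -rho_delta0 -[T (rho h _)]/((T * rho h) _) -e.
Qed.

Lemma tga_star_delta T h : tga T ->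
  (star T (delta 0) : ell2 R F) h = (-1) ^+ B h h * ((T (delta 0) : ell2 R F) h)^*.
Proof.
move=> MT; rewrite -ip_delta [LHS](adjointC (@bop_adjoint _ _ T)) tga_delta //.
by rewrite ipC ip_delta rhoE addr0 rmorphM rmorph_sign.
Qed.

(** The coordinates of [star T (delta 0)] are, up to sign, the conjugates of those of [T (delta 0)].
    So [star T] kills every [delta h], and the range of [T] is orthogonal to all of them. *)
Lemma tga_separating T : tga T -> T (delta 0) = 0 -> T = 0.
Proof.
move=> MT T0.
have S0 : star T (delta 0) = 0.
  by apply: ell2_ext => h; rewrite tga_star_delta // T0 /= rmorph0 mulr0.
apply: bopP => x; apply: ell2_ext => h; rewrite -ip_delta bop_adjoint.
rewrite -[bop_adj T _]/(star T (delta h)) tga_delta; last exact: tga_star.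
have -> : rho h (star T (delta 0)) = 0.
  by rewrite S0; apply: ell2_ext => k; rewrite rhoE /= mulr0.
by rewrite ip0r.
Qed.

Definition tga_tr (T : bop H) : R[i] := ip (T (delta 0)) (delta 0).

Lemma tga_trE T : tga_tr T = (T (delta 0) : ell2 R F) 0.
Proof. exact: ip_delta. Qed.

(** For central [T], [lam g] and [rho g] agree on [T (delta 0)]. Hence its coordinate at [h]
    vanishes whenever some [g] has [B g h != B h g], that is for all [h != 0], and the coordinate at
    0 is the trace. *)
Lemma tga_factor : Defs.factor tga.
Proof.
split; first exact: tga_von_neumann.
have [[M1 MD MZ MM MS] _] := tga_von_neumann.
move=> T MT cT; exists (tga_tr T); apply/eqP; rewrite -subr_eq0; apply/eqP.
apply: tga_separating.
  by apply: MD => //; rewrite -scal_N1; exact/MZ/MZ.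
apply: ell2_ext => h.
rewrite -[LHS]/((T (delta 0) : ell2 R F) h + - (tga_tr T * (delta 0 : ell2 R F) h)) /=.
have [->|h0] := eqVneq h 0; first by rewrite mulr1 -tga_trE subrr.
rewrite mulr0 subr0.
have [g gh] : exists g, B g h != B h g.
  apply: contrapT => /forallNP allg; case/eqP: h0; apply: B_nondeg => g.
  by have /negP/negPn/eqP := allg g.
have lamT : lam g * T = T * lam g.
  have [n gn] := F_cover g; apply: cT.
  exact/lam_span_tga/lam_span_lam/gn.
have : lam g (T (delta 0)) = rho g (T (delta 0)).
  rewrite -[LHS]/((lam g * T) _) lamT -[LHS]/(T (lam g (delta 0))).
  by rewrite lam_delta B0r expr0 scale1r addr0 tga_delta.
move=> /(congr1 (fun x : H => (x : ell2 R F) (g + h))); rewrite lamE rhoE !addKg.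
move: gh; case: (B g h); case: (B h g) => //= _; rewrite ?expr0 ?expr1 ?mul1r ?mulN1r.
  by move=> /esym/eqP; rewrite -addr_eq0 -mulr2n mulrn_eq0 => /eqP.
by move=> /eqP; rewrite -addr_eq0 -mulr2n mulrn_eq0 => /eqP.
Qed.

(** Both traces are the same sum, symmetric in the coordinates of [S (delta 0)] and
    [T (delta 0)]. *)
Lemma tga_trC S T : tga S -> tga T -> tga_tr (S * T) = tga_tr (T * S).
Proof.
have e S' T' : tga S' -> tga_tr (S' * T') =
    csum F (fun h => (-1) ^+ B h h * ((S' (delta 0) : ell2 R F) h * (T' (delta 0) : ell2 R F) h)).
  move=> MS; rewrite /tga_tr -[(S' * T') _]/(S' (T' (delta 0))) bop_adjoint.
  rewrite -[bop_adj S' _]/(star S' (delta 0)) /ip /= /ell2_ip.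
  congr csum; apply/funext => h; rewrite tga_star_delta // rmorphM rmorph_sign /=.
  by rewrite conjCK mulrCA [_ * (S' _ : ell2 R F) _]mulrC.
move=> MS MT; rewrite !e //; congr csum; apply/funext => h.
by rewrite [(S _ : ell2 R F) _ * _]mulrC.
Qed.

Lemma tga_tracial : tracial_state tga tga_tr.
Proof.
split.
- by move=> S T _ _; rewrite /tga_tr -ipDl.
- by move=> k T _; rewrite /tga_tr -ipZl.
- by rewrite tga_trE /= eqxx.
- by move=> T _; apply.
- exact: tga_trC.
- move=> T MT T0; apply: tga_separating => //; apply: ip_eq0.
  by rewrite bop_adjoint [X in ip _ X](_ : _ = (star T * T) (delta 0)) // ipC -/(tga_tr _) T0 rmorph0.
(* The trace is a single vector functional, so one nonzero term suffices for normality. *)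
pose xi n : H := if n is 0 then delta 0 else 0.
have xi_cvg : cvgn (series (fun n => hnorm (xi n) ^+ 2)).
  apply/cvg_ex; exists (hnorm (xi 0%N) ^+ 2); apply: cvg_near_cst.
  exists 1%N => // -[//|n] _ /=; rewrite /series /= big_nat_recl // big1 ?addr0 //.
  by move=> i _; rewrite /hnorm /ip_norm ip0l /= sqrtr0 expr0n.
exists xi, xi; split=> // T _; apply: cvg_near_cst.
exists 1%N => // -[//|n] _ /=; rewrite big_ord_recl big1 ?addr0 // => i _.
exact: (@ip0r R H).
Qed.

Lemma tga_hyperfinite : hyperfinite tga.
Proof.
exists lam_span; split=> // n; last exact: lam_span_mono.
by split; [exact: lam_span_star_subalgebra|exact: lam_span_finite_dimensional].
Qed.

(** The [lam g] map [delta 0] to distinct basis vectors, hence are independent, while more than [n]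
    of them in a span of [n] operators would satisfy a linear relation, read off from a left
    kernel. *)
Lemma tga_infinite : ~ finite_dimensional tga.
Proof.
move=> [n [e he]]; have [m nm] := F_large n.
have /choice[c hc] : forall i : 'I_(size (F m)), exists c : 'I_n -> R[i],
    lam (nth 0 (F m) i) = \sum_k scal (c k) (e k).
  by move=> i; apply/he/lam_span_tga/lam_span_lam/mem_nth.
pose A : 'M[R[i]]_(size (F m), n) := \matrix_(i, k) c i k.
have : kermx A != 0.
  by rewrite -mxrank_eq0 mxrank_ker subn_eq0 -ltnNge (leq_ltn_trans (rank_leq_col A)).
move=> /rowV0Pn[v /sub_kermxP vA v0]; case/eqP: v0.
apply/rowP => i; rewrite mxE.
have s0 : \sum_i scal (v 0 i) (lam (nth 0 (F m) i)) = 0.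
  under eq_bigr => j _ do rewrite hc scal_sum.
  rewrite exchange_big big1 // => k _ /=.
  under eq_bigr => j _ do rewrite scalA.
  have := congr1 (fun u : 'rV_n => u 0 k) vA; rewrite !mxE => vk.
  have -> : \sum_j scal (v 0 j * c j k) (e k) = scal (\sum_j v 0 j * c j k) (e k).
    by rewrite (big_morph (fun a => scal a (e k)) (scalDl (e k)) (scal0 (e k))).
  rewrite (_ : \sum_j v 0 j * c j k = 0) ?scal0 // -[RHS]vk.
  by apply: eq_bigr => j _; rewrite mxE.
have appE (T : 'I_(size (F m)) -> bop H) :
    (\sum_j T j) (delta 0) = \sum_j T j (delta 0).
  by apply: (big_morph (fun S : bop H => S (delta 0))).
have coordE (x : 'I_(size (F m)) -> H) h :
    ((\sum_j x j : H) : ell2 R F) h = \sum_j (x j : ell2 R F) h.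
  by apply: (big_morph (fun y : H => (y : ell2 R F) h)).
have := congr1 (fun S : bop H => (S (delta 0) : ell2 R F) (nth 0 (F m) i)) s0.
rewrite /= appE coordE (bigD1 i) //= [X in _ + X]big1 => [|j ji].
  by rewrite addr0 addgg eqxx B0r expr0 !mulr1.
have -> : ((F m)`_j + (F m)`_i == 0) = false.
  apply: contraNF ji => /eqP ij; have : (F m)`_j == (F m)`_i.
    by rewrite -[X in X == _](addKg (F m)`_i) [(F m)`_i + (F m)`_j]addrC ij addr0.
  by rewrite nth_uniq.
by rewrite !mulr0.
Qed.

Definition tga_factor_II1 : hyperfinite_II1_factor R :=
  HyperfiniteII1 tga_factor tga_infinite tga_tracial tga_hyperfinite.

End TwistedGroupAlgebra.

(** * The hyperfinite factor of the infinite Pauli group *)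

Lemma F2_char2 (x : 'F_2) : x + x = 0.
Proof. by case: x => -[|[|//]] ?; apply: val_inj. Qed.

Lemma F2_neq0D (x y : 'F_2) : (x + y != 0) = (x != 0) (+) (y != 0).
Proof. by case: x y => -[|[|//]] ? [[|[|//]] ?]. Qed.

(** * Matrix units from Weyl relations *)

Section MatrixUnits.
Variables (C : numClosedFieldType) (A : starAlgType C) (m : nat).
Notation W := ('rV['F_2]_m).
Variable beta : W -> W -> bool.
Hypothesis betaDl : forall a b y, beta (a + b) y = beta a y (+) beta b y.
Hypothesis betaDr : forall b y z, beta b (y + z) = beta b y (+) beta b z.
Hypothesis beta_nondeg : forall y, (forall b, beta b y = false) -> y = 0.
Variables X Z : W -> A.
Hypotheses (XM : forall a b, X a * X b = X (a + b)) (X0 : X 0 = 1).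
Hypotheses (ZM : forall a b, Z a * Z b = Z (a + b)) (Z0 : Z 0 = 1).
Hypothesis ZX : forall a b, Z b * X a = (-1) ^+ beta b a * (X a * Z b).
Hypotheses (Xs : forall a, star (X a) = X a) (Zs : forall b, star (Z b) = Z b).

Lemma row_addgg (x : W) : x + x = 0.
Proof. by apply/rowP => i; rewrite !mxE F2_char2. Qed.

Lemma row_addKg (x y : W) : x + (x + y) = y.
Proof. by rewrite addrA row_addgg add0r. Qed.

(** By Fourier inversion on [W], the joint eigenprojection of the [Z b] for the character
    [b |-> (-1) ^+ beta b y]. *)
Definition diag_unit (y : W) : A :=
  scal (#|{: W}|%:R)^-1 (\sum_b (-1) ^+ beta b y * Z b).

Lemma beta0r b : beta b 0 = false.
Proof. by have := betaDr b 0 0; rewrite addr0 addbb. Qed.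

Lemma beta0l b : beta 0 b = false.
Proof. by have := betaDl 0 0 b; rewrite addr0 addbb. Qed.

Lemma reindex_add (V : nmodType) (f : W -> V) c : \sum_b f b = \sum_b f (c + b).
Proof. by apply: reindex_inj; exact: addrI. Qed.

Let card0 : (#|{: W}|%:R : C) != 0.
Proof. by rewrite pnatr_eq0 -lt0n; apply/card_gt0P; exists 0. Qed.

(** Orthogonality of characters: for [y != 0], translating by some [c] with [beta c y] turns the sum
    into its negative. *)
Lemma char_suml y (T : A) : \sum_b (-1) ^+ beta b y * T =
  scal (if y == 0 then #|{: W}|%:R else 0) T.
Proof.
case: eqP => [->|/eqP y0].
  under eq_bigr => b _ do rewrite beta0r expr0 mul1r.
  rewrite big_const; elim: (#|_|) => [|n IH]; first by rewrite /= scal0.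
  by rewrite /= IH -natr1 scalDl scal1 addrC.
have [c cy] : exists c, beta c y.
  apply: contrapT => /forallNP h; case/eqP: y0; apply: beta_nondeg => b.
  by apply/negbTE/negP.
set s := \sum_b _; rewrite scal0.
have : s = - s.
  rewrite {1}/s (reindex_add _ c) -sumrN; apply: eq_bigr => b _.
  by rewrite betaDl cy signr_addb expr1 mulN1r mulNr.
by move=> sN; rewrite -[s]scal_half {2}sN subrr scal_r0.
Qed.

Lemma char_sumr b (T : A) : (forall c, (forall y, beta c y = false) -> c = 0) ->
  \sum_y (-1) ^+ beta b y * T = scal (if b == 0 then #|{: W}|%:R else 0) T.
Proof.
move=> nd; case: eqP => [->|/eqP b0].
  under eq_bigr => y _ do rewrite beta0l expr0 mul1r.
  rewrite big_const; elim: (#|_|) => [|n IH]; first by rewrite /= scal0.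
  by rewrite /= IH -natr1 scalDl scal1 addrC.
have [z bz] : exists z, beta b z.
  apply: contrapT => /forallNP h; case/eqP: b0; apply: nd => y.
  by apply/negbTE/negP.
set s := \sum_y _; rewrite scal0.
have : s = - s.
  rewrite {1}/s (reindex_add _ z) -sumrN; apply: eq_bigr => y _.
  by rewrite betaDr bz signr_addb expr1 mulN1r mulNr.
by move=> sN; rewrite -[s]scal_half {2}sN subrr scal_r0.
Qed.

Hypothesis beta_nondeg' : forall c, (forall y, beta c y = false) -> c = 0.

Lemma diag_unitM y z :
  diag_unit y * diag_unit z = if y == z then diag_unit y else 0.
Proof.
rewrite /diag_unit -scalAl -scalAr scalA mulr_suml.
have -> : \sum_b (-1) ^+ beta b y * Z b * (\sum_c (-1) ^+ beta c z * Z c) =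
    \sum_c \sum_b (-1) ^+ beta b (y + z) * ((-1) ^+ beta c z * Z c).
  rewrite exchange_big; apply: eq_bigr => b _.
  rewrite mulr_sumr (reindex_add _ b); apply: eq_bigr => c _ /=.
  rewrite -mulrA [Z b * _]mulrA comm_sign -mulrA ZM row_addKg !mulrA -!signr_addb.
  by rewrite betaDl betaDr addbA.
under eq_bigr => c _ do rewrite char_suml.
have -> : (y + z == 0) = (y == z).
  by apply/eqP/eqP => [yz|->]; [rewrite -[z](row_addKg y) yz addr0|exact: row_addgg].
case: eqP => [<-|_]; last by rewrite big1 ?scal_r0 // => c _; rewrite scal0.
by rewrite -scal_sum scalA -mulrA mulVf // mulr1.
Qed.

Lemma diag_unit_sum : \sum_y diag_unit y = 1.
Proof.
rewrite -scal_sum exchange_big /=.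
under eq_bigr => b _ do rewrite char_sumr //.
rewrite (bigD1 0) //= eqxx big1 => [|b /negbTE->]; last by rewrite scal0.
by rewrite addr0 Z0 scalA mulVf ?scal1.
Qed.

Lemma diag_unit_star y : star (diag_unit y) = diag_unit y.
Proof.
rewrite starZ star_sum fmorphV rmorph_nat; congr (scal _ _).
by apply: eq_bigr => b _; rewrite starM star_sign Zs comm_sign.
Qed.

Lemma diag_unitX y a : diag_unit y * X a = X a * diag_unit (y + a).
Proof.
rewrite /diag_unit -scalAl -scalAr mulr_suml mulr_sumr; congr (scal _ _).
apply: eq_bigr => b _; rewrite -mulrA ZX mulrA -signr_addb -betaDr.
by rewrite !mulrA comm_sign.
Qed.

(** By [diag_unitX], [X (x + y)] carries the range of [diag_unit y] onto that of [diag_unit x]. *)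
Definition mat_unit (x y : W) : A := X (x + y) * diag_unit y.

Lemma mat_unitM x y z w :
  mat_unit x y * mat_unit z w = if y == z then mat_unit x w else 0.
Proof.
rewrite /mat_unit -mulrA [diag_unit y * _]mulrA diag_unitX -!mulrA diag_unitM mulrA XM.
have -> : (y + (z + w) == w) = (y == z).
  rewrite addrA; apply/eqP/eqP => [h|->]; last by rewrite row_addgg add0r.
  have /(congr1 (fun u => u - w)) := h; rewrite addrK subrr => yz.
  by rewrite -[z](row_addKg y) yz addr0.
case: eqP => [->|_]; last by rewrite mulr0.
rewrite [z + (z + w)]row_addKg; congr (X _ * _).
by rewrite -addrA row_addKg.
Qed.

Lemma mat_unit_star x y : star (mat_unit x y) = mat_unit y x.
Proof.
rewrite starM diag_unit_star Xs diag_unitX /mat_unit addrC.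
by congr (X _ * diag_unit _); rewrite ?[x + y]addrC // row_addKg.
Qed.

Lemma mat_unit_sum : \sum_x mat_unit x x = 1.
Proof.
rewrite -diag_unit_sum; apply: eq_bigr => x _.
by rewrite /mat_unit row_addgg X0 mul1r.
Qed.

Section Embedding.
Variables (d : nat) (f : 'I_d -> W).
Hypothesis f_bij : bijective f.

Definition mat_embed (M : 'M[C]_d) : A :=
  \sum_i \sum_j scal (M i j) (mat_unit (f i) (f j)).

Lemma mat_embedD M N : mat_embed (M + N) = mat_embed M + mat_embed N.
Proof.
rewrite -big_split; apply: eq_bigr => i _; rewrite -big_split.
by apply: eq_bigr => j _; rewrite mxE scalDl.
Qed.

Lemma mat_embedZ k M : mat_embed (k *: M) = scal k (mat_embed M).
Proof.
rewrite scal_sum; apply: eq_bigr => i _; rewrite scal_sum.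
by apply: eq_bigr => j _; rewrite mxE scalA.
Qed.

Lemma mat_embed_star M : mat_embed (star M) = star (mat_embed M).
Proof.
rewrite /mat_embed star_sum [LHS]exchange_big; apply: eq_bigr => i _; rewrite star_sum.
by apply: eq_bigr => j _; rewrite starZ mat_unit_star !mxE.
Qed.

Lemma mat_embed1 : mat_embed 1 = 1.
Proof.
rewrite -mat_unit_sum (reindex f) /=; last exact: onW_bij.
apply: eq_bigr => i _; rewrite (bigD1 i) //= big1 => [|j /negbTE ji].
  by rewrite mxE eqxx scal1 addr0.
by rewrite mxE eq_sym ji scal0.
Qed.

Lemma mat_embedM M N : mat_embed (M * N) = mat_embed M * mat_embed N.
Proof.
rewrite /mat_embed mulr_suml; apply: eq_bigr => i _.
have -> : (\sum_j scal (M i j) (mat_unit (f i) (f j))) *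
    (\sum_k \sum_l scal (N k l) (mat_unit (f k) (f l))) =
    \sum_j \sum_l scal (M i j * N j l) (mat_unit (f i) (f l)).
  rewrite mulr_suml; apply: eq_bigr => j _; rewrite mulr_sumr.
  rewrite [LHS](bigD1 j) //= [X in _ + X]big1 ?addr0 => [|k kj].
    rewrite mulr_sumr; apply: eq_bigr => l _.
    by rewrite -scalAl -scalAr scalA mat_unitM eqxx.
  rewrite mulr_sumr big1 // => l _; rewrite -scalAl -scalAr mat_unitM.
  by rewrite (inj_eq (bij_inj f_bij)) eq_sym (negbTE kj) !scal_r0.
rewrite exchange_big; apply: eq_bigr => l _ /=.
rewrite !mxE; elim/big_rec2: _ => [|j x y _ IH]; first by rewrite scal0.
by rewrite scalDl IH.
Qed.

End Embedding.

End MatrixUnits.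

Definition star_embedding (C : numClosedFieldType) (A B : starAlgType C)
    (f : A -> B) : Prop :=
  [/\ f 1 = 1, {morph f : a b / a + b}, {morph f : a b / a * b},
      forall k a, f (scal k a) = scal k (f a) & forall a, f (star a) = star (f a)].

(** * The Pauli group on finitely supported bit sequences *)

Section DyadicFactor.
Variable R : realType.
Notation V := {poly 'F_2}.
Notation G := (V * V)%type.

(** Polynomials over ['F_2] serve as finitely supported bit sequences; this is the parity of the
    common support. *)
Definition dotp (p q : V) : bool := \sum_(i < size p) p`_i * q`_i != 0.

Lemma dotpE n (p q : V) : (size p <= n)%N -> dotp p q = (\sum_(i < n) p`_i * q`_i != 0).
Proof.
move=> pn; congr (_ != 0); rewrite (big_ord_widen n (fun i => p`_i * q`_i) pn).
rewrite big_mkcond; apply: eq_bigr => i _; case: ltnP => // pi.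
by rewrite nth_default // mul0r.
Qed.

Lemma dotpDl p p' q : dotp (p + p') q = dotp p q (+) dotp p' q.
Proof.
pose n := maxn (size p) (size p').
rewrite (@dotpE n p) ?leq_maxl // (@dotpE n p') ?leq_maxr //.
rewrite (@dotpE n (p + p')); last exact: size_polyD.
rewrite -F2_neq0D -big_split; congr (_ != 0); apply: eq_bigr => i _.
by rewrite coefD mulrDl.
Qed.

Lemma dotpDr p q q' : dotp p (q + q') = dotp p q (+) dotp p q'.
Proof.
rewrite -F2_neq0D -big_split; congr (_ != 0); apply: eq_bigr => i _.
by rewrite coefD mulrDr.
Qed.

Lemma dotp_Xn i q : dotp 'X^i q = (q`_i != 0).
Proof.
rewrite /dotp size_polyXn big_ord_recr /= coefXn eqxx mul1r big1 ?add0r // => j _.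
by rewrite coefXn ltn_eqF ?mul0r.
Qed.

Lemma dotpC p q : dotp p q = dotp q p.
Proof.
pose n := maxn (size p) (size q).
rewrite (@dotpE n p) ?leq_maxl // (@dotpE n q) ?leq_maxr //.
by congr (_ != 0); apply: eq_bigr => i _; rewrite mulrC.
Qed.

Definition polys m : seq V := [seq rVpoly v | v <- enum 'rV['F_2]_m].

Lemma mem_polys m p : (p \in polys m) = (size p <= m)%N.
Proof.
apply/mapP/idP => [[v _ ->]|pm]; first exact: size_poly.
by exists (poly_rV p); rewrite ?mem_enum ?poly_rV_K.
Qed.

Lemma polys_uniq m : uniq (polys m).
Proof.
by rewrite map_inj_uniq ?enum_uniq //; exact: (can_inj (@rVpolyK _ _)).
Qed.

Lemma size_polys m : size (polys m) = (2 ^ m)%N.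
Proof. by rewrite size_map -cardE card_mx card_Fp // mul1n. Qed.

Definition boxes m : seq G := [seq (p, q) | p <- polys m, q <- polys m].

Lemma mem_boxes m (g : G) : (g \in boxes m) = (size g.1 <= m)%N && (size g.2 <= m)%N.
Proof.
case: g => p q; apply/allpairsP/andP => [[[a b] /= [ha hb [-> ->]]]|[hp hq]].
  by rewrite -!mem_polys.
by exists (p, q); rewrite /= !mem_polys.
Qed.

Lemma boxes_uniq m : uniq (boxes m).
Proof. by apply: allpairs_uniq; rewrite ?polys_uniq // => -[a b] [c d] _ _ []-> ->. Qed.

Lemma boxes_mono m n : (m <= n)%N -> {subset boxes m <= boxes n}.
Proof.
by move=> mn g; rewrite !mem_boxes => /andP[h k]; rewrite !(leq_trans _ mn).
Qed.

Lemma boxes_cover g : exists m, g \in boxes m.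
Proof. by exists (maxn (size g.1) (size g.2)); rewrite mem_boxes leq_maxl leq_maxr. Qed.

Lemma boxes_add m g h : g \in boxes m -> h \in boxes m -> g + h \in boxes m.
Proof.
rewrite !mem_boxes => /andP[g1 g2] /andP[h1 h2].
by rewrite !(leq_trans (size_polyD _ _)) // geq_max ?g1 ?g2.
Qed.

Lemma boxes_large n : exists m, (n < size (boxes m))%N.
Proof.
exists n; rewrite size_allpairs size_polys; apply: leq_trans (@ltn_expl 2 n isT) _.
by rewrite leq_pmulr // expn_gt0.
Qed.

Lemma boxes_nonempty m : 0 \in boxes m.
Proof. by rewrite mem_boxes !size_poly0. Qed.

Lemma poly_addgg (p : V) : p + p = 0.
Proof. by apply/polyP => i; rewrite coefD coef0 F2_char2. Qed.

Lemma pair_addgg (g : G) : g + g = 0.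
Proof. by case: g => p q; congr (_, _); exact: poly_addgg. Qed.

(** The sign produced when the [Z_i] of [g] move past the [X_i] of [h]. *)
Definition pauli_form (g h : G) : bool := dotp g.2 h.1.

Lemma pauli_formDl g h k : pauli_form (g + h) k = pauli_form g k (+) pauli_form h k.
Proof. exact: dotpDl. Qed.

Lemma pauli_formDr g h k : pauli_form g (h + k) = pauli_form g h (+) pauli_form g k.
Proof. exact: dotpDr. Qed.

Lemma dotp0l p : dotp 0 p = false.
Proof. by rewrite /dotp big1 ?eqxx // => i _; rewrite coef0 mul0r. Qed.

Lemma dotp0r p : dotp p 0 = false.
Proof. by rewrite dotpC dotp0l. Qed.

Lemma dotp_nondeg p : (forall q, dotp q p = false) -> p = 0.
Proof.
by move=> h; apply/polyP => i; rewrite coef0; have := h 'X^i; rewrite dotp_Xn => /eqP.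
Qed.

Lemma pauli_form_nondeg h : (forall g, pauli_form g h = pauli_form h g) -> h = 0.
Proof.
case: h => p q sym; congr (_, _); apply: dotp_nondeg => r.
  by have := sym (0, r); rewrite /pauli_form /= dotp0r.
by have := sym (r, 0); rewrite /pauli_form /= dotp0l dotpC.
Qed.

(* The CAR factor as the von Neumann algebra of the infinite Pauli group:
   [(a, b)] stands for the product of the [X_i] with [a_i = 1] and of the [Z_i]
   with [b_i = 1]. *)
Definition dyadic_factor : hyperfinite_II1_factor R :=
  tga_factor_II1 R boxes_uniq boxes_mono boxes_cover boxes_add boxes_large
    pair_addgg pauli_formDl pauli_formDr pauli_form_nondeg boxes_nonempty.

Definition pauli (g : G) : bop (hf_space dyadic_factor) :=
  lam R boxes_uniq boxes_mono boxes_cover boxes_add pair_addgg pauli_form g.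

Lemma pauliM g h : pauli g * pauli h = (-1) ^+ pauli_form g h * pauli (g + h).
Proof. exact: (lamM _ _ _ _ _ _ pauli_formDl pauli_formDr). Qed.

Lemma pauli0 : pauli 0 = 1.
Proof. exact: (lam0 _ _ _ _ _ _ pauli_formDl). Qed.

Lemma pauli_star g : star (pauli g) = (-1) ^+ pauli_form g g * pauli g.
Proof. exact: (lam_star _ _ _ _ _ _ pauli_formDr). Qed.

Lemma pauli_in g : hf_set (pauli g).
Proof.
have [n gn] := boxes_cover g.
exact: (lam_span_tga (n := n) (lam_span_lam _ _ _ _ _ _ _ gn)).
Qed.

Lemma hf_set_sum (M : hyperfinite_II1_factor R) (I : Type) (r : seq I)
  (T : I -> bop (hf_space M)) : (forall i, hf_set (T i)) -> hf_set (\sum_(i <- r) T i).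
Proof.
move=> h; have [M1 MD MZ _ _] := (hf_factor M).1.1.
apply: big_ind => //; first by rewrite -(scal0 1); exact: MZ.
Qed.

(** The Pauli operators supported on the first [m] positions satisfy Weyl relations over
    ['rV['F_2]_m], so their matrix units give a copy of the matrices of size [2 ^ m]. *)
Lemma matrix_embedding d m : d = (2 ^ m)%N ->
  exists iota : 'M[R[i]]_d -> bop (hf_space dyadic_factor),
    star_embedding iota /\ forall M, hf_set (iota M).
Proof.
move=> dm; pose W := 'rV['F_2]_m.
have cardW : #|{: W}| = d by rewrite card_mx card_Fp // mul1n.
pose f (i : 'I_d) : W := enum_val (cast_ord (esym cardW) i).
have f_bij : bijective f.
  exists (fun w => cast_ord cardW (enum_rank w)) => [i|w]; rewrite /f.
    by rewrite enum_valK cast_ordKV.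
  by rewrite cast_ordK enum_rankK.
pose X (a : W) := pauli (rVpoly a, 0).
pose Z (b : W) := pauli (0, rVpoly b).
pose beta (b a : W) := dotp (rVpoly b) (rVpoly a).
have betaDl a b y : beta (a + b) y = beta a y (+) beta b y.
  by rewrite /beta raddfD dotpDl.
have betaDr b y z : beta b (y + z) = beta b y (+) beta b z.
  by rewrite /beta raddfD dotpDr.
have nondeg y : (forall b, beta b y = false) -> y = 0.
  move=> h; apply/rowP => i; rewrite mxE -coef_rVpoly_ord.
  have := h (poly_rV 'X^i); rewrite /beta poly_rV_K ?size_polyXn // dotp_Xn.
  by move/eqP.
have nondeg' c : (forall y, beta c y = false) -> c = 0.
  by move=> h; apply: nondeg => b; rewrite /beta dotpC; exact: h.
have XM a b : X a * X b = X (a + b).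
  rewrite /X pauliM /pauli_form /= dotp0l expr0 mul1r raddfD.
  by congr pauli; congr (_, _); rewrite addr0.
have ZM a b : Z a * Z b = Z (a + b).
  rewrite /Z pauliM /pauli_form /= dotp0r expr0 mul1r raddfD.
  by congr pauli; congr (_, _); rewrite addr0.
have ZX a b : Z b * X a = (-1) ^+ beta b a * (X a * Z b).
  rewrite /Z /X !pauliM /pauli_form /= dotp0l expr0 mul1r; congr (_ * pauli _).
  by rewrite addrC.
have X0 : X 0 = 1 by rewrite /X raddf0; exact: pauli0.
have Z0 : Z 0 = 1 by rewrite /Z raddf0; exact: pauli0.
have Xs a : star (X a) = X a.
  by rewrite pauli_star /pauli_form /= dotp0l expr0 mul1r.
have Zs b : star (Z b) = Z b.
  by rewrite pauli_star /pauli_form /= dotp0r expr0 mul1r.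
exists (mat_embed beta X Z f); split; last first.
  move=> M; have [M1 MD MZ MM _] := (hf_factor dyadic_factor).1.1.
  apply: hf_set_sum => i; apply: hf_set_sum => j; apply: (MZ).
  apply: MM; first exact: pauli_in.
  apply: (MZ); apply: hf_set_sum => b; rewrite -scal_sign.
  by apply: MZ; exact: pauli_in.
split.
- exact: (mat_embed1 betaDl betaDr X0 Z0 nondeg' f_bij).
- exact: mat_embedD.
- exact: (mat_embedM betaDl betaDr nondeg XM ZM ZX f_bij).
- exact: mat_embedZ.
- exact: (mat_embed_star betaDr ZX Xs Zs).
Qed.

End DyadicFactor.

(** * Approximate models in matrix algebras *)

Section MonomialMatrices.
Variables (C : numClosedFieldType) (n : nat).
Implicit Types (s t : 'I_n -> 'I_n) (d e : 'I_n -> C).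

(** It sends the [j]-th basis vector to [d j] times the [s j]-th. *)
Definition mono s d : 'M[C]_n := \matrix_(i, j) ((i == s j)%:R * d j).

Lemma monoM s t d e : mono s d * mono t e = mono (s \o t) (fun j => d (t j) * e j).
Proof.
apply/matrixP => i j; rewrite !mxE (bigD1 (t j)) //= big1 => [|k /negbTE kt].
  by rewrite !mxE eqxx mul1r addr0 mulrA.
by rewrite !mxE kt mul0r mulr0.
Qed.

Lemma mono_star s t d : cancel s t -> cancel t s ->
  star (mono s d) = mono t (fun j => (d (t j))^*).
Proof.
move=> st ts; apply/matrixP => i j; rewrite !mxE rmorphM rmorph_nat.
have -> : (j == s i) = (i == t j) by apply/eqP/eqP => ->.
by case: eqP => [->|_]; rewrite ?mul0r.
Qed.

Lemma mono1 : mono id (fun=> 1) = 1.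
Proof. by apply/matrixP => i j; rewrite !mxE mulr1. Qed.

Lemma mono_scalar k : mono id (fun=> k) = scal k 1.
Proof. by apply/matrixP => i j; rewrite !mxE mulrC. Qed.

Lemma monoN s d : - mono s d = mono s (fun j => - d j).
Proof. by apply/matrixP => i j; rewrite !mxE mulrN. Qed.

Lemma monoB s d e : mono s d - mono s e = mono s (fun j => d j - e j).
Proof. by apply/matrixP => i j; rewrite !mxE mulrBr. Qed.

Lemma mono_ext s t d e : s =1 t -> d =1 e -> mono s d = mono t e.
Proof. by move=> /funext-> /funext->. Qed.

End MonomialMatrices.

Section TensorProducts.
Variable C : numClosedFieldType.

Lemma tensM m n (A A' : 'M[C]_m) (B B' : 'M[C]_n) :
  (A *t B) * (A' *t B') = (A * A') *t (B * B').
Proof. exact: tensmx_mul. Qed.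

Lemma tens_star m n (A : 'M[C]_m) (B : 'M[C]_n) :
  star (A *t B) = star A *t star B.
Proof. by apply/matrixP => i j; rewrite !mxE rmorphM. Qed.

Lemma tens11 m n : (1 : 'M[C]_m) *t (1 : 'M[C]_n) = 1.
Proof.
apply/matrixP => i j; rewrite !mxE -natrM mulnb; congr ((nat_of_bool _)%:R).
apply/idP/idP => [/andP[/eqP a /eqP b]|/eqP->]; last by rewrite !eqxx.
apply/eqP.
apply: (can_inj (@mxtens_unindexK m n)).
by rewrite (surjective_pairing (mxtens_unindex i)) (surjective_pairing (mxtens_unindex j)) a b.
Qed.

Lemma tensDl m n (A A' : 'M[C]_m) (B : 'M[C]_n) : (A + A') *t B = A *t B + A' *t B.
Proof. by apply/matrixP => i j; rewrite !mxE mulrDl. Qed.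

Lemma tensDr m n (A : 'M[C]_m) (B B' : 'M[C]_n) : A *t (B + B') = A *t B + A *t B'.
Proof. by apply/matrixP => i j; rewrite !mxE mulrDr. Qed.

Lemma tensNl m n (A : 'M[C]_m) (B : 'M[C]_n) : (- A) *t B = - (A *t B).
Proof. by apply/matrixP => i j; rewrite !mxE mulNr. Qed.

Lemma tensNr m n (A : 'M[C]_m) (B : 'M[C]_n) : A *t (- B) = - (A *t B).
Proof. by apply/matrixP => i j; rewrite !mxE mulrN. Qed.

Lemma tensZl m n k (A : 'M[C]_m) (B : 'M[C]_n) : (scal k A) *t B = scal k (A *t B).
Proof. by apply/matrixP => i j; rewrite !mxE mulrA. Qed.

Definition swap_index n (i : 'I_(n * n)) : 'I_(n * n) :=
  let ab := mxtens_unindex i in mxtens_index (ab.2, ab.1).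

Lemma swap_indexK n : involutive (@swap_index n).
Proof.
move=> i; rewrite /swap_index mxtens_indexK -[RHS]mxtens_unindexK.
by case: (mxtens_unindex i).
Qed.

Definition flip n : 'M[C]_(n * n) := mono (@swap_index n) (fun=> 1).

Lemma flip_sqr n : flip n * flip n = 1.
Proof.
by rewrite monoM -mono1; apply: mono_ext => i /=; rewrite ?swap_indexK ?mulr1.
Qed.

Lemma flip_star n : star (flip n) = flip n.
Proof.
rewrite (mono_star _ (@swap_indexK n) (@swap_indexK n)).
by apply: mono_ext => i //; rewrite rmorph1.
Qed.

Lemma flip_tens n (A B : 'M[C]_n) : flip n * (A *t B) = (B *t A) * flip n.
Proof.
apply/matrixP => i j; rewrite !mxE (bigD1 (swap_index i)) //= big1 ?addr0 => [|k ki].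
  rewrite [RHS](bigD1 (swap_index j)) //= [in RHS]big1 ?addr0 => [|k kj].
    by rewrite !mxE !swap_indexK !eqxx !mul1r !mulr1 /swap_index !mxtens_indexK /= mulrC.
  by rewrite !mxE (negbTE kj) mul0r mulr0.
rewrite !mxE; have -> : (i == swap_index k) = false.
  by apply: contraNF ki => /eqP->; rewrite swap_indexK.
by rewrite !mul0r.
Qed.

End TensorProducts.

(** * The relations to be modelled and their tensor constructions *)

Section Models.
Variables (C : numClosedFieldType) (A : starAlgType C).

Definition unitary (w : A) := w * star w = 1 /\ star w * w = 1.

(* In [seed] and [double], [a := p q] is unitary with [w a w^* ~ a ^+ 2], up to an
   error of norm [sqrt c], and [s a s = - a]. The flip [f] exhibits [q p q] as
   [f1 (f p f) f1] with [f1 := q f], both conjugations being of commuting pairs. *)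
Record seed (p q s w : A) (c : C) : Prop := {
  seed_p : reflection p; seed_q : reflection q; seed_s : reflection s;
  seed_w : unitary w;
  seed_sp : s * p = p * s; seed_sq : s * q = - (q * s); seed_wp : w * p = p * w;
  seed_err : star (w * q * star w - q * p * q) * (w * q * star w - q * p * q) = scal c 1
}.

Record double (p q f s w : A) (c : C) : Prop := {
  double_seed : seed p q s w c;
  double_f : reflection f;
  double_fq : f * q = q * f;
  double_pfp : p * (f * p * f) = f * p * f * p;
  double_rfp : (q * p * q) * (f * p * f) = f * p * f * (q * p * q)
}.

(** Everything that must hold exactly. The commutation of an operator with its conjugates is what
    allows each conjugation to be written as a commutator relation; only the one taking [v q v] to
    [q p q] is left to [model_error]. *)
Record model (p q f s v u : A) : Prop := {
  model_p : reflection p; model_q : reflection q; model_f : reflection f;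
  model_s : reflection s; model_v : reflection v; model_u : reflection u;
  model_fq : f * q = q * f;
  model_pfp : p * (f * p * f) = f * p * f * p;
  model_rfp : (q * p * q) * (f * p * f) = f * p * f * (q * p * q);
  model_sp : s * p = p * s; model_sq : s * q = - (q * s);
  model_pp : p * (v * p * v) = v * p * v * p;
  model_qq : q * (v * q * v) = v * q * v * q;
  model_rq : (q * p * q) * (v * q * v) = v * q * v * (q * p * q);
  model_up : u * (v * p * v) * u = p
}.

Definition model_error (p q v u : A) : A := u * (v * q * v) * u - q * p * q.

Record full_model (p q f s v u x z : A) : Prop := {
  full_model_model : model p q f s v u;
  full_x : reflection x; full_z : reflection z; full_xz : x * z = - (z * x);
  full_comm : forall a, a \in [:: p; q; f; s; v; u] -> a * x = x * a /\ a * z = z * a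
}.

End Models.

Section Doubling.
Variables (C : numClosedFieldType) (n : nat) (p q s w : 'M[C]_n) (c : C).
Hypothesis h : seed p q s w c.

Lemma tens1_reflection m (a : 'M[C]_m) k : reflection a -> reflection (a *t (1 : 'M[C]_k)).
Proof. by move=> [aa sa]; split; [rewrite tensM aa mulr1 tens11|rewrite tens_star sa star1]. Qed.

(* Conjugation by this reflection carries [q *t 1] to [q *t q], so that [w] can be
   corrected after replacing [q] by [q *t q]. *)
Let cc : 'M[C]_(n * n) := 1 *t eigenproj false q + s *t eigenproj true q.

Let eqe d e : eigenproj d q * eigenproj e q = if d == e then eigenproj d q else 0.
Proof.
have qq := (seed_q h).1; case: eqP => [<-|/eqP de]; first exact: eigenproj_sqr.
have -> : d = ~~ e by case: d e de => -[].
exact: eigenproj_orth.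
Qed.

Let eqq d : q * eigenproj d q = (-1) ^+ d * eigenproj d q.
Proof. exact: eigenprojE (seed_q h).1. Qed.

Let eqs d : star (eigenproj d q) = eigenproj d q.
Proof. exact: star_eigenproj (seed_q h).2. Qed.

Lemma tens0r m k (a : 'M[C]_m) : a *t (0 : 'M[C]_k) = 0.
Proof. exact: tensmx0. Qed.

Let cc_reflection : reflection cc.
Proof.
have [ss sS] := seed_s h; split; last by rewrite starD !tens_star !eqs star1 sS.
rewrite mulrDl !mulrDr !tensM !eqe /= !tens0r addr0 add0r ss mulr1 -tensDr.
by rewrite eigenproj_sum tens11.
Qed.

Let cc_q : cc * (q *t 1) * cc = q *t q.
Proof.
have [ss sS] := seed_s h.
rewrite mulrDl !tensM mulrDr !mulrDl !tensM !mulr1 !mul1r !eqe /= !tens0r addr0 add0r.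
rewrite (seed_sq h) mulNr -mulrA ss mulr1 tensNl -tensNr -tensDr.
congr (_ *t _); rewrite -[RHS]mulr1 -[in X in _ = _ * X](eigenproj_sum q) mulrDr !eqq.
by rewrite expr0 expr1 mul1r mulN1r.
Qed.

(** The flip must commute with [q] and yet move [p] to a place where it commutes with [p] and
    [q p q]. Both happen once [q] becomes [q *t q] while [p] stays in the first factor. *)
Lemma double_of_seed : double (p *t (1 : 'M[C]_n)) (q *t q) (flip C n)
  (s *t (1 : 'M[C]_n)) ((w *t (1 : 'M[C]_n)) * cc) c.
Proof.
have rp := seed_p h; have rq := seed_q h; have rs := seed_s h.
have [ww wW] := seed_w h.
have fpf : flip C n * (p *t 1) * flip C n = 1 *t p.
  by rewrite flip_tens -mulrA flip_sqr mulr1.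
have rE : (q *t q) * (p *t 1) * (q *t q) = (q * p * q) *t 1.
  by rewrite !tensM mulr1 rq.1.
have wsE : star ((w *t 1) * cc) = cc * (star w *t 1).
  by rewrite starM tens_star star1 cc_reflection.2.
split.
- split.
  + exact: tens1_reflection.
  + by split; [rewrite tensM rq.1 tens11|rewrite tens_star rq.2].
  + exact: tens1_reflection.
  + rewrite /unitary wsE; split.
      rewrite mulrA -[_ * cc * cc]mulrA cc_reflection.1 mulr1 tensM ww mulr1.
      exact: tens11.
    rewrite mulrA -[_ * _ * (w *t 1)]mulrA tensM wW mulr1 tens11 mulr1.
    exact: cc_reflection.1.
  + by rewrite !tensM (seed_sp h).
  + by rewrite !tensM (seed_sq h) tensNl mul1r mulr1.
  + rewrite -mulrA.
    have -> : cc * (p *t 1) = (p *t 1) * cc.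
      by rewrite mulrDl mulrDr !tensM !mulr1 !mul1r (seed_sp h).
    by rewrite !mulrA !tensM (seed_wp h).
  + rewrite wsE rE.
    have -> : w *t 1 * cc * (q *t q) * (cc * (star w *t 1)) =
        (w * q * star w) *t 1.
      have -> : w *t 1 * cc * (q *t q) * (cc * (star w *t 1)) =
        w *t 1 * (cc * (q *t q) * cc) * (star w *t 1) by rewrite !mulrA.
      have -> : cc * (q *t q) * cc = q *t 1.
        rewrite -cc_q !mulrA cc_reflection.1 mul1r -mulrA cc_reflection.1.
        exact: mulr1.
      by rewrite !tensM !mulr1.
    rewrite -tensNl -tensDl tens_star tensM star1 mulr1 (seed_err h) tensZl.
    by rewrite tens11.
- by split; [exact: flip_sqr|exact: flip_star].
- exact: flip_tens.
- by rewrite fpf !tensM !mul1r !mulr1.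
- by rewrite fpf rE !tensM !mul1r !mulr1.
Qed.

End Doubling.

Section Quadrupling.
Variables (C : numClosedFieldType) (n : nat) (p q f s w : 'M[C]_n) (c : C).
Hypothesis h : double p q f s w c.

Let o : 'M[C]_n := 1.

(** Here [u * v] is [w *t star w], which writes the unitary as a product of two reflections; and
    [v], the flip, moves [p] and [q] into the second factor, away from the originals. *)
Lemma model_of_double :
  model (p *t o) (q *t o) (f *t o) (s *t o) (flip C n) ((w *t star w) * flip C n) /\
  star (model_error (p *t o) (q *t o) (flip C n) ((w *t star w) * flip C n)) *
  model_error (p *t o) (q *t o) (flip C n) ((w *t star w) * flip C n) = scal c 1.
Proof.
have [rp rq rs [ww wW] sp sq wp err] := double_seed h.
have ff := flip_sqr C n.
have flipE (a b : 'M[C]_n) : flip C n * (a *t b) * flip C n = b *t a.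
  by rewrite flip_tens -mulrA ff mulr1.
have uE (a b : 'M[C]_n) : (w *t star w) * flip C n * (a *t b) *
    ((w *t star w) * flip C n) = (w * b * star w) *t (star w * a * w).
  rewrite -[(w *t star w) * flip C n * _]mulrA flip_tens.
  rewrite mulrA -[_ * (w *t star w)]mulrA; rewrite !mulrA.
  rewrite -[_ * flip C n * (w *t star w)]mulrA flip_tens -!mulrA ff mulr1.
  by rewrite !tensM !mulrA.
have conj_u a b : w *t star w * flip C n * (flip C n * (a *t b) * flip C n) *
    (w *t star w * flip C n) = (w * a * star w) *t (star w * b * w).
  by rewrite flipE uE.
have rE : (q *t o) * (p *t o) * (q *t o) = (q * p * q) *t o.
  by rewrite !tensM !mulr1.
split; last first.
  rewrite /model_error conj_u rE mulr1 wW -tensNl -tensDl tens_star tensM.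
  by rewrite star1 mulr1 err tensZl tens11.
split.
- exact: tens1_reflection.
- exact: tens1_reflection.
- exact/tens1_reflection/double_f/h.
- exact: tens1_reflection.
- by split; [exact: flip_sqr|exact: flip_star].
- split.
    by have := uE 1 1; rewrite tens11 !mulr1 ww wW tens11.
  by rewrite starM flip_star tens_star starK flip_tens.
- by rewrite !tensM (double_fq h).
- by rewrite !tensM (double_pfp h) !mulr1.
- by rewrite !tensM (double_rfp h) !mulr1.
- by rewrite !tensM sp.
- by rewrite !tensM sq tensNl.
- by rewrite flipE !tensM !mul1r !mulr1.
- by rewrite flipE !tensM !mul1r !mulr1.
- by rewrite flipE rE !tensM !mul1r !mulr1.
- by rewrite conj_u wp -(mulrA p) ww !mulr1 wW.
Qed.

End Quadrupling.

Section PauliFactor.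
Variables (C : numClosedFieldType) (n : nat) (p q f s v u : 'M[C]_n).
Hypothesis h : model p q f s v u.

Definition pauliX : 'M[C]_2 := mono (@rev_ord 2) (fun=> 1).
Definition pauliZ : 'M[C]_2 := mono id (fun j => (-1) ^+ j).

Lemma pauliX_reflection : reflection pauliX.
Proof.
split.
  by rewrite monoM -mono1; apply: mono_ext => i /=; rewrite ?rev_ordK ?mulr1.
rewrite (mono_star _ (@rev_ordK 2) (@rev_ordK 2)).
by apply: mono_ext => i //; rewrite rmorph1.
Qed.

Lemma pauliZ_reflection : reflection pauliZ.
Proof.
split.
  rewrite monoM -mono1; apply: mono_ext => i //=.
  by rewrite -expr2 sqrr_sign.
rewrite (mono_star (t := id)) //; apply: mono_ext => i //.
by rewrite rmorph_sign.
Qed.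

Lemma pauli_anticomm : pauliX * pauliZ = - (pauliZ * pauliX).
Proof.
rewrite !monoM monoN; apply: mono_ext => i //=.
by case: i => -[|[|//]] ?; rewrite /= ?expr0 ?expr1 ?mulr1 ?mul1r ?opprK.
Qed.

Let o : 'M[C]_2 := 1.

Lemma full_model_of_model : full_model (p *t o) (q *t o) (f *t o) (s *t o)
  (v *t o) (u *t o) ((1 : 'M[C]_n) *t pauliX) ((1 : 'M[C]_n) *t pauliZ).
Proof.
case: h => rp rq rf rs rv ru fq pfp rfp sp sq pp qq rq' up.
have r1 (a : 'M[C]_2) : reflection a -> reflection ((1 : 'M[C]_n) *t a).
  by move=> [aa sa]; split; [rewrite tensM aa mulr1 tens11|rewrite tens_star sa star1].
split.
- split; try exact: tens1_reflection; rewrite ?tensM ?mulr1.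
  + by rewrite fq.
  + by rewrite pfp.
  + by rewrite rfp.
  + by rewrite sp.
  + by rewrite sq tensNl.
  + by rewrite pp.
  + by rewrite qq.
  + by rewrite rq'.
  + by rewrite up.
- exact/r1/pauliX_reflection.
- exact/r1/pauliZ_reflection.
- by rewrite !tensM pauli_anticomm tensNr.
have cm (a : 'M[C]_n) b : (a *t o) * ((1 : 'M[C]_n) *t b) = (1 *t b) * (a *t o).
  by rewrite !tensM !mul1r !mulr1.
by move=> a; rewrite !inE; do 5 (case/predU1P=> [->|]; first by rewrite !cm);
  move/eqP->; rewrite !cm.
Qed.

Lemma model_error_tens : model_error (p *t o) (q *t o) (v *t o) (u *t o) =
  model_error p q v u *t o.
Proof. by rewrite /model_error !tensM !mulr1 tensDl tensNl. Qed.

End PauliFactor.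

(** * Diagonal phases at odd multiples of pi / N *)

Section PhaseSeed.
Variable R : realType.
Implicit Types x y : R.

Definition phase x : R[i] := (cos x +i* sin x)%C.

Lemma phaseD x y : phase (x + y) = phase x * phase y.
Proof.
apply: cplxP; rewrite ?cReM ?cImM /= ?cosD ?sinD //.
by rewrite addrC.
Qed.

Lemma phase_conj x : (phase x)^* = phase (- x).
Proof. by apply: cplxP; rewrite ?cRe_conj ?cIm_conj /= ?cosN ?sinN. Qed.

Lemma phase0 : phase 0 = 1.
Proof. by apply: cplxP; rewrite /= ?cos0 ?sin0. Qed.

Lemma phaseDpi x : phase (x + pi) = - phase x.
Proof. by apply: cplxP; rewrite /= ?cosDpi ?sinDpi. Qed.

Lemma phaseD2pi x : phase (x + pi + pi) = phase x.
Proof. by rewrite !phaseDpi opprK. Qed.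

Lemma phase_norm x : (phase x)^* * phase x = 1.
Proof. by rewrite phase_conj -phaseD addNr phase0. Qed.

Lemma phase_dist x y : (phase x - phase y)^* * (phase x - phase y) =
  (2 - 2 * cos (x - y))%:C%C.
Proof.
rewrite rmorphB /= !phase_conj mulrBl !mulrBr -!phaseD !addNr phase0.
have -> : - x + y = - (x - y) by rewrite opprB addrC.
by apply: cplxP; rewrite /= [- y + x]addrC ?cosN ?sinN; ring.
Qed.

Variable m : nat.
Hypothesis m_gt0 : (0 < m)%N.
Notation N := (m + m)%N.

(* [p q] is diagonal with the phases of the odd multiples of [pi / N]. The squares are
   the phases of the multiples [4 k + 2] of [pi / N], each taken twice: both odd
   neighbours of each are used, which dictates the permutation [rotate]. *)
Definition angle (k : nat) : R := (k.*2.+1)%:R * (pi / N%:R).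

Definition top_flip_nat k := if (k < m)%N then (k + m)%N else (k - m)%N.
Definition rotate_nat k := if odd k then (k./2 + m)%N else k./2.
Definition unrotate_nat k := if (k < m)%N then k.*2 else ((k - m).*2.+1).

Fact top_flip_proof (k : 'I_N) : (top_flip_nat k < N)%N.
Proof. by rewrite /top_flip_nat; have := ltn_ord k; case: ifP; lia. Qed.
Fact rotate_proof (k : 'I_N) : (rotate_nat k < N)%N.
Proof. by rewrite /rotate_nat; have := ltn_ord k; case: ifP; lia. Qed.
Fact unrotate_proof (k : 'I_N) : (unrotate_nat k < N)%N.
Proof. by rewrite /unrotate_nat; have := ltn_ord k; case: ifP; lia. Qed.

Definition top_flip k : 'I_N := Ordinal (top_flip_proof k).
Definition rotate k : 'I_N := Ordinal (rotate_proof k).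
Definition unrotate k : 'I_N := Ordinal (unrotate_proof k).

Lemma top_flipK : involutive top_flip.
Proof.
move=> k; apply: val_inj => /=; rewrite /top_flip_nat; have := ltn_ord k.
by case: (ltnP k m) => h1; case: ifP => h2; lia.
Qed.

Lemma rotateK : cancel rotate unrotate.
Proof.
move=> k; apply: val_inj => /=; rewrite /unrotate_nat /rotate_nat; have := ltn_ord k.
by case: (boolP (odd k)) => h1; case: ifP => h2; lia.
Qed.

Lemma unrotateK : cancel unrotate rotate.
Proof.
move=> k; apply: val_inj => /=; rewrite /unrotate_nat /rotate_nat; have := ltn_ord k.
by case: (ltnP k m) => h1; case: ifP => h2; lia.
Qed.

Lemma rev_top_flip k : rev_ord (top_flip k) = top_flip (rev_ord k).
Proof.
apply: val_inj => /=; rewrite /top_flip_nat; have := ltn_ord k.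
by case: ifP => h1; case: ifP => h2; lia.
Qed.

Lemma rev_rotate k : rev_ord (rotate k) = rotate (rev_ord k).
Proof.
apply: val_inj => /=; rewrite /rotate_nat; have := ltn_ord k.
by case: ifP => h1; case: ifP => h2; lia.
Qed.

Lemma rev_unrotate k : rotate (rev_ord (unrotate k)) = rev_ord k.
Proof. by rewrite -rev_rotate unrotateK. Qed.

Let N_neq0 : (N%:R : R) != 0.
Proof. by rewrite pnatr_eq0; lia. Qed.

Let step : R := pi / N%:R.

Let stepE : m%:R * step + m%:R * step = pi.
Proof. by rewrite -mulrDl -natrD mulrC divfK. Qed.

Lemma angleE k : angle k = k%:R * step + k%:R * step + step.
Proof. by rewrite /angle -addn1 natrD -addnn natrD /step; ring. Qed.

Let nat_step (a b : nat) : a = b -> a%:R * step = b%:R * step. Proof. by move->. Qed.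

Lemma angle_rev (k : 'I_N) : angle (rev_ord k) = - angle k + pi + pi.
Proof.
have : (rev_ord k + k + 1)%N = N by rewrite /=; have := ltn_ord k; lia.
by move=> /nat_step; rewrite !angleE !natrD !mulrDl mul1r; have := stepE; lra.
Qed.

Lemma angle_top_flip (k : 'I_N) : phase (angle (top_flip k)) = - phase (angle k).
Proof.
rewrite /= /top_flip_nat; case: ltnP => km.
  rewrite -phaseDpi; congr phase; rewrite !angleE natrD mulrDl.
  by have := stepE; lra.
suff -> : angle k = angle (k - m) + pi by rewrite phaseDpi opprK.
by rewrite !angleE natrB // mulrBl; have := stepE; lra.
Qed.

(** In units of [pi / N], twice the angle of [k] is [4 k + 2]. The angle of [unrotate k] is
    [4 k + 1] for [k < m], and [4 k + 3] modulo a full turn otherwise. *)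
Lemma angle_unrotate (k : 'I_N) : exists e : bool,
  phase (angle k) * phase (angle k) = phase (angle (unrotate k) + (-1) ^+ e * step).
Proof.
rewrite -phaseD /= /unrotate_nat; case: ltnP => km.
  exists false; congr phase; rewrite !angleE -addnn natrD expr0; lra.
exists true; rewrite -[RHS]phaseD2pi; congr phase.
rewrite !angleE -addnn -addn1 !natrD natrB // expr1.
by have := stepE; rewrite !mulrDl !mulNr; lra.
Qed.

Definition error_const : R := 2 - 2 * cos step.

Let phi (k : 'I_N) : R[i] := phase (angle k).

Let phi_rev k : phi (rev_ord k) = (phi k)^*.
Proof. by rewrite /phi angle_rev phaseD2pi phase_conj. Qed.

Let phi_norm k : (phi k)^* * phi k = 1.
Proof. exact: phase_norm. Qed.

Definition seed_p_mx : 'M[R[i]]_N := mono (@rev_ord N) (fun=> 1).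
Definition seed_q_mx : 'M[R[i]]_N := mono (@rev_ord N) phi.
Definition seed_s_mx : 'M[R[i]]_N := mono top_flip (fun=> 1).
Definition seed_w_mx : 'M[R[i]]_N := mono rotate (fun=> 1).

Let w_star : star seed_w_mx = mono unrotate (fun=> 1).
Proof.
rewrite (mono_star _ rotateK unrotateK).
by apply: mono_ext => i //; rewrite rmorph1.
Qed.

Let mono_involution (f : 'I_N -> 'I_N) : involutive f ->
  reflection (mono f (fun=> 1) : 'M[R[i]]_N).
Proof.
move=> fK; split.
  by rewrite monoM -mono1; apply: mono_ext => i /=; rewrite ?fK ?mulr1.
by rewrite (mono_star _ fK fK); apply: mono_ext => i //; rewrite rmorph1.
Qed.

(** The error is monomial, and all its entries have the modulus of the difference of two phases one
    step apart; so [star] of it times itself is exactly a scalar. *)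
Lemma phase_seed : seed seed_p_mx seed_q_mx seed_s_mx seed_w_mx (error_const%:C%C).
Proof.
split.
- exact/mono_involution/rev_ordK.
- split.
    rewrite monoM -mono1; apply: mono_ext => i /=; rewrite ?rev_ordK //.
    by rewrite phi_rev phi_norm.
  rewrite (mono_star _ (@rev_ordK N) (@rev_ordK N)); apply: mono_ext => i //.
  by rewrite phi_rev conjCK.
- exact/mono_involution/top_flipK.
- rewrite /unitary w_star !monoM -mono1.
  by split; apply: mono_ext => i /=; rewrite ?rotateK ?unrotateK ?mulr1.
- by rewrite !monoM; apply: mono_ext => i //=; rewrite rev_top_flip.
- rewrite !monoM monoN; apply: mono_ext => i /=; first by rewrite rev_top_flip.
  by rewrite mul1r mulr1 /phi angle_top_flip opprK.
- by rewrite !monoM; apply: mono_ext => i //=; rewrite rev_rotate.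
have -> : seed_w_mx * seed_q_mx * star seed_w_mx - seed_q_mx * seed_p_mx * seed_q_mx =
    mono (@rev_ord N) (fun k => phi (unrotate k) - phi k * phi k).
  rewrite w_star !monoM -monoB; congr (_ - _); apply: mono_ext => k //=.
  + by rewrite rev_unrotate.
  + by rewrite mul1r mulr1.
  + by rewrite rev_ordK.
  + by rewrite rev_ordK mulr1.
rewrite (mono_star _ (@rev_ordK N) (@rev_ordK N)) monoM -mono_scalar.
apply: mono_ext => k /=; rewrite rev_ordK //.
have [e ->] := angle_unrotate k.
rewrite phase_dist /error_const; congr ((2 - 2 * _)%:C%C).
by rewrite opprD addrA subrr add0r cosN; case: e; rewrite ?expr0 ?expr1 ?mul1r ?mulN1r ?cosN.
Qed.

End PhaseSeed.

Local Open Scope classical_set_scope.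

Lemma error_const_cvg (R : realType) :
  ((fun n => @error_const R (2 ^ n)%N) @ \oo --> (0 : R))%classic.
Proof.
have -> : 0 = 2 - 2 * cos 0 :> R by rewrite cos0; ring.
rewrite /error_const; apply: cvgB; first exact: cvg_cst.
apply: cvgM; first exact: cvg_cst.
apply: continuous_cvg; first exact: continuous_cos.
have -> : (fun n => pi / ((2 ^ n + 2 ^ n)%N)%:R) = (fun n => (pi / 2) * (2^-1) ^+ n) :> (nat -> R).
  by apply/funext => n; rewrite addnn -mul2n natrM natrX invfM mulrA exprVn.
rewrite -[X in _ --> X](mulr0 (pi / 2)); apply: cvgM; first exact: cvg_cst.
by apply: cvg_expr; rewrite ger0_norm ?invr_ge0 // invf_lt1 // ltr1n.
Qed.

Section Transport.
Variables (C : numClosedFieldType) (A A' : starAlgType C) (f : A -> A').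
Hypothesis hf : star_embedding f.

Lemma star_embeddingN a : f (- a) = - f a.
Proof. by have [_ _ _ fZ _] := hf; rewrite -!scal_N1 fZ. Qed.

Lemma transport_reflection a : reflection a -> reflection (f a).
Proof.
have [f1 _ fM _ fS] := hf; move=> [aa sa].
by split; [rewrite -fM aa f1|rewrite -fS sa].
Qed.

Lemma transport_full_model p q g s v u x z : full_model p q g s v u x z ->
  full_model (f p) (f q) (f g) (f s) (f v) (f u) (f x) (f z).
Proof.
have [f1 fD fM fZ fS] := hf; have fN := star_embeddingN.
move=> [[rp rq rg rs rv ru gq pgp rgp sp sq pp qq rq' up] rx rz xz cm].
split; try exact: transport_reflection; last first.
- move=> a; rewrite !inE; have cm' b : b \in [:: p; q; g; s; v; u] ->
      f b * f x = f x * f b /\ f b * f z = f z * f b.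
    by move=> /cm[h1 h2]; rewrite -!fM h1 h2.
  by do 5 (case/predU1P=> [->|]; first by apply: cm'; rewrite !inE eqxx ?orbT);
    move/eqP->; apply: cm'; rewrite !inE eqxx ?orbT.
- by rewrite -!fM xz fN.
by split; try exact: transport_reflection; rewrite -!fM -?fN; congr f.
Qed.

Lemma transport_error p q v u c : star (model_error p q v u) * model_error p q v u = scal c 1 ->
  star (model_error (f p) (f q) (f v) (f u)) * model_error (f p) (f q) (f v) (f u) =
  scal c 1.
Proof.
have [f1 fD fM fZ fS] := hf.
have -> : model_error (f p) (f q) (f v) (f u) = f (model_error p q v u).
  by rewrite /model_error -!fM -star_embeddingN -fD.
by rewrite -fS -fM => ->; rewrite fZ f1.
Qed.

End Transport.

(** Indices 0 to 7 stand for [p q f s v u x z]; indexing by [nat] lets the operators serve as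
    generators of star-terms. *)
Definition family_model (C : numClosedFieldType) (A : starAlgType C) (t : nat -> A) :=
  full_model (t 0%N) (t 1%N) (t 2%N) (t 3%N) (t 4%N) (t 5%N) (t 6%N) (t 7%N).

Definition family_error (C : numClosedFieldType) (A : starAlgType C) (t : nat -> A) :=
  model_error (t 0%N) (t 1%N) (t 4%N) (t 5%N).

Lemma matrix_model (R : realType) n :
  exists (d m : nat) (t : nat -> 'M[R[i]]_d), [/\ d = (2 ^ m)%N, family_model t &
    star (family_error t) * family_error t = scal (error_const R (2 ^ n))%:C%C 1].
Proof.
have hs := @phase_seed R (2 ^ n)%N (expn_gt0 2 n).
have [hm he] := model_of_double (double_of_seed hs).
have hf := full_model_of_model hm.
set N := (2 ^ n + 2 ^ n)%N in hs hm he hf.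
(* [N] is [2 ^ n.+1]; the two flips each square the size, and the last factor 2 carries the Pauli
   pair. *)
exists (N * N * (N * N) * 2)%N, (n.+1 + n.+1 + (n.+1 + n.+1) + 1)%N.
set p := seed_p_mx R _ in hs hm he hf; set q := seed_q_mx R _ in hs hm he hf.
set s := seed_s_mx R _ in hs hm he hf; set w := seed_w_mx R _ in hs hm he hf.
move: hf he; rewrite /family_error.
set e := model_error _ _ _ _.
match goal with |- full_model ?p ?q ?f ?s ?v ?u ?x ?z -> _ =>
  move=> hf he; exists (nth 0 [:: p; q; f; s; v; u; x; z]) end.
split; first by rewrite !expnD /N addnn -mul2n -expnS.
  exact: hf.
by rewrite /= model_error_tens tens_star tensM he star1 mulr1 tensZl tens11.
Qed.

Lemma approximate_model (R : realType) n :
  exists t : nat -> bop (hf_space (dyadic_factor R)),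
  [/\ forall k, hf_set (t k), family_model t &
      star (family_error t) * family_error t = scal (error_const R (2 ^ n))%:C%C 1].
Proof.
have [d [m [t [dm ht he]]]] := matrix_model R n.
have [iota [emb inM]] := matrix_embedding R dm.
exists (iota \o t); split=> [k||]; first exact: inM.
  exact: (transport_full_model emb ht).
exact: (transport_error emb he).
Qed.

(** * An exact model in the ultrapower *)

Section FreeUltrafilters.
Variable U : free_ultrafilter.

Lemma ultrafilter_tail N : fu_sets U [set n | (N <= n)%N].
Proof.
have uU := fu_ultra U.
elim: N => [|N IH]; first by apply: filterS filterT.
have : fu_sets U (~` [set N]).
  by case: (in_ultra_setVsetC [set N] uU) => // /(@fu_free U N).
move=> /(filterI IH); apply: filterS => n [/= Nn nN].
by rewrite ltn_neqAle Nn andbT; apply/eqP => e; apply: nN.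
Qed.

Lemma cvg_ultrafilter (T : topologicalType) (u : nat -> T) (l : T) :
  u @ \oo --> l -> u @ (fu_sets U) --> l.
Proof.
move=> h A /h [N _ hN]; apply: filterS (ultrafilter_tail N).
by move=> n /= /hN.
Qed.

End FreeUltrafilters.

Section UltrapowerModel.
Variables (R : realType) (U : free_ultrafilter) (M : hyperfinite_II1_factor R).
Notation A := (ultrapower M U).
Notation B := (bop (hf_space M)).

(** As the difference has scalar square, its 2-norm follows from the trace of 1 and equals the root
    of [c n]. *)
Lemma ultra_null (u v : bdd_seq M) (c : nat -> R) :
  (forall n, star (u n - v n) * (u n - v n) = scal (c n)%:C%C 1) ->
  c @ \oo --> (0 : R) -> qpi (T := ultra_setoid M U) u = qpi (T := ultra_setoid M U) v.
Proof.
move=> uv c0; apply/qpiP.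
have trE n : norm2 (u n - v n) = Num.sqrt (c n).
  have [M1 _ _ _ _] := (hf_factor M).1.1.
  by rewrite /norm2 uv (trZ (hf_trace M)) // (tr1 (hf_trace M)) mulr1.
have : (fun n => Num.sqrt (c n)) @ \oo --> (0 : R).
  rewrite -[X in _ --> X]sqrtr0; apply: continuous_cvg => //; exact: sqrt_continuous.
move=> /(cvg_ultrafilter U).
suff -> : (fun n => Num.sqrt (c n)) = norm2 (M := M) \o (fun n => u n - v n) by [].
by apply/funext => n; rewrite -trE.
Qed.

Lemma ultra_eq (u v : bdd_seq M) : (forall n, u n = v n) ->
  qpi (T := ultra_setoid M U) u = qpi (T := ultra_setoid M U) v.
Proof.
move=> uv; apply: (@ultra_null u v (fun=> 0)) => [n|]; last exact: cvg_cst.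
by rewrite uv subrr mulr0 scal0.
Qed.

Lemma reflection_bounded (T : B) x : reflection T -> hnorm (T x) <= 1 * hnorm x.
Proof.
move=> [TT sT]; rewrite mul1r /hnorm /ip_norm -(adjointC (@bop_adjoint _ _ T)).
rewrite -[bop_adj T _]/((star T * T) x).
by rewrite sT TT.
Qed.

Section Family.
Variable t : nat -> nat -> B.
Hypothesis t_in : forall n k, hf_set (t n k).
Hypothesis t_model : forall n, family_model (t n).
Variable c : nat -> R.
Hypothesis t_err : forall n,
  star (family_error (t n)) * family_error (t n) = scal (c n)%:C%C 1.
Hypothesis c_cvg : c @ \oo --> (0 : R).

Lemma family_reflection n k : (k < 8)%N -> reflection (t n k).
Proof.
have [[]] := t_model n.
by case: k => [|[|[|[|[|[|[|[|]]]]]]]].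
Qed.

(** Nothing is known of the entries of index 8 and more; replacing them by 1 makes every sequence
    bounded. *)
Lemma family_bounded k : exists c : R, forall n x,
  hnorm ((if (k < 8)%N then t n k else 1) x) <= c * hnorm x.
Proof.
exists 1 => n x; case: ifP => [k8|_]; last by rewrite mul1r.
exact/reflection_bounded/family_reflection.
Qed.

Lemma family_in k n : hf_set (if (k < 8)%N then t n k else 1).
Proof. by case: ifP => // _; have [] := (hf_factor M).1.1. Qed.

Definition family_seq k : bdd_seq M := BddSeq (family_in k) (family_bounded k).

Definition ultra_family k : A := qpi (T := ultra_setoid M U) (family_seq k).

Definition family_at n k : B := family_seq k n.

Fixpoint term_seq (e : starTerm R[i] nat) : bdd_seq M :=
  match e with
  | TGen k => family_seq k
  | TZero => bseq_zero M
  | TOne => bseq_one M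
  | TOpp a => bseq_opp (term_seq a)
  | TAdd a b => bseq_add (term_seq a) (term_seq b)
  | TMul a b => bseq_mul (term_seq a) (term_seq b)
  | TScal k a => bseq_scal k (term_seq a)
  | TStar a => bseq_star (term_seq a)
  end.

Lemma term_seqE e n : term_seq e n = interp (family_at n) e.
Proof.
by elim: e => //= [a ->|a -> b ->|a -> b ->|k a ->|a ->].
Qed.

Lemma interp_ultra e : interp ultra_family e = qpi (T := ultra_setoid M U) (term_seq e).
Proof.
elim: e => //= [a ->|a -> b ->|a -> b ->|k a ->|a ->].
- exact: qpiN.
- exact: qpiD.
- exact: qpiM.
- exact: qpiZ.
- exact: qpi_star.
Qed.

(** Transfer: an identity between star-polynomials that holds at every [n] holds in the ultrapower.
    The tactics that follow recover the terms from a goal. *)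
Lemma interp_ultra_eq e e' : (forall n, interp (family_at n) e = interp (family_at n) e') ->
  interp ultra_family e = interp ultra_family e'.
Proof. by move=> ee'; rewrite !interp_ultra; apply: ultra_eq => n; rewrite !term_seqE. Qed.

Local Ltac reify e :=
  match e with
  | ?a * ?b => let x := reify a in let y := reify b in constr:(TMul x y)
  | - ?a => let x := reify a in constr:(TOpp x)
  | star ?a => let x := reify a in constr:(TStar x)
  | 1 => constr:(@TOne R[i] nat)
  | ultra_family ?k => constr:(@TGen R[i] nat k)
  end.

Local Ltac transfer :=
  match goal with |- ?a = ?b =>
    let x := reify a in let y := reify b in
    change (interp ultra_family x = interp ultra_family y);
    apply: interp_ultra_eq => n /=
  end.

Lemma ultra_model : family_model ultra_family /\ family_error ultra_family = 0.
Proof.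
split; last first.
  pose g k := @TGen R[i] nat k.
  pose e := TMul (TMul (g 5) (TMul (TMul (g 4) (g 1)) (g 4))) (g 5).
  pose e' := TMul (TMul (g 1) (g 0)) (g 1).
  apply/eqP; rewrite subr_eq0; apply/eqP.
  change (interp ultra_family e = interp ultra_family e').
  rewrite !interp_ultra; apply: (@ultra_null (term_seq e) (term_seq e') c _ c_cvg) => n.
  by rewrite (term_seqE e n) (term_seqE e' n); exact: t_err.
have refl k : (k < 8)%N -> reflection (ultra_family k).
  move=> k8; split; transfer; rewrite /family_at /= k8;
    by have [h1 h2] := family_reflection n k8.
split; [|exact: refl|exact: refl| |].
- split; try exact: refl; transfer; by have [[]] := t_model n.
- transfer; by have [] := t_model n.
have cm j k : (j < 6)%N -> k \in [:: 6; 7]%N ->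
    ultra_family j * ultra_family k = ultra_family k * ultra_family j.
  move=> j6 k67; transfer; rewrite /family_at /=.
  have -> : (j < 8)%N by apply: leq_trans j6 _.
  have -> : (k < 8)%N by move: k67; rewrite !inE => /orP[] /eqP->.
  have [_ _ _ _ h] := t_model n.
  have [] := h (t n j); last by move: k67; rewrite !inE => /orP[] /eqP-> h6 h7.
  by case: j j6 => [|[|[|[|[|[|]]]]]] //; rewrite !inE eqxx ?orbT.
move=> a; rewrite !inE.
by do 5 (case/predU1P=> [->|]; first by split; apply: cm);
    move/eqP->; split; apply: cm.
Qed.

End Family.
End UltrapowerModel.

Lemma exact_ultra_model (R : realType) (U : free_ultrafilter) :
  exists t : nat -> ultrapower (dyadic_factor R) U, family_model t /\ family_error t = 0.
Proof.
have /choice[t ht] := @approximate_model R.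
exists (ultra_family U (t := t) (fun n => let: And3 h _ _ := ht n in h)
  (fun n => let: And3 _ h _ := ht n in h)).
by apply: ultra_model (@error_const_cvg R) => n; case: (ht n).
Qed.

(** * The two systems *)

(* The spectrum of [a] is finite and invariant under negation, and squaring maps
   it onto itself, hence injectively. *)
Lemma no_matrix_doubling (C : numClosedFieldType) (d : nat) (a b s : 'M[C]_d) :
  (0 < d)%N -> a \in unitmx -> b \in unitmx -> s \in unitmx ->
  b *m a = a *m a *m b -> s *m a = - (a *m s) -> False.
Proof.
move=> d0 ua ub us ba sa.
have [rs charE] := closed_field_poly_normal (char_poly a).
pose S := undup rs.
have memS l : (l \in S) = eigenvalue a l.
  rewrite mem_undup eigenvalue_root_char charE (eqP (char_poly_monic a)) scale1r.
  by rewrite root_prod_XsubC.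
have neg l : l \in S -> - l \in S.
  rewrite !memS => /eigenvalueP[v va v0]; apply/eigenvalueP; exists (v *m s).
    by rewrite -mulmxA sa mulmxN mulmxA va -scalemxAl scaleNr.
  apply: contra v0 => /eqP vs; apply/eqP.
  by rewrite -[v](mulmxK us) vs mul0mx.
have nz l : l \in S -> l != 0.
  rewrite memS => /eigenvalueP[v va v0]; apply: contra v0 => /eqP l0; apply/eqP.
  by rewrite -[v](mulmxK ua) va l0 scale0r mul0mx.
have sq l : l \in S -> exists2 k, k \in S & k ^+ 2 = l.
  rewrite memS => /eigenvalueP[v va v0].
  pose w := v *m invmx b.
  have w0 : w != 0.
    apply: contra v0 => /eqP w0; apply/eqP.
    by rewrite -[v](mulmxKV ub) -/w w0 mul0mx.
  have wa : w *m a *m a = l *: w.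
    rewrite -mulmxA -[a *m a](mulmxK ub) -ba !mulmxA /w mulmxKV // va.
    by rewrite scalemxAl.
  (* Since [a * a] acts on [w] as [k ^+ 2], either [w] is an eigenvector for [k], or
     [w *m a - k *: w] is one for [- k]. *)
  pose k := sqrtC l; have kk : k ^+ 2 = l by exact: sqrtCK.
  have [e|ne] := eqVneq (w *m a) (k *: w).
    by exists k => //; rewrite memS; apply/eigenvalueP; exists w.
  exists (- k); last by rewrite sqrrN.
  rewrite memS; apply/eigenvalueP; exists (w *m a - k *: w); last by rewrite subr_eq0.
  by rewrite mulmxBl wa -scalemxAl scalerBr !scaleNr opprK scalerA -expr2 kk addrC.
have [l lS] : exists l, l \in S.
  have : size (char_poly a) != 1 by rewrite size_char_poly eqSS -lt0n.
  by move=> /closed_rootP[l hl]; exists l; rewrite memS eigenvalue_root_char.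
(* Dropping [- l] loses no square, since [l] remains; the squares of a smaller set would still cover
   [S]. *)
pose S1 := rem (- l) S.
have uS : uniq S by exact: undup_uniq.
have sub : {subset S <= map (fun k => k ^+ 2) S1}.
  move=> x /sq[k kS <-].
  have [->|kl] := eqVneq k (- l).
    rewrite sqrrN; apply: (map_f (fun k => k ^+ 2)); rewrite mem_rem_uniq // inE lS andbT.
    by rewrite -addr_eq0 -mulr2n mulrn_eq0 nz.
  by apply: (map_f (fun k => k ^+ 2)); rewrite mem_rem_uniq // inE kl.
have := uniq_leq_size uS sub; rewrite size_map size_rem ?neg //.
by case: (S) lS => // x s' _; rewrite /= ltnn.
Qed.

Section Anticommutation.
Variable L : language.
Hypothesis L_parity : forall (Y : Type) (s t u v : term Y),
  pp L (fun phi => term_val phi s (+) term_val phi t (+) term_val phi u =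
    term_val phi v).

Lemma minus_one (C : numClosedFieldType) (A : starAlgType C) (w : A) :
  reflection w -> w * w * w = (-1) ^+ true -> w = -1.
Proof. by move=> [ww _]; rewrite ww mul1r expr1. Qed.

(** An involution with cube [-1] is [-1] itself: this names the scalar by an equation. *)
Let eq_a (_ : 'I_1) : equation 'I_3 := (inord 2, inord 2, inord 2, true).
Let comm_a (_ : 'I_1) : 'I_3 * 'I_3 * 'I_3 := (inord 0, inord 1, inord 2).

(** The first tensor factor carries the anticommuting solution, the second the spare pair that
    completes the square. *)
Lemma matrix_not_classical (C : numClosedFieldType) : exists B : bcs_ctx,
  over_language L B /\ matrix_satisfiable C B /\ ~ satisfiable C B.
Proof.
have [B [BL hB]] := bcs_of_commutator_system L_parity eq_a comm_a.
exists B; split=> //; split.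
  exists (2 * 2)%N => //; have [_ sat] := hB C ('M[C]_(2 * 2) : starAlgType C).
  pose o : 'M[C]_2 := 1.
  pose g := nth 1 [:: pauliX C *t o; pauliZ C *t o; -1].
  have rX := pauliX_reflection C; have rZ := pauliZ_reflection C.
  have xz := pauli_anticomm C.
  have r1 (a : 'M[C]_2) : reflection a -> reflection (o *t a).
    by move=> [aa sa]; split; [rewrite tensM aa mulr1 tens11|rewrite tens_star sa star1].
  have rN : reflection (-1 : 'M[C]_(2 * 2)) by exact: (reflection_sign _ true).
  have cm (a b : 'M[C]_2) : (a *t o) * (o *t b) = (o *t b) * (a *t o).
    by rewrite !tensM !mul1r !mulr1.
  apply: (sat (fun i : 'I_3 => g i) (o *t pauliX C) (o *t pauliZ C)).
  - move=> [[|[|[|//]]] ?]; rewrite /g /=; [exact: tens1_reflection..|exact: rN].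
  - move=> j; rewrite /holds /eq_a /g !inordK //=; split=> //.
    by rewrite mulrNN mulr1 mul1r.
  - move=> j; rewrite /commutator_holds /comm_a /g !inordK //= mulN1r mulNr.
    by rewrite !tensM xz tensNl.
  - move=> j; rewrite /commutator_central /comm_a /g !inordK //=.
    by rewrite !mulN1r !mulrN1.
  - exact: r1.
  - exact: r1.
  - by rewrite !tensM xz tensNr.
  - by move=> [[|[|[|//]]] ?]; rewrite /g /GRing.comm /= ?cm // mulN1r mulrN1.
  - by move=> [[|[|[|//]]] ?]; rewrite /g /GRing.comm /= ?cm // mulN1r mulrN1.
have [to _] := hB C (C^o : starAlgType C).
move=> /to[f [rf fe fc]].
have := fe ord0; rewrite /holds /eq_a => -[_ /(minus_one (rf _)) w].
have := fc ord0; rewrite /commutator_holds /comm_a w mulN1r mulNr.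
move=> /eqP; rewrite -addr_eq0 [X in _ + X]mulrC -mulr2n mulrn_eq0 /=.
rewrite mulf_eq0 => /orP[] /eqP e0.
  by have [] := rf (inord 0); rewrite e0 mul0r => /esym/eqP; rewrite oner_eq0.
by have [] := rf (inord 1); rewrite e0 mul0r => /esym/eqP; rewrite oner_eq0.
Qed.

End Anticommutation.

(** * The doubling system *)

Section ConjugationBySwaps.
Variables (C : numClosedFieldType) (A : starAlgType C).

(** The product equation gives [w = b * a], which turns the commutator relation into
    [x * a = b * x]. *)
Lemma conj_of_commutator (x a b w : A) : reflection x -> reflection a -> reflection b ->
  a * b * w = 1 -> x * a = w * a * x -> x * a * x = b.
Proof.
move=> rx ra rb /(triple_solve ra rb)-> ->.
by rewrite -!mulrA rx.1 mulr1 ra.1 mulr1.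
Qed.

Lemma commutator_of_conj (x a : A) : reflection x -> reflection a ->
  GRing.comm a (x * a * x) -> x * a = (a * (x * a * x)) * a * x.
Proof.
move=> rx ra ac; rewrite [a * (x * a * x)]ac -[_ * a * a]mulrA ra.1 mulr1.
by rewrite -mulrA rx.1 mulr1.
Qed.

Lemma commutator_conj_central (x a : A) : reflection x -> reflection a ->
  GRing.comm a (x * a * x) ->
  let w := a * (x * a * x) in w * x = x * w /\ w * a = a * w.
Proof.
move=> rx ra ac /=; split; last by rewrite -mulrA -[_ * a]ac.
by rewrite [in RHS]ac -!mulrA rx.1 mulr1 [x * (x * _)]mulrA rx.1 mul1r.
Qed.

End ConjugationBySwaps.

(* The variables of the second system, by index: p q f s v u (0-5) as in
   [model]; f1 with q = f1 f (6); r = q p q (7); p' = v p v and q' = v q v (8, 9);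
   p'' = f p f (10); the products p p'', p'' r, p p', q q', q' r (11-15);
   -1 (16); s p (17). *)
Definition doubling_eqs : seq (nat * nat * nat * bool) :=
  [:: (6, 2, 1, false); (0, 10, 11, false); (10, 7, 12, false); (0, 8, 13, false);
      (1, 9, 14, false); (9, 7, 15, false); (16, 16, 16, true); (3, 0, 17, false)]%N.

(** As conjugations: [f] takes [p] to [p''], [f1] takes [p''] to [r], [v] takes [p] to [p'] and [q]
    to [q'], [u] takes [p'] to [p] and [q'] to [r]. The last entry makes [s] and [q] anticommute. *)
Definition doubling_comms : seq (nat * nat * nat) :=
  [:: (2, 0, 11); (6, 10, 12); (4, 0, 13); (4, 1, 14); (5, 8, 13); (5, 9, 15);
      (3, 1, 16)]%N.

Definition doubling_eq (j : 'I_8) : equation 'I_18 :=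
  let: (x, y, z, b) := nth (0, 0, 0, false)%N doubling_eqs j in
  (inord x, inord y, inord z, b).

Definition doubling_comm (j : 'I_7) : 'I_18 * 'I_18 * 'I_18 :=
  let: (x, y, w) := nth (0, 0, 0)%N doubling_comms j in (inord x, inord y, inord w).

(** Conjugation by [b = u v] fixes [p] and takes [q] to [q p q], hence [a = p q] to its square; [s]
    commutes with [p] and anticommutes with [q], hence negates [a]. *)
Lemma doubling_not_matrix (C : numClosedFieldType) (d : nat) (f : 'I_18 -> 'M[C]_d) :
  (0 < d)%N -> (forall x, reflection (f x)) -> (forall j, holds f (doubling_eq j)) ->
  (forall j, commutator_holds f (doubling_comm j)) -> False.
Proof.
move=> d0 rf fe fc; pose g k := f (inord k).
have rg k : reflection (g k) by exact: rf.
have [c0 e0] := fe (@Ordinal 8 0 isT); have [c1 e1] := fe (@Ordinal 8 1 isT).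
have [c2 e2] := fe (@Ordinal 8 2 isT); have [c3 e3] := fe (@Ordinal 8 3 isT).
have [c4 e4] := fe (@Ordinal 8 4 isT); have [c5 e5] := fe (@Ordinal 8 5 isT).
have [_ e6] := fe (@Ordinal 8 6 isT); have [c7 e7] := fe (@Ordinal 8 7 isT).
have k0 := fc (@Ordinal 7 0 isT); have k1 := fc (@Ordinal 7 1 isT).
have k2 := fc (@Ordinal 7 2 isT); have k3 := fc (@Ordinal 7 3 isT).
have k4 := fc (@Ordinal 7 4 isT); have k5 := fc (@Ordinal 7 5 isT).
have k6 := fc (@Ordinal 7 6 isT).
rewrite /commutator_holds /doubling_comm /= -!/(g _) in k0 k1 k2 k3 k4 k5 k6.
rewrite -!/(g _) in c0 e0 c1 e1 c2 e2 c3 e3 c4 e4 c5 e5 e6 c7 e7.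
have qE : g 1%N = g 6%N * g 2%N.
  by rewrite (triple_solve (rg _) (rg _) e0) c0.
have p2E := conj_of_commutator (rg _) (rg _) (rg _) e1 k0.
have rE := conj_of_commutator (rg _) (rg _) (rg _) e2 k1.
have p1E := conj_of_commutator (rg _) (rg _) (rg _) e3 k2.
have q1E := conj_of_commutator (rg _) (rg _) (rg _) e4 k3.
(* The product of [p] and [p'] serves both directions: [c3] exchanges its factors, so that [e3] also
   describes the passage from [p'] to [p]. *)
have up := conj_of_commutator (rg _) (rg _) (rg _) (etrans (congr1 (fun z => z * _) (esym c3)) e3) k4.
have uq := conj_of_commutator (rg _) (rg _) (rg _) e5 k5.
have w7 := minus_one (rg _) e6.
have fC : g 2%N * g 6%N = g 1%N by rewrite qE c0.
have r_qpq : g 7%N = g 1%N * g 0%N * g 1%N.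
  by rewrite -rE -p2E -{2}fC qE !mulrA.
have unitr k : g k \in unitmx.
  by have /mulmx1_unit[] : g k *m g k = 1%:M by exact: (rg k).1.
pose a := g 0%N * g 1%N; pose b := g 5%N * g 4%N.
have conjM (x y z : 'M[C]_d) : reflection x -> x * (y * z) * x = (x * y * x) * (x * z * x).
  by move=> rx; rewrite !mulrA -[_ * x * x]mulrA rx.1 mulr1.
apply: (@no_matrix_doubling C d a b (g 3%N) d0).
- by rewrite unitmx_mul !unitr.
- by rewrite unitmx_mul !unitr.
- exact: unitr.
- have e : g 5%N * (g 4%N * a * g 4%N) * g 5%N = a * a.
    have -> : g 4%N * a * g 4%N = g 8%N * g 9%N by rewrite conjM // p1E q1E.
    by rewrite conjM // up uq r_qpq /a !mulrA.
  change (b * a = a * a * b); rewrite -e /b.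
  rewrite -!mulrA [g 5%N * (g 5%N * _)]mulrA (rg _).1 mul1r (rg _).1 mulr1.
  by rewrite !mulrA.
change (g 3%N * a = - (a * g 3%N)).
have sq : g 3%N * g 1%N = - (g 1%N * g 3%N) by rewrite k6 w7 mulN1r mulNr.
by rewrite /a mulrA c7 -[LHS]mulrA sq mulrN mulrA.
Qed.

Section DoublingSystem.
Variable L : language.
Hypothesis L_parity : forall (Y : Type) (s t u v : term Y),
  pp L (fun phi => term_val phi s (+) term_val phi t (+) term_val phi u =
    term_val phi v).

Lemma sat_of_model (C : numClosedFieldType) (A : starAlgType C) (B : bcs_ctx)
  (t : nat -> A) :
  (forall (f : 'I_18 -> A) (u v : A), (forall x, reflection (f x)) ->
      (forall j, holds f (doubling_eq j)) ->
      (forall m, commutator_holds f (doubling_comm m)) ->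
      (forall m, commutator_central f (doubling_comm m)) ->
      reflection u -> reflection v -> u * v = - (v * u) ->
      (forall x, GRing.comm (f x) u) -> (forall x, GRing.comm (f x) v) ->
      sat_in B A) ->
  family_model t -> family_error t = 0 -> sat_in B A.
Proof.
move=> sat [[rp rq rf rs rv ru fq pfp rfp sp sq pp qq rq' up] rx rz xz cm] err.
move: rp rq rf rs rv ru fq pfp rfp sp sq pp qq rq' up rx rz xz cm err.
rewrite /family_error /model_error.
set p := t 0%N; set q := t 1%N; set f := t 2%N; set s := t 3%N; set v := t 4%N.
set u := t 5%N; set X := t 6%N; set Z := t 7%N.
move=> rp rq rf rs rv ru fq pfp rfp sp sq pp qq rq' up rx rz xz cm.
(* The vanishing error is the remaining conjugation, which the finite models satisfy only
   approximately. *)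
move=> /eqP; rewrite subr_eq0 => /eqP uq.
set r := q * p * q in rfp rq' uq; set p2 := f * p * f in pfp rfp.
set p1 := v * p * v in pp up; set q1 := v * q * v in qq rq' uq.
have rp1 : reflection p1 by exact: reflectionJ.
have rq1 : reflection q1 by exact: reflectionJ.
have rp2 : reflection p2 by exact: reflectionJ.
have rr : reflection r by exact: reflectionJ.
pose f1 := q * f; have rf1 : reflection f1 by apply: reflectionM.
(* The order is that of the variables of [doubling_eqs]. The default 1 is a central reflection, so
   the checks on entries hold for every index. *)
pose l := [:: p; q; f; s; v; u; f1; r; p1; q1; p2; p * p2; p2 * r; p * p1; q * q1;
  q1 * r; -1; s * p].
have rN : reflection (-1 : A) by exact: (reflection_sign _ true).
have f1f : f1 * f = q by rewrite /f1 -mulrA rf.1 mulr1.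
have f1C : f1 = f * q by rewrite /f1 fq.
have cf1 : f1 * f = f * f1 by rewrite f1f /f1 -fq mulrA rf.1 mul1r.
have rl k : reflection (nth 1 l k).
  have [kl|kl] := ltnP k (size l); last first.
    by rewrite nth_default //; split; [exact: mulr1|exact: star1].
  have all_l : forall a, List.In a l -> reflection a.
    move=> a; rewrite /l /=; do 11 (case=> [<-|] //).
    do 5 (case=> [<-|]; first by apply: reflectionM => //; exact: esym).
    by do 2 (case=> [<-|] //); apply: reflectionM.
  by move: k kl; do 18 (case=> [_|]; [apply: all_l; rewrite /l /=; tauto|]).
have f1p2 : f1 * p2 * f1 = r.
  by rewrite {2}f1C /f1 /p2 /r -!mulrA [f * (f * q)]mulrA [f * (f * _)]mulrA rf.1 !mul1r.
have p2r : GRing.comm p2 (f1 * p2 * f1) by rewrite f1p2; exact: esym.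
have p1p : GRing.comm p1 (u * p1 * u) by rewrite up; exact: esym.
have q1r : GRing.comm q1 (u * q1 * u) by rewrite uq; exact: esym.
have commT a : (forall b, b \in [:: p; q; f; s; v; u] -> GRing.comm b a) ->
    forall k, GRing.comm (nth 1 l k) a.
  move=> h; have [hp hq hf] : [/\ GRing.comm p a, GRing.comm q a & GRing.comm f a].
    by split; apply: h; rewrite !inE eqxx ?orbT.
  have [hs hv hu] : [/\ GRing.comm s a, GRing.comm v a & GRing.comm u a].
    by split; apply: h; rewrite !inE eqxx ?orbT.
  have cM b c : GRing.comm b a -> GRing.comm c a -> GRing.comm (b * c) a.
    by move=> hb hc; apply/commr_sym/commrM; exact: commr_sym.
  have c1 : GRing.comm 1 a by exact/commr_sym/commr1.
  have cN : GRing.comm (-1) a by exact/commr_sym/commrN1.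
  have hr : GRing.comm r a by apply: (cM (_ * _)) => //; apply: cM.
  have hp1 : GRing.comm p1 a by apply: (cM (_ * _)) => //; apply: cM.
  have hq1 : GRing.comm q1 a by apply: (cM (_ * _)) => //; apply: cM.
  have hp2 : GRing.comm p2 a by apply: (cM (_ * _)) => //; apply: cM.
  do 18 (case=> [|]; [first [by []|by apply: cM]|]).
  by move=> n; rewrite nth_default.
apply: (sat (fun i => nth 1 l i) X Z) => //.
- move=> [[|[|[|[|[|[|[|[|//]]]]]]]] ?]; rewrite /holds /doubling_eq /= !inordK //=;
    split=> //; rewrite ?expr0; try by apply: triple_prod => //; exact: esym.
    by rewrite f1f rq.1.
  by rewrite mulrNN mulr1 mul1r.
- move=> [[|[|[|[|[|[|[|//]]]]]]] ?]; rewrite /commutator_holds /doubling_comm /= !inordK //=.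
  + exact: commutator_of_conj.
  + by have := commutator_of_conj rf1 rp2 p2r; rewrite f1p2.
  + exact: commutator_of_conj.
  + exact: commutator_of_conj.
  + by have := commutator_of_conj ru rp1 p1p; rewrite up pp.
  + by have := commutator_of_conj ru rq1 q1r; rewrite uq.
  by rewrite mulN1r mulNr sq.
- move=> [[|[|[|[|[|[|[|//]]]]]]] ?]; rewrite /commutator_central /doubling_comm /= !inordK //=.
  + exact: commutator_conj_central.
  + by have := commutator_conj_central rf1 rp2 p2r; rewrite f1p2.
  + exact: commutator_conj_central.
  + exact: commutator_conj_central.
  + by have := commutator_conj_central ru rp1 p1p; rewrite up pp.
  + by have := commutator_conj_central ru rq1 q1r; rewrite uq.
  by rewrite !mulN1r !mulrN1.
- by move=> x; apply: commT => b /cm[].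
- by move=> x; apply: commT => b /cm[].
Qed.

Lemma ultra_not_matrix (R : realType) (U : free_ultrafilter) : exists B : bcs_ctx,
  over_language L B /\ RU_satisfiable R U B /\ ~ matrix_satisfiable R[i] B.
Proof.
have [B [BL hB]] := bcs_of_commutator_system L_parity doubling_eq doubling_comm.
exists B; split=> //; split.
  have [t [ht he]] := exact_ultra_model R U.
  exists (dyadic_factor R).
  by have [_ sat] := hB _ (ultrapower (dyadic_factor R) U); apply: sat_of_model sat ht he.
move=> [d d0 /(proj1 (hB _ _))[f [rf fe fc]]].
exact: doubling_not_matrix d0 rf fe fc.
Qed.

End DoublingSystem.

Theorem theorem5p2 (R : realType) (U : free_ultrafilter) (L : language)
  (not_bijunctive : ~ bijunctive L) (not_horn : ~ horn L)
  (not_dual_horn : ~ dual_horn L) :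
  (exists B : bcs_ctx,
     over_language L B /\ matrix_satisfiable R[i] B /\ ~ satisfiable R[i] B) /\
  (exists B : bcs_ctx,
     over_language L B /\ RU_satisfiable R U B /\ ~ matrix_satisfiable R[i] B).
Proof.
have L_parity := pp_parity not_bijunctive not_horn not_dual_horn.
by split; [exact: matrix_not_classical|exact: ultra_not_matrix].
Qed.
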